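(* There exists a polynomial-time algorithm which, given distinct places $v_1,\dots,v_l$ of $\mathbb{F}_{2^k}(t)$ with $l$ even, constructs a quaternion algebra over $\mathbb{F}_{2^k}(t)$ which is ramified exactly at $v_1,\dots,v_l$.
   Context: $\mathbb{F}_{2^k}(t)$ is the rational function field over the field with $2^k$ elements. Its places are the finite ones, corresponding to monic irreducible polynomials $f\in\mathbb{F}_{2^k}[t]$ (and given by these polynomials), and the infinite place $\infty$, with valuation $v_\infty=-\deg$. Over a field $F$ of characteristic $2$, a quaternion algebra is a 4-dimensional $F$-algebra with a basis $1,i,j,ij$ satisfying $i^2+i=a$, $j^2=b$, $ij=j(i+1)$ for some $a\in F$, $b\in F^\times$; constructing it means outputting such parameters $a,b$ (equivalently, structure constants). A quaternion algebra $A$ over $\mathbb{F}_{2^k}(t)$ is ramified at a place $v$ if its base change to the completion of $\mathbb{F}_{2^k}(t)$ at $v$ is a division algebra, i.e. not isomorphic to a $2\times 2$ matrix algebra. The input size is measured by $k$, $l$ and the degrees of the polynomials defining the finite places. Polynomial time means a number of bit operations polynomial in the input size, in the probabilistic sense (random choices allowed, e.g. to find irreducible polynomials in a prescribed residue class). *)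

(* Defs.v *)
From HB Require Import structures.
From mathcomp Require Import all_boot all_order all_algebra all_field.
From mathcomp Require Import generic_quotient ring_quotient zify ring.
From mathcomp Require Import all_classical.

Set Implicit Arguments.
Unset Strict Implicit.
Unset Printing Implicit Defensive.

Import Order.TTheory GRing.Theory Num.Theory.
Local Open Scope ring_scope.
Local Open Scope quotient_scope.

Notation "x %:F" := (FracField.tofrac x) : ring_scope.

(* A valuation with values in [int], i.e. in Z; the valuation of 0 is +oo in
   the mathematics, so the (junk) value of [vfun] at 0 is never used. *)
Record valuation (F : fieldType) := Valuation {
  vfun :> F -> int;
  valM : forall x y, x != 0 -> y != 0 -> vfun (x * y) = vfun x + vfun y;
  valD : forall x y (n : int), x != 0 -> y != 0 -> x + y != 0 ->
    n <= vfun x -> n <= vfun y -> n <= vfun (x + y)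
}.

Section Completion.
Variables (F : fieldType) (v : valuation F).
Implicit Types (x y : F) (n m : int) (u w : nat -> F).

Definition vge n x := (x == 0) || (n <= v x).

Lemma vge0 n : vge n 0. Proof. by rewrite /vge eqxx. Qed.

Lemma vge_nz n x : x != 0 -> vge n x = (n <= v x).
Proof. by rewrite /vge => /negPf->. Qed.

Lemma val1 : v 1 = 0.
Proof.
have := valM v (oner_neq0 F) (oner_neq0 F); rewrite mulr1 => /eqP.
by rewrite eq_sym -subr_eq0 addrK => /eqP.
Qed.

Lemma valV x : x != 0 -> v x^-1 = - v x.
Proof.
move=> x0; have := valM v x0 (invr_neq0 x0); rewrite mulfV // val1 => /eqP.
by rewrite eq_sym addrC addr_eq0 => /eqP.
Qed.

Lemma valN x : x != 0 -> v (- x) = v x.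
Proof.
have m1 : (-1 : F) != 0 by rewrite oppr_eq0 oner_neq0.
have vm1 : v (-1) = 0.
  have := valM v m1 m1; rewrite mulrNN mulr1 val1 => /eqP.
  by rewrite eq_sym -mulr2n mulrn_eq0 /= => /eqP.
by move=> x0; rewrite -mulN1r valM // vm1 add0r.
Qed.

Lemma vgeN n x : vge n (- x) = vge n x.
Proof.
by rewrite /vge oppr_eq0; case: eqVneq => //= x0; rewrite valN.
Qed.

Lemma vgeD n x y : vge n x -> vge n y -> vge n (x + y).
Proof.
have [->|x0] := eqVneq x 0; first by rewrite add0r.
have [->|y0] := eqVneq y 0; first by rewrite addr0.
have [->|xy0] := eqVneq (x + y) 0; first by rewrite vge0.
by rewrite !vge_nz //; apply: valD.
Qed.

Lemma vgeB n x y : vge n x -> vge n y -> vge n (x - y).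
Proof. by move=> hx hy; rewrite vgeD ?vgeN. Qed.

Lemma vgeM n m x y : vge n x -> vge m y -> vge (n + m) (x * y).
Proof.
have [->|x0] := eqVneq x 0; first by rewrite mul0r !vge0.
have [->|y0] := eqVneq y 0; first by rewrite mulr0 !vge0.
by rewrite !vge_nz ?mulf_neq0 // valM //; apply: lerD.
Qed.

Lemma vge_le n m x : m <= n -> vge n x -> vge m x.
Proof.
move=> mn; rewrite /vge => /orP[->//|nx].
by rewrite (le_trans mn nx) orbT.
Qed.

Definition cauchy u :=
  forall n, exists N, forall i j, (N <= i)%N -> (N <= j)%N -> vge n (u i - u j).

Definition null u := forall n, exists N, forall i, (N <= i)%N -> vge n (u i).

Lemma cauchy_bounded u : cauchy u -> exists m, exists N,
  forall i, (N <= i)%N -> vge m (u i).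
Proof.
move=> /(_ 0)[N hN]; exists (Num.min 0 (v (u N))), N => i Ni.
rewrite -(subrK (u N) (u i)); apply: vgeD.
  by apply: vge_le (hN _ _ Ni (leqnn _)); rewrite ge_min lexx.
by rewrite /vge ge_min lexx !orbT.
Qed.

Definition cauchy_pred : {pred (nat -> F)} := fun u => `[< cauchy u >].

Lemma cauchy_subring : subring_closed cauchy_pred.
Proof.
split.
- by apply/asboolP => n; exists 0 => i j _ _; rewrite subrr vge0.
- move=> u w /asboolP cu /asboolP cw; apply/asboolP => n.
  have [N hN] := cu n; have [M hM] := cw n; exists (maxn N M) => i j.
  rewrite !geq_max => /andP[Ni Mi] /andP[Nj Mj].
  have -> : (u - w) i - (u - w) j = (u i - u j) - (w i - w j).
    by rewrite !fctE; ring.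
  by apply: vgeB; [apply: hN|apply: hM].
- move=> u w /asboolP cu /asboolP cw; apply/asboolP => n.
  have [m [N1 h1]] := cauchy_bounded cu; have [p [M1 g1]] := cauchy_bounded cw.
  have [N hN] := cu (n - p); have [M hM] := cw (n - m).
  exists (maxn (maxn N N1) (maxn M M1)) => i j.
  rewrite !geq_max => /andP[/andP[Ni N1i] /andP[Mi M1i]].
  move=> /andP[/andP[Nj N1j] /andP[Mj M1j]].
  have -> : (u * w) i - (u * w) j = (u i - u j) * w i + (w i - w j) * u j.
    by rewrite !fctE; ring.
  apply: vgeD.
    by rewrite -(subrK p n); apply: vgeM; [apply: hN|apply: g1].
  by rewrite -(subrK m n); apply: vgeM; [apply: hM|apply: h1].
Qed.

HB.instance Definition _ := GRing.isSubringClosed.Build (nat -> F) cauchy_pred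
  cauchy_subring.

Definition cauchy_seq := {u : nat -> F | u \in cauchy_pred}.
HB.instance Definition _ := SubChoice.on cauchy_seq.
HB.instance Definition _ := [SubChoice_isSubComNzRing of cauchy_seq by <:].

Definition null_pred : {pred cauchy_seq} := fun s => `[< null (val s) >].

Lemma null_idealr : idealr_closed null_pred.
Proof.
split.
- by apply/asboolP => n; exists 0 => i _; rewrite vge0.
- apply/asboolP => /(_ 1)[N /(_ N (leqnn N))].
  by rewrite /vge rmorph1 /= val1 oner_eq0.
move=> a u w /asboolP nu /asboolP nw; apply/asboolP => n.
have [m [N ha]] := cauchy_bounded (asboolP _ (valP a)).
have [N1 h1] := nu (n - m); have [N2 h2] := nw n.
exists (maxn N (maxn N1 N2)) => i; rewrite !geq_max => /and3P[Ni N1i N2i].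
rewrite rmorphD rmorphM /=.
apply: vgeD; last exact: h2.
by rewrite -(subrKC m n); apply: vgeM; [apply: ha|apply: h1].
Qed.

HB.instance Definition _ := isIdealr.Build cauchy_seq null_pred null_idealr.

(* Cauchy sequences modulo null sequences. *)
Definition completion := {ideal_quot null_pred}.
HB.instance Definition _ := GRing.ComNzRing.on completion.


Lemma not_null_bounded u : cauchy u -> ~ null u ->
  exists m N, forall i, (N <= i)%N -> u i != 0 /\ v (u i) = m.
Proof.
move=> cu /existsNP[n hn]; have [N hN] := cu n.
have [i0 Ni0 ui0] : exists2 i, (N <= i)%N & ~~ vge n (u i).
  apply: contrapT => hno; apply: hn; exists N => i Ni.
  by apply/negPn/negP => ui; apply: hno; exists i.
have ui00 : u i0 != 0 by apply: contraNneq ui0 => ->; rewrite vge0.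
have vui0 : v (u i0) < n by move: ui0; rewrite vge_nz // -ltNge.
exists (v (u i0)), N => i Ni; have hd := hN i i0 Ni Ni0.
have ui : u i != 0.
  apply: contraNneq ui0 => ui; move: hd.
  by rewrite ui sub0r vgeN.
split=> //; apply/eqP; rewrite eq_le; apply/andP; split.
  rewrite leNgt; apply/negP => lt.
  have : vge (v (u i0) + 1) (u i0).
    rewrite -[X in vge _ X](subKr (u i)); apply: vgeB.
      by rewrite vge_nz // lezD1.
    by apply: vge_le hd; rewrite lezD1.
  by rewrite vge_nz // lezD1 ltxx.
have : vge (v (u i0)) (u i).
  rewrite -(subrK (u i0) (u i)); apply: vgeD; last by rewrite vge_nz.
  by apply: vge_le hd; apply: ltW.
by rewrite vge_nz.
Qed.

Lemma cauchyV u : cauchy u -> ~ null u -> cauchy (fun i => (u i)^-1).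
Proof.
move=> cu nu n; have [m [N hN]] := not_null_bounded cu nu.
have [M hM] := cu (n + m + m).
exists (maxn N M) => i j; rewrite !geq_max => /andP[Ni Mi] /andP[Nj Mj].
have [ui vui] := hN i Ni; have [uj vuj] := hN j Nj.
have -> : (u i)^-1 - (u j)^-1 = - ((u i - u j) * ((u i)^-1 * (u j)^-1)).
  by field; rewrite ui uj.
have -> : n = (n + m + m) + (- m + - m) by ring.
rewrite vgeN; apply: vgeM; first exact: hM.
by apply: vgeM; rewrite vge_nz ?invr_eq0 // valV // ?vui ?vuj.
Qed.

Lemma completion_unit (z : completion) : z != 0 -> exists t, t * z = 1.
Proof.
elim/quotW: z => s s0.
have ns : ~ null (val s).
  move=> ns; case/eqP: s0; apply/eqP.
  by rewrite -[0](rmorph0 \pi_completion) eqmodE /= /Quotient.equiv subr0; apply/asboolP.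
have cs : cauchy (val s) by apply/asboolP/(valP s).
pose t : cauchy_seq := Sub (fun i => (val s i)^-1) (asboolT (cauchyV cs ns)).
exists (\pi t); rewrite -rmorphM -(rmorph1 \pi_completion); apply/eqP.
rewrite eqmodE /= /Quotient.equiv; apply/asboolP => n.
have [m [N hN]] := not_null_bounded cs ns; exists N => i Ni.
rewrite rmorphB rmorphM rmorph1 /= !fctE /=.
by rewrite mulVf ?subrr ?vge0 //; case: (hN i Ni).
Qed.

Definition completion_inv (z : completion) : completion :=
  if pselect (exists t, t * z = 1) is left h then projT1 (cid h) else 0.

Lemma completion_mulVf (z : completion) : z != 0 -> completion_inv z * z = 1.
Proof.
rewrite /completion_inv => /completion_unit ex; case: pselect => // h.
by case: cid.
Qed.

Lemma completion_inv0 : completion_inv 0 = 0.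
Proof.
rewrite /completion_inv; case: pselect => // h; case: cid => y /= /eqP.
by rewrite mulr0 eq_sym oner_eq0.
Qed.

HB.instance Definition _ := GRing.ComNzRing_isField.Build completion
  completion_mulVf completion_inv0.

Lemma cst_cauchy x : (fun=> x : F) \in cauchy_pred.
Proof. by apply/asboolP => n; exists 0 => i j _ _; rewrite subrr vge0. Qed.

(* The canonical embedding of F: constant sequences. *)
Definition to_completion x : completion :=
  \pi_completion (Sub (fun=> x) (cst_cauchy x) : cauchy_seq).

Lemma to_completion_zmod : zmod_morphism to_completion.
Proof. by move=> x y; rewrite /to_completion -rmorphB; congr \pi; apply: val_inj. Qed.

Lemma to_completion_monoid : monoid_morphism to_completion.
Proof.
split=> [|x y]; rewrite /to_completion.
  by rewrite -(rmorph1 \pi_completion); congr \pi; apply: val_inj.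
by rewrite -rmorphM; congr \pi; apply: val_inj.
Qed.

HB.instance Definition _ := GRing.isZmodMorphism.Build F completion
  to_completion to_completion_zmod.
HB.instance Definition _ := GRing.isMonoidMorphism.Build F completion
  to_completion to_completion_monoid.

End Completion.

Section Places.
Variable k : fieldType.
Implicit Types (f p q : {poly k}) (x y : {fraction {poly k}}).

Definition is_prime_poly f := (f \is monic) && `[< irreducible_poly f >].

(* [None] is the infinite place. *)
Definition place := option {f : {poly k} | is_prime_poly f}.

(* [v] on polynomials: the multiplicity of f, resp. minus the degree. *)
Definition pord (v : place) p : int :=
  if v is Some f then (\max_(i < size p | (sval f ^+ i %| p)%R) i)%N%:Z
  else - (size p).-1%:Z.

Lemma prime_poly_factor f p : is_prime_poly f -> p != 0 ->
  exists m q, p = f ^+ m * q /\ ~~ (f %| q).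
Proof.
move=> /andP[fm /asboolP fi]; have [n] := ubnP (size p).
elim: n p => // n IH p pn p0; have [fp|nfp] := boolP (f %| p); last first.
  by exists 0%N, p; rewrite mul1r.
have q0 : p %/ f != 0 by rewrite divp_eq0 !negb_or p0 monic_neq0 //= -leqNgt dvdp_leq.
have [||m [q [qE nq]]] := IH (p %/ f); rewrite //.
  rewrite size_divp ?monic_neq0 //; have [f1 _] := fi.
  have := size_poly_gt0 p; rewrite p0 => sp.
  rewrite ltnS in pn; apply: leq_trans pn; rewrite ltn_subrL sp andbT.
  by case: (size f) f1 => [|[|]].
by exists m.+1, q; rewrite -(divpK fp) qE exprSr mulrAC.
Qed.

Lemma prime_poly_coprime f p i : is_prime_poly f -> ~~ (f %| p) ->
  coprimep (f ^+ i) p.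
Proof.
move=> /andP[fm /asboolP fi] nf.
by apply: coprimep_expl; rewrite irreducible_poly_coprime.
Qed.

Lemma pord_factor f (fP : is_prime_poly f) m q : q != 0 -> ~~ (f %| q) ->
  pord (Some (exist _ f fP)) (f ^+ m * q) = m.
Proof.
move=> q0 nq /=; congr Posz; have /andP[fm /asboolP [f1 _]] := fP.
have f0 := monic_neq0 fm.
have fp i : (f ^+ i %| f ^+ m * q) = (i <= m)%N.
  by rewrite Gauss_dvdpl ?prime_poly_coprime // dvdp_Pexp2l.
apply/eqP; rewrite eqn_leq; apply/andP; split.
  by apply/bigmax_leqP => i; rewrite fp.
have ms : (m < size (f ^+ m * q)%R)%N.
  rewrite size_mul ?expf_neq0 //; have := size_exp f m.
  have : (m <= (size f).-1 * m)%N by rewrite leq_pmull // -subn1 subn_gt0.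
  have := expf_neq0 m f0; have := q0; rewrite -!size_poly_gt0.
  case: (size q) => // a _; case: (size (f ^+ m)%R) => // b _ /=.
  by rewrite addnS /= => + bE; rewrite -bE => /leq_ltn_trans -> //; lia.
apply: (@leq_bigmax_cond _ _ (fun i : 'I_(size (f ^+ m * q)%R) => i : nat)
  (Ordinal ms)).
by rewrite fp.
Qed.

Lemma pordM v p q : p != 0 -> q != 0 -> pord v (p * q) = pord v p + pord v q.
Proof.
case: v => [[f fP]|] p0 q0; last first.
  rewrite /= size_mul // -opprD -PoszD; congr (- Posz _).
  move: p0 q0; rewrite -!size_poly_gt0.
  by case: (size p) (size q) => // a [|b] // _ _; rewrite addSn addnS.
have [m [p' [pE np]]] := prime_poly_factor fP p0.
have [n [q' [qE nq]]] := prime_poly_factor fP q0.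
have p'0 : p' != 0 by apply: contraNneq np => ->.
have q'0 : q' != 0 by apply: contraNneq nq => ->.
rewrite pE qE (pord_factor fP) // (pord_factor fP) //.
have -> : f ^+ m * p' * (f ^+ n * q') = f ^+ (m + n) * (p' * q').
  by rewrite exprD; ring.
rewrite (pord_factor fP) ?mulf_neq0 //.
by rewrite -[f]expr1 Gauss_dvdpr ?prime_poly_coprime.
Qed.

Lemma pord_ge f (fP : is_prime_poly f) p (n : nat) : p != 0 ->
  (n%:Z <= pord (Some (exist _ f fP)) p) = (f ^+ n %| p).
Proof.
move=> p0; have [m [q [-> nq]]] := prime_poly_factor fP p0.
have q0 : q != 0 by apply: contraNneq nq => ->.
have /andP[fm /asboolP [f1 _]] := fP.
rewrite (pord_factor fP) // lez_nat Gauss_dvdpl ?prime_poly_coprime //.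
by rewrite dvdp_Pexp2l.
Qed.

Lemma pordD v p q (n : int) : p != 0 -> q != 0 -> p + q != 0 ->
  n <= pord v p -> n <= pord v q -> n <= pord v (p + q).
Proof.
case: v => [[f fP]|] p0 q0 pq0.
  case: n => [n|n] hp hq; last by rewrite (le_trans _ (_ : 0 <= _)).
  by move: hp hq; rewrite !pord_ge //; apply: dvdp_add.
rewrite /= !(lerNr n) => hp hq.
have [/leq_trans|] := leqP (size (p + q)) (maxn (size p) (size q)).
  move=> _; have := size_polyD p q; rewrite leq_max => /orP[] h.
    by apply: le_trans hp; rewrite lez_nat -!subn1 leq_sub2r.
  by apply: le_trans hq; rewrite lez_nat -!subn1 leq_sub2r.
by rewrite ltnNge size_polyD.
Qed.

Definition ford (v : place) x : int :=
  pord v \n_(repr x) - pord v \d_(repr x).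


Lemma frac_repr x : x = (\n_(repr x))%:F / (\d_(repr x))%:F.
Proof.
have d0 : \d_(repr x) != 0 by exact: denom_ratioP.
rewrite -{1}[x]reprK; move: (repr x) d0 => r d0.
have d0' : (\d_r)%:F != 0 by rewrite tofrac_eq0.
apply: (mulIf d0'); rewrite divfK //.
unlock FracField.tofrac; rewrite -[LHS]FracField.pi_mul; apply/eqP.
rewrite FracField.equivf_def /FracField.mulf /=.
by rewrite !numden_Ratio ?mulf_neq0 ?oner_neq0 //= !mulr1 mulrC.
Qed.

Lemma ford_frac v p q : p != 0 -> q != 0 ->
  ford v (p%:F / q%:F) = pord v p - pord v q.
Proof.
move=> p0 q0; rewrite /ford; set x := p%:F / q%:F.
have d0 : \d_(repr x) != 0 by exact: denom_ratioP.
have x0 : x != 0 by rewrite mulf_neq0 ?invr_eq0 ?tofrac_eq0.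
have n0 : \n_(repr x) != 0.
  by apply: contraNneq x0 => n0; rewrite (frac_repr x) n0 tofrac0 mul0r.
have e : p * \d_(repr x) = \n_(repr x) * q.
  apply/eqP; rewrite -tofrac_eq !tofracM -eqr_div ?tofrac_eq0 //.
  by rewrite -frac_repr.
have := pordM v p0 d0; rewrite e pordM // => e'.
by rewrite -(addrK (pord v \d_(repr x)) (pord v p)) -e'; ring.
Qed.

Lemma ford_factor x : x != 0 ->
  exists p q, [/\ p != 0, q != 0 & x = p%:F / q%:F].
Proof.
move=> x0; exists \n_(repr x), \d_(repr x); split; last exact: frac_repr.
  by apply: contraNneq x0 => n0; rewrite (frac_repr x) n0 tofrac0 mul0r.
exact: denom_ratioP.
Qed.

Lemma fordM v x y : x != 0 -> y != 0 -> ford v (x * y) = ford v x + ford v y.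
Proof.
move=> /ford_factor[p [q [p0 q0 ->]]] /ford_factor[r [s [r0 s0 ->]]].
rewrite mulf_div -!tofracM !ford_frac ?mulf_neq0 // !pordM //; ring.
Qed.

Lemma fordD v x y (n : int) : x != 0 -> y != 0 -> x + y != 0 ->
  n <= ford v x -> n <= ford v y -> n <= ford v (x + y).
Proof.
move=> /ford_factor[p [q [p0 q0 ->]]] /ford_factor[r [s [r0 s0 ->]]].
rewrite addf_div ?tofrac_eq0 // -!tofracM -tofracD => xy0.
have e0 : p * s + r * q != 0.
  by apply: contraNneq xy0 => ->; rewrite tofrac0 mul0r.
rewrite !ford_frac ?mulf_neq0 // !lerBrDr => h1 h2; apply: pordD => //.
- exact: mulf_neq0.
- exact: mulf_neq0.
- by rewrite !pordM // addrA lerD2r.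
- by rewrite !pordM // addrA addrAC lerD2r.
Qed.

Definition place_val v : valuation {fraction {poly k}} :=
  Valuation (@fordM v) (@fordD v).

End Places.

Notation ratfun k := {fraction {poly k}}.

(* [quat a b] is the free K-module on 1, i, j, ij with the multiplication
   defined by i^2 = i + a, j^2 = b, i j = j (1 - i).  It is associative over
   any field; over a field of characteristic 2 the relations are
   i^2 + i = a, j^2 = b, i j = j (i + 1), see [quat_i2], [quat_j2], [quat_ij].
   It is a quaternion algebra when b != 0. *)
Section Quaternion.
Variable K : fieldType.

Record quat (a b : K) : Type := Quat { q0 : K; q1 : K; q2 : K; q3 : K }.

Variables a b : K.
Implicit Types (x y : quat a b) (c : K).

Definition quat_tuple x := (q0 x, q1 x, q2 x, q3 x).
Definition tuple_quat (t : K * K * K * K) : quat a b :=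
  let: (x0, x1, x2, x3) := t in Quat a b x0 x1 x2 x3.

Lemma quat_tupleK : cancel quat_tuple tuple_quat. Proof. by case. Qed.

HB.instance Definition _ := Choice.copy (quat a b) (can_type quat_tupleK).

Definition quat0 : quat a b := Quat a b 0 0 0 0.
Definition quat1 : quat a b := Quat a b 1 0 0 0.
Definition quati : quat a b := Quat a b 0 1 0 0.
Definition quatj : quat a b := Quat a b 0 0 1 0.
Definition quatij : quat a b := Quat a b 0 0 0 1.

Definition quat_opp x : quat a b :=
  let: Quat x0 x1 x2 x3 := x in Quat a b (- x0) (- x1) (- x2) (- x3).

Definition quat_add x y : quat a b :=
  let: Quat x0 x1 x2 x3 := x in let: Quat y0 y1 y2 y3 := y in
  Quat a b (x0 + y0) (x1 + y1) (x2 + y2) (x3 + y3).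

Definition quat_scale c x : quat a b :=
  let: Quat x0 x1 x2 x3 := x in Quat a b (c * x0) (c * x1) (c * x2) (c * x3).

Definition quat_mul x y : quat a b :=
  let: Quat x0 x1 x2 x3 := x in let: Quat y0 y1 y2 y3 := y in
  Quat a b
    (x0 * y0 + a * x1 * y1 + b * x2 * y2 + b * x2 * y3 - a * b * x3 * y3)
    (x0 * y1 + x1 * y0 + x1 * y1 - b * x2 * y3 + b * x3 * y2)
    (x0 * y2 + x2 * y0 + x2 * y1 + a * x1 * y3 - a * x3 * y1)
    (x0 * y3 + x3 * y0 + x1 * y2 - x2 * y1 + x1 * y3).

Lemma quat_addA : associative quat_add.
Proof. move=> [????] [????] [????]; congr Quat; ring. Qed.

Lemma quat_addC : commutative quat_add.
Proof. move=> [????] [????]; congr Quat; ring. Qed.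

Lemma quat_add0 : left_id quat0 quat_add.
Proof. move=> [????]; congr Quat; ring. Qed.

Lemma quat_addN : left_inverse quat0 quat_opp quat_add.
Proof. move=> [????]; congr Quat; ring. Qed.

HB.instance Definition _ := GRing.isZmodule.Build (quat a b)
  quat_addA quat_addC quat_add0 quat_addN.

Lemma quat_mulA : associative quat_mul.
Proof. move=> [????] [????] [????]; congr Quat; ring. Qed.

Lemma quat_mul1l : left_id quat1 quat_mul.
Proof. move=> [????]; congr Quat; ring. Qed.

Lemma quat_mul1r : right_id quat1 quat_mul.
Proof. move=> [????]; congr Quat; ring. Qed.

Lemma quat_mulDl : left_distributive quat_mul +%R.
Proof. move=> [????] [????] [????]; congr Quat; ring. Qed.

Lemma quat_mulDr : right_distributive quat_mul +%R.
Proof. move=> [????] [????] [????]; congr Quat; ring. Qed.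

Lemma quat1_neq0 : quat1 != 0.
Proof. by apply/eqP => -[/eqP]; rewrite oner_eq0. Qed.

HB.instance Definition _ := GRing.Zmodule_isNzRing.Build (quat a b)
  quat_mulA quat_mul1l quat_mul1r quat_mulDl quat_mulDr quat1_neq0.

Lemma quat_scaleA c d x : quat_scale c (quat_scale d x) = quat_scale (c * d) x.
Proof. case: x => [????]; congr Quat; ring. Qed.

Lemma quat_scale1 : left_id 1 quat_scale.
Proof. move=> [????]; congr Quat; ring. Qed.

Lemma quat_scaleDr : right_distributive quat_scale +%R.
Proof. move=> c [????] [????]; congr Quat; ring. Qed.

Lemma quat_scaleDl x : {morph quat_scale^~ x : c d / c + d}.
Proof. case: x => [????] c d; congr Quat; ring. Qed.

HB.instance Definition _ := GRing.Zmodule_isLmodule.Build K (quat a b)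
  quat_scaleA quat_scale1 quat_scaleDr quat_scaleDl.

Lemma quat_scalerAl c x y : c *: (x * y) = (c *: x) * y.
Proof. case: x => [????]; case: y => [????]; congr Quat; ring. Qed.

HB.instance Definition _ := GRing.Lmodule_isLalgebra.Build K (quat a b)
  quat_scalerAl.

Lemma quat_scalerAr c x y : c *: (x * y) = x * (c *: y).
Proof. case: x => [????]; case: y => [????]; congr Quat; ring. Qed.

HB.instance Definition _ := GRing.Lalgebra_isAlgebra.Build K (quat a b)
  quat_scalerAr.

Lemma quat_basis x :
  x = q0 x *: 1 + q1 x *: quati + q2 x *: quatj + q3 x *: quatij.
Proof. case: x => [????]; congr Quat => /=; ring. Qed.

Lemma quat_i2 : 2%N \in [pchar K] -> quati ^+ 2 + quati = a%:A.
Proof.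
move=> K2; have e : (1 + 1 : K) = 0 by rewrite -mulr2n (mulrn_pchar K2).
congr Quat; try ring.
by rewrite -[RHS]addr0 -[X in _ = _ + X]e; ring.
Qed.

Lemma quat_j2 : quatj ^+ 2 = b%:A.
Proof. congr Quat; ring. Qed.

Lemma quat_ijE : quati * quatj = quatij.
Proof. congr Quat; ring. Qed.

Lemma quat_ij : 2%N \in [pchar K] -> quati * quatj = quatj * (quati + 1).
Proof.
move=> K2; have e : (1 + 1 : K) = 0 by rewrite -mulr2n (mulrn_pchar K2).
congr Quat; try ring.
  by rewrite -[LHS]addr0 -[X in _ + X = _]e; ring.
by rewrite -[RHS]addr0 -[X in _ = _ + X]e; ring.
Qed.

End Quaternion.

Section BaseChange.
Variables (F K : fieldType) (phi : {rmorphism F -> K}) (a b : F).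

Definition quat_map (x : quat a b) : quat (phi a) (phi b) :=
  Quat _ _ (phi (q0 x)) (phi (q1 x)) (phi (q2 x)) (phi (q3 x)).

Lemma quat_map_zmod : zmod_morphism quat_map.
Proof. by move=> [????] [????]; congr Quat; rewrite /= rmorphB. Qed.

Lemma quat_map_monoid : monoid_morphism quat_map.
Proof.
split=> [|[????] [????]]; congr Quat;
  by rewrite /= ?(rmorph1, rmorph0, rmorphD, rmorphN, rmorphM).
Qed.

End BaseChange.

Lemma completion_pchar (k : fieldType) (v : valuation (ratfun k)) :
  [pchar completion v] =i [pchar k].
Proof.
move=> p; have e : ((p%:R == 0 :> completion v) = (p%:R == 0 :> k)).
  rewrite -(rmorph_nat (@to_completion _ v)) fmorph_eq0.
  by rewrite -(rmorph_nat (@FracField.tofrac {poly k})) tofrac_eq0 -polyC_natr polyC_eq0.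
by rewrite !inE e.
Qed.

Lemma qfpoly_pchar2 (h : {poly 'F_2}) (hI : monic_irreducible_poly h) :
  2%N \in [pchar {poly %/ h with hI}].
Proof.
rewrite inE /= -(rmorph_nat (in_alg {poly %/ h with hI})).
by rewrite (_ : 2%:R = 0) ?rmorph0 //; apply/eqP.
Qed.

Definition division_algebra (A : nzRingType) :=
  forall x : A, x != 0 -> exists y, x * y = 1 /\ y * x = 1.

(* Extension of scalars along F -> F_v keeps the structure constants, so the
   base change of [quat a b] is the [quat] on the images of a and b, the
   canonical map to it being [quat_map]. *)
Definition ramified (k : fieldType) (a b : ratfun k) (v : place k) :=
  division_algebra (quat (to_completion (place_val v) a)
                         (to_completion (place_val v) b)).

(* Structured programs over stacks of bits: each elementary instruction
   inspects or changes O(1) bits.  Two stacks are a tape, so these are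
   probabilistic multitape Turing machines with structured control. *)
Inductive program :=
| Push of nat & bool
| Pop of nat
| Flip of nat                   (* push a fair random bit *)
| Seq of program & program
| Case of nat & program & program & program  (* top is: absent, 0, 1 *)
| While of nat & program.       (* while the stack is nonempty *)

Definition store := nat -> seq bool.

Definition upd (s : store) (i : nat) (w : seq bool) : store :=
  fun j => if j == i then w else s j.

(* The list of programs that remain to be run, and the store. *)
Definition config := (seq program * store)%type.

(* One step; [c] is a fresh random bit, used by [Flip] only. *)
Definition step (g : config) (c : bool) : config :=
  let: (ps, s) := g in
  match ps with
  | [::] => g
  | Push i b :: ps => (ps, upd s i (b :: s i))
  | Pop i :: ps => (ps, upd s i (behead (s i)))
  | Flip i :: ps => (ps, upd s i (c :: s i))
  | Seq p q :: ps => (p :: q :: ps, s)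
  | Case i p p0 p1 :: ps =>
      (match s i with [::] => p | b :: _ => if b then p1 else p0 end :: ps, s)
  | While i p :: ps' =>
      (if s i is [::] then ps' else [:: p, While i p & ps'], s)
  end.

(* The input is on stack 0 initially, the output on stack 0 finally. *)
Definition start (P : program) (x : seq bool) : config :=
  ([:: P], fun i => if i == 0%N then x else [::]).

Definition run P x (coins : seq bool) : config := foldl step (start P x) coins.

Definition halted (g : config) := nilp g.1.

(* [y] is output for some sequence of random bits. *)
Definition may_output P x y :=
  exists coins, halted (run P x coins) /\ (run P x coins).2 0%N = y.

(* The probability that the running time is > n. *)
Definition prob_running P x n : rat :=
  #|[set w : n.-tuple bool | ~~ halted (run P x w)]|%:R / (2 ^ n)%:R.

(* The expectation of the running time, the sum over n of the probabilities
   that it is > n, is at most B. *)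
Definition expected_time_le P x (B : nat) :=
  forall N, \sum_(n < N) prob_running P x n <= B%:R.

(* A prefix-free code of sequences from a prefix-free code of the items. *)
Definition enc_seq (T : Type) (enc : T -> seq bool) (s : seq T) : seq bool :=
  flatten [seq true :: enc x | x <- s] ++ [:: false].

(* The coefficients, from the constant one to the leading one. *)
Definition enc_poly (R : nzRingType) (enc : R -> seq bool) (p : {poly R}) :=
  enc_seq enc p.

Definition enc_poly2 : {poly 'F_2} -> seq bool :=
  enc_poly (fun c : 'F_2 => [:: c != 0]).

Section Encoding.
Variables (h : {poly 'F_2}) (hI : monic_irreducible_poly h).
Local Notation k := {poly %/ h with hI}.

(* By the representative of degree < deg h. *)
Definition enc_field (c : k) : seq bool := enc_poly2 c.

Definition enc_place (v : place k) : seq bool :=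
  if v is Some f then true :: enc_poly enc_field (sval f) else [:: false].

Definition enc_input (vs : seq (place k)) : seq bool :=
  enc_poly2 h ++ enc_seq enc_place vs.

(* [y] encodes fractions that represent a and b. *)
Definition enc_output (a b : ratfun k) (y : seq bool) :=
  exists p q r s : {poly k},
    [/\ q != 0, s != 0, a = p%:F / q%:F, b = r%:F / s%:F &
        y = enc_poly enc_field p ++ enc_poly enc_field q ++
            enc_poly enc_field r ++ enc_poly enc_field s].

End Encoding.

Definition place_degree (k : fieldType) (v : place k) : nat :=
  if v is Some f then (size (sval f)).-1 else 0.

Definition input_size (k : nat) (F : fieldType) (vs : seq (place F)) : nat :=
  (k + size vs + \sum_(v <- vs) place_degree v)%N.

(* Main.v *)
From HB Require Import structures.
Require Import Defs.
From mathcomp Require Import all_boot all_order all_algebra all_field.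
From mathcomp Require Import generic_quotient ring_quotient zify ring.
From mathcomp Require Import all_classical.

(** Write q = 2^k and wp(w) = w^2 + w. The algorithm needs no search and no
    random choice, because every class can be written with b = t: the
    differentials a dt / t are all the differentials of F_q(t), and the
    invariant of [a, t) at a place v is the trace to F_2 of the residue of
    a dt / t at v (Schmid's formula). So it is enough to write down a
    differential with simple poles whose residues have trace 1 at the given
    finite places and at no other finite place; the residue theorem then takes
    care of infinity, as the number of places is even. By Euler's formula
    Tr (t^(d-1) / f'(t)) = 1 for f irreducible of degree d, so that

      a = c * sum_f t^(deg f) / f,   c = x^(k-1) / h'(x),

    has these residues, the sum being over the finite places f and c being, by
    the same formula, an element of trace 1 of F_q = F_2[x] / h.

    The proof replaces residues and traces by elementary facts. Over a field K
    of characteristic 2 in which t is not a square, [a, t) is split if and only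
    if a lies in wp(K) + t K^2 ([quat_split], [quat_division]); approximation
    and the convergence of e + e^2 + e^4 + ... for v(e) > 0 turn this, for the
    completion at v, into the question whether a lies in wp(F) + t F^2 up to
    elements of positive valuation ([ramified_split]). Let f be a finite place
    other than t, and f = A^2 + t B^2. The identity
    B^2 (w^2 + t u^2) = (B w + A u)^2 + f u^2, whose right-hand side has no
    cancellation, shows that elements without a pole at f are split
    ([split_of_integral]) and that a split c t^d / f would give y with
    y^2 + A y + c t^d = 0 modulo f ([pole_reduction]). Such a y does not exist
    when c is not in wp(F_q) ([residue_obstruction]); this is the place where
    Euler's formula and the reciprocity law are replaced by a computation with
    polynomials. At t and at infinity the valuation of t is odd, the residue
    field is F_q, and a is congruent to c or to 0 ([not_split_const]). All this
    is collected in [ramified_place_sum], and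
    [trace_one_not_artin_schreier] gives c.

    The program keeps polynomials P, Q in F_2[X][t] with
    P / (t Q) = sum_f t^(deg f) / f, and turns them into bit lists by Kronecker's
    substitution t -> X^d, where d is the length of the input: this exceeds
    the X-degrees that occur, so that the substitution can be undone by
    cutting into blocks of length d ([chop_kronecker]). Multiplication is then
    Horner's rule for lists of bits. Only the final output is reduced modulo h,
    block by block ([reduce_spec]), and trimmed ([coef_textE]). Its numerator
    is X^(k-1) P and its denominator t h' Q ([output_correct]). All stacks
    stay polynomially bounded and every loop consumes one of them
    ([Main_spec]), and the run is deterministic, so that the expected time is
    bounded by the time of this run ([expected_time_exec]). *)

Set Implicit Arguments.
Unset Strict Implicit.
Unset Printing Implicit Defensive.

(** * Runs of stack programs *)

(** Runs that toss no coin: none of the rules reads a random bit, so that a run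
    has a definite length. *)
Inductive big_step : program -> store -> store -> nat -> Prop :=
| EvPush i b s : big_step (Push i b) s (upd s i (b :: s i)) 1
| EvPop i s : big_step (Pop i) s (upd s i (behead (s i))) 1
| EvSeq p q s s1 s2 m n : big_step p s s1 m -> big_step q s1 s2 n ->
    big_step (Seq p q) s s2 (m + n).+1
| EvCase i p p0 p1 s s' n :
    big_step (match s i with [::] => p | b :: _ => if b then p1 else p0 end) s s' n ->
    big_step (Case i p p0 p1) s s' n.+1
| EvWhile0 i p s : s i = [::] -> big_step (While i p) s s 1
| EvWhile1 i p s s1 s2 m n : s i <> [::] -> big_step p s s1 m ->
    big_step (While i p) s1 s2 n -> big_step (While i p) s s2 (m + n).+1.

Lemma big_step_foldl p s s' n : big_step p s s' n -> forall ps w, size w = n ->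
  foldl step (p :: ps, s) w = (ps, s').
Proof.
elim=> {p s s' n}.
- by move=> i b s ps [|c [|? ?]].
- by move=> i s ps [|c [|? ?]].
- move=> p q s s1 s2 m n _ IHp _ IHq ps [//|c w] [sw] /=.
  rewrite -(cat_take_drop m w) foldl_cat IHp; last by rewrite size_takel // sw leq_addr.
  by apply: IHq; rewrite size_drop sw addKn.
- by move=> i p p0 p1 s s' n _ IH ps [//|c w] [sw] /=; apply: IH.
- by move=> i p s s0 ps [|c [|? ?]] //= _; rewrite s0.
- move=> i p s s1 s2 m n s0 _ IHp _ IHw ps [//|c w] [sw] /=.
  case E: (s i) => [//|b l].
  rewrite -(cat_take_drop m w) foldl_cat IHp; last by rewrite size_takel // sw leq_addr.
  by apply: IHw; rewrite size_drop sw addKn.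
Qed.

(** Stacks beyond the list are empty. On explicit lists updates compute, which
    makes symbolic execution a matter of reduction. *)
Definition store_of (l : seq (seq bool)) : store := fun i => nth [::] l i.

Lemma upd_store_of l i w : upd (store_of l) i w = store_of (set_nth [::] l i w).
Proof. by apply/funext => j; rewrite /upd /store_of nth_set_nth /=. Qed.

(** The time is an upper bound, so that the costs added up during symbolic
    execution can be replaced by convenient expressions. *)
Definition exec p l l' T := exists2 n, (n <= T)%N & big_step p (store_of l) (store_of l') n.

Lemma exec_le p l l' T T' : exec p l l' T -> (T <= T')%N -> exec p l l' T'.
Proof. by move=> [n nT h] TT; exists n => //; apply: leq_trans TT. Qed.

Lemma exec_eq p l l1 l2 T : exec p l l1 T -> l1 = l2 -> exec p l l2 T.
Proof. by move=> h <-. Qed.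

Lemma exec_push i b l :
  exec (Push i b) l (set_nth [::] l i (b :: nth [::] l i)) 1.
Proof. by exists 1 => //; rewrite -upd_store_of; apply: EvPush. Qed.

Lemma exec_pop i l : exec (Pop i) l (set_nth [::] l i (behead (nth [::] l i))) 1.
Proof. by exists 1 => //; rewrite -upd_store_of; apply: EvPop. Qed.

Lemma exec_seq p q l l1 l2 T U : exec p l l1 T -> exec q l1 l2 U ->
  exec (Seq p q) l l2 (T + U).+1.
Proof.
move=> [m mT hp] [n nU hq]; exists (m + n).+1; first by rewrite ltnS leq_add.
exact: EvSeq hp hq.
Qed.

Lemma exec_case i p p0 p1 l l' T :
  exec (match nth [::] l i with [::] => p | b :: _ => if b then p1 else p0 end)
    l l' T -> exec (Case i p p0 p1) l l' T.+1.
Proof. by move=> [n nT h]; exists n.+1 => //; apply: EvCase. Qed.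

Lemma exec_while0 i p l : nth [::] l i = [::] -> exec (While i p) l l 1.
Proof. by move=> h; exists 1 => //; apply: EvWhile0. Qed.

Lemma exec_while1 i p l l1 l2 T U : nth [::] l i <> [::] ->
  exec p l l1 T -> exec (While i p) l1 l2 U ->
  exec (While i p) l l2 (T + U).+1.
Proof.
move=> h [m mT hp] [n nU hq]; exists (m + n).+1; first by rewrite ltnS leq_add.
exact: EvWhile1 hp hq.
Qed.

(** A routine is verified once on the stacks 0, 1, ... and then used on any
    distinct stacks of a larger store. *)
Fixpoint relabel (idx : seq nat) p :=
  match p with
  | Push i b => Push (nth 0 idx i) b
  | Pop i => Pop (nth 0 idx i)
  | Flip i => Flip (nth 0 idx i)
  | Seq p q => Seq (relabel idx p) (relabel idx q)
  | Case i p p0 p1 => Case (nth 0 idx i) (relabel idx p) (relabel idx p0) (relabel idx p1)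
  | While i p => While (nth 0 idx i) (relabel idx p)
  end.

Arguments relabel : simpl never.

Fixpoint below m p :=
  match p with
  | Push i _ | Pop i | Flip i => (i < m)%N
  | Seq p q => below m p && below m q
  | Case i p p0 p1 => [&& (i < m)%N, below m p, below m p0 & below m p1]
  | While i p => (i < m)%N && below m p
  end.

Lemma big_step_relabel idx p s s' n : big_step p s s' n -> uniq idx -> below (size idx) p ->
  forall S, (forall j, (j < size idx)%N -> S (nth 0 idx j) = s j) ->
  exists S', [/\ big_step (relabel idx p) S S' n,
    forall j, (j < size idx)%N -> S' (nth 0 idx j) = s' j &
    forall i, i \notin idx -> S' i = S i].
Proof.
move=> + uidx; have upd_ren i w s0 S0 : (i < size idx)%N ->
    (forall j, (j < size idx)%N -> S0 (nth 0 idx j) = s0 j) ->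
    (forall j, (j < size idx)%N -> upd S0 (nth 0 idx i) w (nth 0 idx j) = upd s0 i w j) /\
    (forall j, j \notin idx -> upd S0 (nth 0 idx i) w j = S0 j).
  move=> im h; split=> j jm; rewrite /upd; first by rewrite nth_uniq // h.
  by case: eqP => // ji; case/negP: jm; rewrite ji mem_nth.
elim=> {p s s' n}.
- move=> i b s im S h; exists (upd S (nth 0 idx i) (b :: s i)).
  have [h1 h2] := upd_ren i (b :: s i) _ _ im h; split=> //=.
  by rewrite -h //; apply: EvPush.
- move=> i s im S h; exists (upd S (nth 0 idx i) (behead (s i))).
  have [h1 h2] := upd_ren i (behead (s i)) _ _ im h; split=> //=.
  by rewrite -h //; apply: EvPop.
- move=> p q s s1 s2 m n _ IHp _ IHq /= /andP[bp bq] S h.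
  have [S1 [e1 h1 f1]] := IHp bp S h; have [S2 [e2 h2 f2]] := IHq bq S1 h1.
  exists S2; split=> //; first exact: EvSeq e1 e2.
  by move=> i ii; rewrite f2 // f1.
- move=> i p p0 p1 s s' n _ IH /= /and4P[im bp bp0 bp1] S h.
  have [|S1 [e1 h1 f1]] := IH _ S h; first by case: (s i) => [|[]].
  exists S1; split=> //; apply: EvCase; rewrite h //.
  by case: (s i) e1 => [|[]].
- move=> i p s s0 /= /andP[im bp] S h; exists S; split=> //.
  by apply: EvWhile0; rewrite h.
- move=> i p s s1 s2 m n s0 _ IHp _ IHw /= /andP[im bp] S h.
  have [S1 [e1 h1 f1]] := IHp bp S h.
  have [|S2 [e2 h2 f2]] := IHw _ S1 h1; first by rewrite /= im.
  exists S2; split=> //; last by move=> j jj; rewrite f2 // f1.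
  by apply: EvWhile1 e1 e2; rewrite h.
Qed.

Fixpoint write (L : seq (seq bool)) (idx : seq nat) (l : seq (seq bool)) :=
  match idx, l with
  | i :: idx, w :: l => write (set_nth [::] L i w) idx l
  | _, _ => L
  end.

Lemma nth_write_notin L idx l i : i \notin idx ->
  nth [::] (write L idx l) i = nth [::] L i.
Proof.
elim: idx l L => [|j idx IH] [|w l] L //=; rewrite inE negb_or => /andP[ij ii].
by rewrite IH // nth_set_nth /= (negPf ij).
Qed.

Lemma nth_write L idx l j : uniq idx -> size l = size idx -> (j < size idx)%N ->
  nth [::] (write L idx l) (nth 0 idx j) = nth [::] l j.
Proof.
elim: idx l L j => [|i idx IH] [|w l] L // [|j] /= /andP[ii ui] [sl] jm.
  by rewrite nth_write_notin // nth_set_nth /= eqxx.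
by rewrite IH.
Qed.

(** The frame rule: stacks outside [idx] keep their contents. *)
Lemma exec_relabel idx p l l' T L : uniq idx -> below (size idx) p ->
  size l = size idx -> size l' = size idx -> map (nth [::] L) idx = l ->
  exec p l l' T -> exec (relabel idx p) L (write L idx l') T.
Proof.
move=> ui bp sl sl' Ll [n nT e]; exists n => //.
have [j jm|S' [e' h f]] := big_step_relabel e ui bp (S := store_of L).
  by rewrite /store_of -Ll (nth_map 0).
suff -> : store_of (write L idx l') = S' by [].
apply/funext => i; rewrite /store_of; case: (boolP (i \in idx)) => ii; last first.
  by rewrite nth_write_notin // f.
have /nthP-/(_ 0)[j jm <-] := ii.
by rewrite nth_write // h.
Qed.

Ltac xcbn := cbn [set_nth nth behead write map cat fst snd].
(* Calls a routine with specification H on other stacks. *)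
Ltac xcall H :=
  eapply exec_eq;
    [eapply exec_relabel; [ | | | | |eapply H]; [reflexivity..]|xcbn; reflexivity].
(* Symbolic execution of straight-line code, up to the next loop or call. *)
Ltac xstep :=
  lazymatch goal with
  | |- exec (Seq _ _) _ _ _ => eapply exec_seq; [xstep|xcbn]
  | |- exec (Push _ _) _ _ _ => eapply exec_push
  | |- exec (Pop _) _ _ _ => eapply exec_pop
  | |- exec (Case _ _ _ _) _ _ _ => eapply exec_case; xcbn; xstep
  | _ => idtac
  end.
Ltac xs := repeat progress xstep.

Definition Move := While 0 (Case 0 (Pop 0) (Seq (Pop 0) (Push 1 false)) (Seq (Pop 0) (Push 1 true))).

Lemma Move_spec a b : exec Move [:: a; b] [:: [::]; catrev a b] (5 * size a + 1).
Proof.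
elim: a b => [|x a IH] b; first exact: exec_while0.
eapply exec_le.
  eapply exec_while1 => //; last exact: IH.
  by case: x; xs.
by move=> /=; lia.
Qed.

(* One round of a loop followed by the induction hypothesis IH; leaves the body
   and the inequality between the times. *)
Ltac xloop IH :=
  eapply exec_le; [eapply exec_while1; [by []| |exact: IH]; xcbn|].

(** * Arithmetic of polynomials over F_2 on stacks *)

Definition Move2 := While 0 (Case 0 (Pop 0)
  (Seq (Pop 0) (Seq (Push 1 false) (Push 2 false)))
  (Seq (Pop 0) (Seq (Push 1 true) (Push 2 true)))).

Lemma Move2_spec a b c :
  exec Move2 [:: a; b; c] [:: [::]; catrev a b; catrev a c] (7 * size a + 1).
Proof.
elim: a b c => [|x a IH] b c; first exact: exec_while0.
xloop IH; first by case: x; xs.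
by move=> /=; lia.
Qed.

Definition Copy := Seq (relabel [:: 0; 2] Move) (relabel [:: 2; 0; 1] Move2).

Lemma Copy_spec a b :
  exec Copy [:: a; b; [::]] [:: a; a ++ b; [::]] (12 * size a + 3).
Proof.
eapply exec_le.
  eapply exec_eq.
    eapply exec_seq; [xcall Move_spec|xcbn; xcall Move2_spec].
  by xcbn; rewrite !catrevE !cats0 revK.
by xcbn; rewrite !catrevE cats0 size_rev; lia.
Qed.

Definition Clear := While 0 (Pop 0).

Lemma Clear_spec a : exec Clear [:: a] [:: [::]] (2 * size a + 1).
Proof.
elim: a => [|x a IH]; first exact: exec_while0.
by xloop IH; [xs|move=> /=; lia].
Qed.

Definition Transfer := Seq (relabel [:: 0; 2] Move) (relabel [:: 2; 1] Move).

Lemma Transfer_spec a b :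
  exec Transfer [:: a; b; [::]] [:: [::]; a ++ b; [::]] (10 * size a + 3).
Proof.
eapply exec_le.
  eapply exec_eq.
    eapply exec_seq; [xcall Move_spec|xcbn; xcall Move_spec].
  by xcbn; rewrite !catrevE !cats0 revK.
by xcbn; rewrite !catrevE cats0 size_rev; lia.
Qed.

Fixpoint xorl (a b : seq bool) :=
  match a, b with
  | [::], _ => b
  | _, [::] => a
  | x :: a, y :: b => (x (+) y) :: xorl a b
  end.

Definition XorLoop := While 1 (Case 1 (Pop 1)
  (Seq (Pop 1) (Seq (Push 2 false) (Case 0 (Push 3 false)
     (Seq (Pop 0) (Push 3 false)) (Seq (Pop 0) (Push 3 true)))))
  (Seq (Pop 1) (Seq (Push 2 true) (Case 0 (Push 3 true)
     (Seq (Pop 0) (Push 3 true)) (Seq (Pop 0) (Push 3 false)))))).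

Lemma XorLoop_spec a p t u :
  exec XorLoop [:: a; p; t; u]
    [:: drop (size p) a; [::]; catrev p t; catrev (xorl (take (size p) a) p) u]
    (11 * size p + 1).
Proof.
elim: p a t u => [|y p IH] a t u.
  by rewrite take0 drop0; exact: exec_while0.
case: a => [|x a].
  xloop (IH [::]); first by case: y; xs.
  by move=> /=; lia.
xloop (IH a); first by case: y; case: x; xs.
by move=> /=; lia.
Qed.

Definition Xor := Seq XorLoop (Seq (relabel [:: 2; 1] Move) (relabel [:: 3; 0] Move)).

Lemma size_xorl a b : size (xorl a b) = maxn (size a) (size b).
Proof. by elim: a b => [|x a IH] [|y b] //=; rewrite ?maxn0 ?max0n // IH maxnSS. Qed.

Lemma xorl_take a b : xorl (take (size b) a) b ++ drop (size b) a = xorl a b.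
Proof.
elim: b a => [|y b IH] [|x a] //=; first by rewrite cats0.
by rewrite IH.
Qed.

Lemma Xor_spec a p : exec Xor [:: a; p; [::]; [::]] [:: xorl a p; p; [::]; [::]]
  (21 * size p + 5).
Proof.
eapply exec_le.
  eapply exec_eq.
    eapply exec_seq; [apply: XorLoop_spec|xcbn].
    eapply exec_seq; [xcall Move_spec|xcbn; xcall Move_spec].
  by xcbn; rewrite !catrevE !cats0 !revK xorl_take.
xcbn; rewrite !catrevE !cats0 !size_rev size_xorl size_take_min.
by have /maxn_idPr-> := geq_minl (size p) (size a); lia.
Qed.

(** Multiplication of stack 1 by the power of the variable whose exponent is the
    height of stack 0; stack 2 is scratch space. *)
Definition PushZeros := Seq
  (While 0 (Case 0 (Pop 0)
    (Seq (Pop 0) (Seq (Push 2 false) (Push 1 false)))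
    (Seq (Pop 0) (Seq (Push 2 true) (Push 1 false)))))
  (relabel [:: 2; 0] Move).

Lemma PushZeros_loop d a t :
  exec (While 0 (Case 0 (Pop 0)
    (Seq (Pop 0) (Seq (Push 2 false) (Push 1 false)))
    (Seq (Pop 0) (Seq (Push 2 true) (Push 1 false)))))
  [:: d; a; t] [:: [::]; nseq (size d) false ++ a; catrev d t] (7 * size d + 1).
Proof.
elim: d a t => [|x d IH] a t; first exact: exec_while0.
have -> : nseq (size (x :: d)) false ++ a = nseq (size d) false ++ (false :: a).
  by rewrite /=; elim: (size d) => //= n ->.
xloop IH; first by case: x; xs.
by move=> /=; lia.
Qed.

Lemma PushZeros_spec d a :
  exec PushZeros [:: d; a; [::]] [:: d; nseq (size d) false ++ a; [::]] (12 * size d + 3).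
Proof.
eapply exec_le.
  eapply exec_eq.
    eapply exec_seq; [apply: PushZeros_loop|xcbn; xcall Move_spec].
  by xcbn; rewrite !catrevE !cats0 revK.
by xcbn; rewrite !catrevE cats0 size_rev; lia.
Qed.

(** Product of polynomials over F_2 by Horner's rule. Stack 0 is one factor, with
    its highest coefficient on top, stack 1 the other one, with its constant
    coefficient on top, stack 2 the accumulator; 3 and 4 are scratch space. *)
Definition Horner := While 0 (Seq (Push 2 false) (Case 0 (Pop 0) (Pop 0)
  (Seq (Pop 0) (relabel [:: 2; 1; 3; 4] Xor)))).

Definition horner_step p acc (b : bool) :=
  if b then xorl (false :: acc) p else false :: acc.

Lemma Horner_spec f p a :
  exec Horner [:: f; p; a; [::]; [::]] [:: [::]; p; foldl (horner_step p) a f; [::]; [::]]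
    (size f * (21 * size p + 11) + 1).
Proof.
elim: f a => [|[] f IH] a; first exact: exec_while0.
  xloop IH.
    by eapply exec_seq; [xs|xcbn; eapply exec_case; xcbn; eapply exec_seq; [xs|xcbn; xcall Xor_spec]].
  by move=> /=; lia.
by xloop IH; [eapply exec_seq; [xs|xcbn; xs]|move=> /=; lia].
Qed.

(** * Reading the input *)

(** Loop over a sequence coded with continuation bits, read from stack 0. A loop
    can only test whether a stack is empty; therefore stack 1 holds a token as
    long as items may follow. *)
Definition Items body := Seq (Push 1 true)
  (While 1 (Case 0 (Pop 1) (Seq (Pop 0) (Pop 1)) (Seq (Pop 0) body))).

Lemma enc_seq_cons T (enc : T -> seq bool) x xs :
  enc_seq enc (x :: xs) = true :: enc x ++ enc_seq enc xs.
Proof. by rewrite /enc_seq /= -catA. Qed.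

(** [Z] gives the stacks from 2 on as a function of an abstract state. The
    invariant may depend on the items still to be read, which allows it to
    bound stacks that grow with every item. *)
Lemma Items_spec (A S : Type) (enc : A -> seq bool) body (Z : S -> seq (seq bool))
    (f : S -> A -> S) (inv : seq A -> S -> Prop) (T : A -> nat) xs s rest :
  (forall x ys s rest, inv (x :: ys) s ->
     exec body [:: enc x ++ rest, [:: true] & Z s] [:: rest, [:: true] & Z (f s x)] (T x)
     /\ inv ys (f s x)) ->
  inv xs s ->
  exec (Items body) [:: enc_seq enc xs ++ rest, [::] & Z s]
    [:: rest, [::] & Z (foldl f s xs)] (sumn [seq T x + 4 | x <- xs] + 9).
Proof.
move=> step inv0; 
have -> : sumn [seq T x + 4 | x <- xs] + 9 = (1 + (sumn [seq T x + 4 | x <- xs] + 7)).+1.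
  by xcbn; lia.
eapply exec_seq; first by xs.
xcbn; elim: xs s inv0 => [|x xs IH] s inv0.
  rewrite -[enc_seq enc [::] ++ rest]/(false :: rest).
  eapply exec_le; first eapply exec_while1 => //; xcbn.
  - by eapply exec_case; xcbn; xs.
  - by apply: exec_while0.
  by [].
have [stp inv1] := step x xs s (enc_seq enc xs ++ rest) inv0.
rewrite enc_seq_cons cat_cons -catA.
eapply exec_le; first eapply exec_while1 => //; xcbn.
- by eapply exec_case; xcbn; eapply exec_seq; [xs|xcbn; exact: stp].
- exact: IH inv1.
by move=> /=; lia.
Qed.

Definition ParseBit d := Case 0 (Pop 0) (Seq (Pop 0) (Push d false)) (Seq (Pop 0) (Push d true)).

Definition enc_bits (c : seq bool) := enc_seq (fun b => [:: b]) c.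

(** Reads the modulus onto stack 2; stack 3 is needed to restore the order. *)
Definition ParseH := Seq (relabel [:: 0; 1; 3] (Items (ParseBit 2))) (relabel [:: 3; 2] Move).

Lemma foldl_cons (T : Type) (s t : seq T) : foldl (fun z x => x :: z) t s = catrev s t.
Proof. by elim: s t => //= x s IH t. Qed.

Lemma sumn_const (T : Type) (s : seq T) c : sumn [seq c | _ <- s] = c * size s.
Proof. by elim: s => [|x s /= ->]; rewrite ?muln0 // mulnS. Qed.

Lemma ParseBits_spec c rest d :
  exec (Items (ParseBit 2)) [:: enc_bits c ++ rest; [::]; d]
    [:: rest; [::]; catrev c d] (8 * size c + 9).
Proof.
rewrite -foldl_cons; eapply exec_le.
  apply: (Items_spec (Z := fun s => [:: s]) (inv := fun _ _ => True)
    (T := fun _ => 4)) => // x ys s r _; split=> //.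
  by rewrite /ParseBit; case: x; xcbn; (eapply exec_le; [xs|by []]).
by rewrite sumn_const; lia.
Qed.

Lemma ParseH_spec h rest :
  exec ParseH [:: enc_bits h ++ rest; [::]; [::]; [::]] [:: rest; [::]; h; [::]]
    (13 * size h + 11).
Proof.
eapply exec_le.
  eapply exec_eq.
    eapply exec_seq; [xcall ParseBits_spec|xcbn; xcall Move_spec].
  by rewrite !catrevE !cats0 revK.
by xcbn; rewrite !catrevE !cats0 !size_rev; lia.
Qed.

(** Reads a coefficient in F_q onto stack 2, in reversed order, and pads it to the
    height d of stack 3. Coefficients of consecutive powers of t thus end up at
    distance d, which is the substitution t -> X^d. *)
Definition ParseCoef := Seq (relabel [:: 3; 4; 5] Copy) (Seq
  (relabel [:: 0; 1; 2; 4] (Items (Seq (Pop 3) (ParseBit 2))))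
  (While 4 (Seq (Pop 4) (Push 2 false)))).

Definition padto n (c : seq bool) := c ++ nseq (n - size c) false.

Lemma ParsePaddedBits_spec c rest f d :
  exec (Items (Seq (Pop 3) (ParseBit 2))) [:: enc_bits c ++ rest; [::]; f; d]
    [:: rest; [::]; catrev c f; drop (size c) d] (10 * size c + 9).
Proof.
have -> : [:: catrev c f; drop (size c) d] =
  (fun s : seq bool * seq bool => [:: s.1; s.2])
    (foldl (fun s b => (b :: s.1, behead s.2)) (f, d) c).
  elim: c f d => [|x c IH] f d /=; first by rewrite drop0.
  by rewrite -IH /=; case: d.
eapply exec_le.
  apply: (Items_spec (s := (f, d)) (Z := fun s => [:: s.1; s.2]) (inv := fun _ _ => True)
    (T := fun _ => 6)) => // x ys s r _; split=> //.
  by rewrite /ParseBit; case: x; xcbn; (eapply exec_le; [xs|by []]).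
by rewrite sumn_const; lia.
Qed.

Lemma PadLoop_spec a b c e d g :
  exec (While 4 (Seq (Pop 4) (Push 2 false))) [:: a; b; c; e; d; g]
   [:: a; b; nseq (size d) false ++ c; e; [::]; g] (4 * size d + 1).
Proof.
elim: d c => [|x d IH] c; first exact: exec_while0.
have -> : nseq (size (x :: d)) false ++ c = nseq (size d) false ++ (false :: c).
  by rewrite /=; elim: (size d) => //= n ->.
by xloop IH; [xs|move=> /=; lia].
Qed.

Lemma ParseCoef_spec c rest f d :
  exec ParseCoef [:: enc_bits c ++ rest; [::]; f; d; [::]; [::]]
    [:: rest; [::]; rev (padto (size d) c) ++ f; d; [::]; [::]]
    (16 * size d + 10 * size c + 16).
Proof.
eapply exec_le.
  eapply exec_eq.
    eapply exec_seq; [xcall Copy_spec|xcbn].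
    eapply exec_seq; [xcall ParsePaddedBits_spec|xcbn].
    apply: PadLoop_spec.
  by rewrite cats0 size_drop catrevE /padto rev_cat rev_nseq catA.
by xcbn; rewrite cats0 size_drop; lia.
Qed.

(** Reads a polynomial f over F_q onto stack 3, highest coefficient on top. Each
    coefficient also shifts stack 7 by d, so that this stack gets multiplied by
    t^(deg f + 1) on the way. *)
Definition ParsePoly := Items (Seq (relabel [:: 0; 2; 3; 4; 5; 6] ParseCoef)
  (relabel [:: 4; 7; 6] PushZeros)).

Definition flatten_padded n cs := flatten (map (padto n) cs).

Lemma ParsePoly_spec cs rest f d r :
  exec ParsePoly [:: enc_seq enc_bits cs ++ rest; [::]; [::]; f; d; [::]; [::]; r]
    [:: rest; [::]; [::]; rev (flatten_padded (size d) cs) ++ f; d; [::]; [::];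
        nseq (size d * size cs) false ++ r]
    ((28 * size d + 24) * size cs + 10 * sumn (map size cs) + 9).
Proof.
have -> : [:: [::]; rev (flatten_padded (size d) cs) ++ f; d; [::]; [::];
        nseq (size d * size cs) false ++ r] =
  (fun s : seq bool * seq bool => [:: [::]; s.1; d; [::]; [::]; s.2])
    (foldl (fun s c => (rev (padto (size d) c) ++ s.1, nseq (size d) false ++ s.2)) (f, r) cs).
  elim: cs f r => [|c cs IH] f r /=; first by rewrite muln0.
  rewrite -IH /=; congr [:: _; _; _; _; _; _].
    by rewrite /flatten_padded /= rev_cat -catA.
  by rewrite mulnS addnC nseqD catA.
eapply exec_le.
  apply: (Items_spec (s := (f, r)) (Z := fun s => [:: [::]; s.1; d; [::]; [::]; s.2]) (inv := fun _ _ => True)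
    (T := fun c => 28 * size d + 10 * size c + 20)) => // c ys s rst _; split=> //.
  eapply exec_le.
    by eapply exec_seq; [xcall ParseCoef_spec|xcbn; xcall PushZeros_spec].
  by xcbn; lia.
by elim: cs => [|c cs IH] //=; lia.
Qed.

(** The update (P, Q) -> (f P + t^(deg f + 1) Q, f Q) for a place f.
    Stacks: 0 input, 1 to 3 tokens of the nested loops, 4 f, 5 d in unary,
    8 t^(deg f + 1) Q, 9 P, 10 Q, 11 copy of f, 12 accumulator; 6 and 7 are
    scratch space. *)
Definition FinitePlace :=
  Seq (relabel [:: 10; 8; 7] Copy) (
  Seq (relabel [:: 0; 2; 3; 4; 5; 6; 7; 8] ParsePoly) (
  Seq (relabel [:: 4; 11; 7] Copy) (
  Seq (relabel [:: 11; 9; 12; 6; 7] Horner) (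
  Seq (relabel [:: 12; 8; 6; 7] Xor) (
  Seq (relabel [:: 8] Clear) (
  Seq (relabel [:: 9] Clear) (
  Seq (relabel [:: 12; 9; 7] Transfer) (
  Seq (relabel [:: 4; 10; 12; 6; 7] Horner) (
  Seq (relabel [:: 10] Clear) (
  relabel [:: 12; 10; 7] Transfer)))))))))).

Definition PlaceBody := Case 0 (Pop 0) (Pop 0) (Seq (Pop 0) FinitePlace).

Definition horner_mul f p := foldl (horner_step p) [::] f.

Definition place_step d (s : seq bool * seq bool) cs :=
  (xorl (horner_mul (rev (flatten_padded d cs)) s.1) (nseq (d * size cs) false ++ s.2),
   horner_mul (rev (flatten_padded d cs)) s.2).

Definition place_option_step d s (o : option (seq (seq bool))) :=
  if o is Some cs then place_step d s cs else s.

Definition enc_place_bits (o : option (seq (seq bool))) :=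
  if o is Some cs then true :: enc_seq enc_bits cs else [:: false].

Lemma size_horner_mul f p : size (horner_mul f p) <= size f + size p.
Proof.
suff : forall a, size (foldl (horner_step p) a f) <= size f + maxn (size p) (size a).
  by move=> /(_ [::]); rewrite maxn0.
elim: f => [|b f IH] a /=; first by rewrite leq_maxr.
apply: leq_trans (IH _) _; rewrite /horner_step; case: b; rewrite ?size_xorl /=; lia.
Qed.

Lemma FinitePlace_spec cs rest fl d p q M :
  size d <= M -> size cs <= M -> sumn (map size cs) <= M ->
  size (flatten_padded (size d) cs) <= M -> size d * size cs <= M -> size p <= M -> size q <= M ->
  exec FinitePlace
   [:: enc_seq enc_bits cs ++ rest; fl; [::]; [::]; [::]; d; [::]; [::]; [::]; p; q; [::]; [::]]
   [:: rest; fl; [::]; [::]; [::]; d; [::]; [::]; [::];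
     (place_step (size d) (p, q) cs).1; (place_step (size d) (p, q) cs).2; [::]; [::]]
   (42 * (M * M) + 220 * M + 60).
Proof.
move=> dM csM sM fM dcM pM qM; rewrite /place_step /=.
set F := rev (flatten_padded (size d) cs); have FM : size F <= M by rewrite size_rev.
set R := nseq _ _ ++ q.
have RM : size R <= M + M by rewrite size_cat size_nseq leq_add.
have hP : size (xorl (horner_mul F p) R) <= M + M.
  by rewrite size_xorl geq_max RM (leq_trans (size_horner_mul _ _)) // leq_add.
have hQ : size (horner_mul F q) <= M + M by rewrite (leq_trans (size_horner_mul _ _)) // leq_add.
have m1 : size F * (21 * size p + 11) <= M * (21 * M + 11) by apply: leq_mul; lia.
have m2 : size F * (21 * size q + 11) <= M * (21 * M + 11) by apply: leq_mul; lia.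
rewrite /FinitePlace; eapply exec_le.
  eapply exec_seq; [xcall Copy_spec|xcbn; rewrite cats0].
  eapply exec_seq; [xcall ParsePoly_spec|xcbn; rewrite cats0 -/F -/R].
  eapply exec_seq; [xcall Copy_spec|xcbn; rewrite cats0].
  eapply exec_seq; [xcall Horner_spec|xcbn; rewrite -/(horner_mul F p)].
  eapply exec_seq; [xcall Xor_spec|xcbn].
  eapply exec_seq; [xcall Clear_spec|xcbn].
  eapply exec_seq; [xcall Clear_spec|xcbn].
  eapply exec_seq; [xcall Transfer_spec|xcbn; rewrite cats0].
  eapply exec_seq; [xcall Horner_spec|xcbn; rewrite -/(horner_mul F q)].
  eapply exec_seq; [xcall Clear_spec|xcbn].
  eapply exec_eq; [xcall Transfer_spec|xcbn; rewrite cats0; reflexivity].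
xcbn; rewrite -/(horner_mul F p) -/(horner_mul F q) -/F -/R; lia.
Qed.

Lemma size_flatten_padded d cs : all (fun c => size c <= d) cs -> size (flatten_padded d cs) = d * size cs.
Proof.
elim: cs => [|c cs IH] /=; first by rewrite muln0.
case/andP=> cd /IH; rewrite /flatten_padded /= size_cat mulnS => ->.
by rewrite size_cat size_nseq subnKC.
Qed.

Definition place_stacks d (s : seq bool * seq bool) : seq (seq bool) :=
  [:: [::]; [::]; [::]; d; [::]; [::]; [::]; s.1; s.2; [::]; [::]].

Definition coef_count (o : option (seq (seq bool))) := if o is Some cs then size cs else 0.

(** Bounds that hold for every place of an input of length d. The first one makes
    the padding to length d effective. *)
Definition small_place d M (o : option (seq (seq bool))) :=
  if o is Some cs then
    [&& all (fun c => size c <= d) cs, size cs <= M & sumn (map size cs) <= M]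
  else true.

(** P and Q grow at most by d times the number of coefficients that are read; the
    invariant of the loop adds to their sizes what is still to come. *)
Lemma Places_spec d M os s rest : size d <= M ->
  all (small_place (size d) M) os ->
  maxn (size s.1) (size s.2) + size d * sumn (map coef_count os) <= M ->
  exec (Items PlaceBody) [:: enc_seq enc_place_bits os ++ rest, [::] & place_stacks d s]
    [:: rest, [::] & place_stacks d (foldl (place_option_step (size d)) s os)]
    ((42 * (M * M) + 220 * M + 68) * size os + 9).
Proof.
move=> dM sos sM; eapply exec_le.
  apply: (Items_spec (T := fun=> 42 * (M * M) + 220 * M + 64)
    (inv := fun os s => all (small_place (size d) M) os /\
       maxn (size s.1) (size s.2) + size d * sumn (map coef_count os) <= M)); last by split.
  move=> [cs|] ys [p q] r; last first.
    move=> [/= sys hM]; split; last by split.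
    by rewrite /PlaceBody; eapply exec_le; [xs|by lia].
  move=> [/= /andP[/and3P[scs csM sumM] sys]]; rewrite mulnDr => hM.
  have fE := size_flatten_padded scs.
  split.
    rewrite /PlaceBody; eapply exec_le.
      eapply exec_case; xcbn; eapply exec_seq; [xs|xcbn].
      by apply: (@FinitePlace_spec cs r _ d p q M); rewrite ?fE //; lia.
    by lia.
  split=> //=; apply: leq_trans hM.
  rewrite addnA leq_add2r geq_max; apply/andP; split.
    rewrite size_xorl geq_max (leq_trans (size_horner_mul _ _)) /= ?size_rev ?fE; last by lia.
    by rewrite size_cat size_nseq; lia.
  by rewrite (leq_trans (size_horner_mul _ _)) // size_rev fE; lia.
by rewrite sumn_const; lia.
Qed.

(** * Writing a polynomial with reduced coefficients *)

Definition TakeBlock := While 0 (Seq (Pop 0) (Case 1 (Pop 1)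
  (Seq (Pop 1) (Push 2 false)) (Seq (Pop 1) (Push 2 true)))).

Lemma TakeBlock_spec d g b :
  exec TakeBlock [:: d; g; b]
    [:: [::]; drop (size d) g; catrev (take (size d) g) b] (7 * size d + 1).
Proof.
elim: d g b => [|y d IH] g b; first by rewrite drop0 take0; exact: exec_while0.
case: g => [|x g].
  by xloop (IH [::]); [xs|move=> /=; lia].
by xloop (IH g); [case: x; xs|move=> /=; lia].
Qed.

(** Unlike [take], this pads short lists with zeros: the result always has
    length n, and its last entry is the coefficient of degree n - 1. *)
Fixpoint pad_take n (a : seq bool) :=
  if n is n.+1 then head false a :: pad_take n (behead a) else [::].

Lemma size_pad_take n a : size (pad_take n a) = n.
Proof. by elim: n a => //= n IH a; rewrite IH. Qed.

(** Walks through the accumulator (stack 0) and the modulus (stack 1) in parallel.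
    A loop over the modulus stops exactly when its degree is reached, and then
    the coefficient of that degree is on top of stack 2. *)
Definition LockStep := While 1 (Case 1 (Pop 1)
  (Seq (Pop 1) (Seq (Push 3 false) (Case 0 (Push 2 false)
    (Seq (Pop 0) (Push 2 false)) (Seq (Pop 0) (Push 2 true)))))
  (Seq (Pop 1) (Seq (Push 3 true) (Case 0 (Push 2 false)
    (Seq (Pop 0) (Push 2 false)) (Seq (Pop 0) (Push 2 true)))))).

Lemma LockStep_spec a h x y :
  exec LockStep [:: a; h; x; y]
    [:: drop (size h) a; [::]; catrev (pad_take (size h) a) x; catrev h y] (11 * size h + 1).
Proof.
elim: h a x y => [|z h IH] a x y; first by rewrite drop0; exact: exec_while0.
case: a => [|b a].
  by xloop (IH [::]); [case: z; xs|move=> /=; lia].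
by xloop (IH a); [case: z; case: b; xs|move=> /=; lia].
Qed.

Definition MoveBit := Case 0 (Pop 0) (Seq (Pop 0) (Push 1 false)) (Seq (Pop 0) (Push 1 true)).

Lemma MoveBit_spec b a c : exec MoveBit [:: b :: a; c] [:: a; b :: c] 4.
Proof. by rewrite /MoveBit; case: b; (eapply exec_le; [xs|]). Qed.

(** One step of Horner's rule modulo h. Stacks: 0 the polynomial to be reduced,
    highest coefficient on top, 1 accumulator, 2 modulus, 3 and 4 scratch
    space. *)
Definition ReduceBody :=
  Seq (relabel [:: 0; 1] MoveBit) (
  Seq (relabel [:: 1; 2; 3; 4] LockStep) (
  Seq (relabel [:: 1] Clear) (
  Case 3 (Pop 3)
    (Seq (relabel [:: 3; 1] Move) (relabel [:: 4; 2] Move))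
    (Seq (relabel [:: 3; 1] Move) (Seq (relabel [:: 4; 2] Move) (relabel [:: 1; 2; 3; 4] Xor)))))).

(** The modulus is monic of degree [size h - 1], and the accumulator has smaller
    degree before it is shifted; so one conditional subtraction reduces it. *)
Definition mod_step h acc (b : bool) :=
  let a := pad_take (size h) (b :: acc) in if last false a then xorl a h else a.

Lemma size_mod_step h acc b : size (mod_step h acc b) = size h.
Proof. by rewrite /mod_step; case: ifP; rewrite ?size_xorl size_pad_take ?maxnn. Qed.

Lemma rev_last_cons (a : seq bool) x r : rev a = x :: r -> last false a = x.
Proof. by move=> e; rewrite -[a]revK e rev_cons last_rcons. Qed.

Lemma ReduceBody_spec b bs acc h : 0 < size h -> size acc <= size h ->
  exec ReduceBody [:: b :: bs; acc; h; [::]; [::]]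
    [:: bs; mod_step h acc b; h; [::]; [::]] (42 * size h + 50).
Proof.
move=> h0 ah; rewrite /ReduceBody.
have sd : size (drop (size h) (b :: acc)) <= 1 by rewrite size_drop /=; lia.
have := size_pad_take (size h) (b :: acc); rewrite -size_rev /mod_step.
case E: (rev (pad_take (size h) (b :: acc))) => [|x r] sr; first by rewrite -sr in h0.
rewrite (rev_last_cons E) -[pad_take _ _]revK E.
case: x E sr => E sr.
  eapply exec_le.
    eapply exec_seq; [xcall MoveBit_spec|xcbn].
    eapply exec_seq; [xcall LockStep_spec|xcbn; rewrite !catrevE !cats0 E].
    eapply exec_seq; [xcall Clear_spec|xcbn].
    eapply exec_case; xcbn.
    eapply exec_seq; [xcall Move_spec|xcbn; rewrite !catrevE !cats0].
    eapply exec_seq; [xcall Move_spec|xcbn; rewrite !catrevE !cats0 revK].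
    xcall Xor_spec.
  xcbn; rewrite sr size_rev; lia.
eapply exec_le.
  eapply exec_seq; [xcall MoveBit_spec|xcbn].
  eapply exec_seq; [xcall LockStep_spec|xcbn; rewrite !catrevE !cats0 E].
  eapply exec_seq; [xcall Clear_spec|xcbn].
  eapply exec_case; xcbn.
  eapply exec_seq; [xcall Move_spec|xcbn; rewrite !catrevE !cats0].
  eapply exec_eq; [xcall Move_spec|xcbn; rewrite !catrevE !cats0 revK; reflexivity].
xcbn; rewrite sr size_rev; lia.
Qed.

Definition ReduceLoop := While 0 ReduceBody.

Lemma ReduceLoop_spec bs acc h : 0 < size h -> size acc <= size h ->
  exec ReduceLoop [:: bs; acc; h; [::]; [::]]
    [:: [::]; foldl (mod_step h) acc bs; h; [::]; [::]]
    (size bs * (42 * size h + 51) + 1).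
Proof.
move=> h0; elim: bs acc => [|b bs IH] acc ah; first exact: exec_while0.
eapply exec_le.
  eapply exec_while1; [by []|exact: ReduceBody_spec|apply: IH].
  by rewrite size_mod_step.
by move=> /=; lia.
Qed.

Fixpoint strip (a : seq bool) := if a is false :: a' then strip a' else a.

Definition Strip := Seq (Push 1 true) (While 1 (Case 0 (Pop 1) (Pop 0) (Pop 1))).

Lemma Strip_spec a : exec Strip [:: a; [::]] [:: strip a; [::]] (3 * size a + 6).
Proof.
rewrite /Strip; have -> : 3 * size a + 6 = (1 + (3 * size a + 4)).+1 by lia.
eapply exec_seq; [xs|xcbn]; elim: a => [|[] a IH].
- eapply exec_le; first eapply exec_while1; xcbn => //; first by xs.
  xcbn; by apply: exec_while0.
  by [].
- eapply exec_le; first eapply exec_while1; xcbn => //; first by xs.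
  xcbn; by apply: exec_while0.
  by move=> /=; lia.
by xloop IH; [xs|move=> /=; lia].
Qed.

Definition flushz z o := iter z (fun o => false :: true :: o) o.

Definition FlushZ := While 0 (Seq (Pop 0) (Seq (Push 1 true) (Push 1 false))).

Lemma FlushZ_spec z o : exec FlushZ [:: z; o] [:: [::]; flushz (size z) o] (6 * size z + 1).
Proof.
elim: z o => [|x z IH] o; first exact: exec_while0.
have -> : flushz (size (x :: z)) o = flushz (size z) (false :: true :: o) by apply: iterSr.
by xloop IH; [xs|move=> /=; lia].
Qed.

Definition EmitBits := While 0 (Case 0 (Pop 0)
  (Seq (Pop 0) (Seq (Push 1 true) (Push 1 false)))
  (Seq (Pop 0) (Seq (Push 1 true) (Push 1 true)))).

Lemma EmitBits_spec a o : exec EmitBits [:: a; o]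
  [:: [::]; foldl (fun o b => b :: true :: o) o a] (7 * size a + 1).
Proof.
elim: a o => [|x a IH] o; first exact: exec_while0.
by xloop IH; [case: x; xs|move=> /=; lia].
Qed.

Lemma enc_bits_rev a o : catrev (enc_bits a) o = false :: foldl (fun o b => b :: true :: o) o a.
Proof. by rewrite /enc_bits; elim: a o => [|b a IH] o //; rewrite enc_seq_cons /= IH. Qed.

(** Codes the coefficient on stack 0 and pushes the code, reversed, on stack 2.
    Stack 3 counts the zero coefficients that have been held back. *)
Definition EmitBlock :=
  let X := Seq (relabel [:: 3; 2] FlushZ) (Seq (Push 2 true) (
    Seq (relabel [:: 1; 0] Move) (Seq (relabel [:: 0; 2] EmitBits) (Push 2 false)))) in
  Seq (relabel [:: 0; 1] Move) (Seq (relabel [:: 1; 4] Strip) (Case 1 (Push 3 true) X X)).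

(** A zero coefficient is held back until a nonzero one follows: the code of a
    polynomial must not end with zero coefficients. *)
Definition push_coef (s : seq bool * seq bool) (r : seq bool) :=
  if r is [::] then (s.1, true :: s.2)
  else (catrev (enc_bits r) (true :: flushz (size s.2) s.1), [::]).

Definition trim a := rev (strip (rev a)).

Lemma size_strip a : size (strip a) <= size a.
Proof. by elim: a => // -[] a IH //=; apply: leqW. Qed.

Lemma EmitBlock_spec a s :
  exec EmitBlock [:: a; [::]; s.1; s.2; [::]]
    [:: [::]; [::]; (push_coef s (trim a)).1; (push_coef s (trim a)).2; [::]]
    (20 * size a + 6 * size s.2 + 30).
Proof.
have sr : size (strip (rev a)) <= size a by rewrite -[size a]size_rev size_strip.
rewrite /EmitBlock /push_coef /trim; case E: (strip (rev a)) => [|x r].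
  eapply exec_le.
    eapply exec_seq; [xcall Move_spec|xcbn; rewrite !catrevE !cats0].
    eapply exec_seq; [xcall Strip_spec|xcbn; rewrite E].
    by eapply exec_case; xcbn; xs.
  by xcbn; rewrite size_rev; lia.
have e : rev (x :: r) <> [::] by move=> /(congr1 size); rewrite size_rev.
case F: (rev (x :: r)) => [|y r'] //.
eapply exec_le.
  eapply exec_seq; [xcall Move_spec|xcbn; rewrite !catrevE !cats0].
  eapply exec_seq; [xcall Strip_spec|xcbn; rewrite E].
  eapply exec_case; xcbn; rewrite if_same.
  eapply exec_seq; [xcall FlushZ_spec|xcbn].
  eapply exec_seq; [xs|xcbn].
  eapply exec_seq; [xcall Move_spec|xcbn; rewrite !catrevE !cats0 F].
  eapply exec_seq; [xcall EmitBits_spec|xcbn].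
  by eapply exec_eq; [xs|xcbn; rewrite -catrevE enc_bits_rev].
rewrite E in sr; xcbn; rewrite -F !size_rev; lia.
Qed.

(** The fuel makes the recursion structural; the length of the list is enough,
    as every block takes at least one bit when d > 0. *)
Fixpoint chop fuel d (g : seq bool) : seq (seq bool) :=
  if fuel is n.+1 then
    if g is [::] then [::] else take d g :: chop n d (drop d g)
  else [::].

Definition reduce h block := foldl (mod_step h) [::] (rev block).

Definition residues h d g := [seq trim (reduce h b) | b <- chop (size g) d g].

Lemma size_reduce h b : size (reduce h b) <= size h.
Proof.
rewrite /reduce; elim/last_ind: (rev b) => [|s x _] //.
by rewrite foldl_rcons size_mod_step.
Qed.

(** Stacks: 0 the bit list to be cut into blocks, 1 output, 2 modulus, 3 d in
    unary, 6 current block, 7 its remainder, 10 reversed text, 11 zero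
    coefficients held back, 12 token; the others are scratch space. *)
Definition EmitLoop := While 0 (Seq (relabel [:: 3; 4; 5] Copy) (
  Seq (relabel [:: 4; 0; 6] TakeBlock) (
  Seq (relabel [:: 6; 7; 2; 8; 9] ReduceLoop) (
  relabel [:: 7; 8; 10; 11; 12] EmitBlock)))).

Lemma EmitLoop_spec g out h d s fuel M : 0 < size d -> 0 < size h ->
  size d <= M -> size h <= M -> size g + size s.2 <= M -> size g <= fuel ->
  exec EmitLoop
    [:: g; out; h; d; [::]; [::]; [::]; [::]; [::]; [::]; s.1; s.2; [::]]
    (let s' := foldl push_coef s [seq trim (reduce h b) | b <- chop fuel (size d) g] in
     [:: [::]; out; h; d; [::]; [::]; [::]; [::]; [::]; [::]; s'.1; s'.2; [::]])
    (size g * (42 * (M * M) + 100 * M + 50) + 1).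
Proof.
move=> d0 h0 dM hM; elim: fuel g s => [|fuel IH] [|x g] s gsM // gf /=; try exact: exec_while0.
set b := take (size d) (x :: g); set g' := drop (size d) (x :: g).
have sg' : size g' < size (x :: g) by rewrite size_drop /=; case: (size d) d0; lia.
have sb : size b <= M by rewrite size_take_min; apply: leq_trans dM; rewrite geq_minl.
have sr : size (reduce h b) <= M := leq_trans (size_reduce h b) hM.
have se : size (push_coef s (trim (reduce h b))).2 <= (size s.2).+1.
  by rewrite /push_coef; case: trim.
eapply exec_le.
  eapply exec_while1; [by []| |apply: IH]; xcbn.
  - eapply exec_seq; [xcall Copy_spec|xcbn; rewrite cats0].
    eapply exec_seq; [xcall TakeBlock_spec|xcbn; rewrite catrevE cats0 -/b -/g'].
    eapply exec_seq; [xcall (@ReduceLoop_spec (rev b) [::] h h0 (leq0n _))|xcbn; rewrite -/(reduce h b)].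
    xcall EmitBlock_spec.
  - by move: sg' gsM => /=; lia.
  - by move: sg' gf => /=; lia.
have m1 : size b * (42 * size h + 51) <= M * (42 * M + 51) by apply: leq_mul; lia.
have m2 : size g' * (42 * (M * M) + 100 * M + 50) <= size g * (42 * (M * M) + 100 * M + 50).
  by rewrite leq_mul2r; apply/orP; right; rewrite -ltnS.
rewrite /= in gsM; xcbn; rewrite size_rev -/b -/g' -/(reduce h b).
lia.
Qed.

Definition Emit := Seq EmitLoop (Seq (relabel [:: 11] Clear) (Seq (Push 10 false)
  (relabel [:: 10; 1] Move))).

Definition coef_text rs := rev (false :: (foldl push_coef ([::], [::]) rs).1).

(** A zero that is held back counts twice, because its code has two bits: then the
    total grows by the size of the code of each coefficient. *)
Lemma push_coef_sizes rs s : size (foldl push_coef s rs).1 + 2 * size (foldl push_coef s rs).2 <=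
  size s.1 + 2 * size s.2 + sumn [seq 2 + 2 * size r | r <- rs].
Proof.
elim: rs s => [|r rs IH] s /=; first by rewrite addn0.
apply: leq_trans (IH _) _; rewrite addnA leq_add2r.
have flz z o : size (flushz z o) = 2 * z + size o.
  by rewrite /flushz; elim: z => //= z ->; lia.
have enc_size (c : seq bool) : size (enc_bits c) = 2 * size c + 1.
  rewrite /enc_bits; elim: c => [|b c IHc] //.
  by rewrite enc_seq_cons /= IHc; lia.
case: r => [|b r]; first by rewrite /push_coef /=; lia.
by rewrite /push_coef catrevE size_cat size_rev enc_size /= flz; lia.
Qed.

Lemma Emit_spec g out h d M : 0 < size d -> 0 < size h ->
  size d <= M -> size h <= M -> size g <= M ->
  exec Emit
    [:: g; out; h; d; [::]; [::]; [::]; [::]; [::]; [::]; [::]; [::]; [::]]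
    [:: [::]; coef_text (residues h (size d) g) ++ out; h; d; [::]; [::]; [::]; [::]; [::]; [::]; [::]; [::]; [::]]
    (100 * (M * (M * M)) + 200 * (M * M) + 200 * M + 50).
Proof.
move=> d0 h0 dM hM gM.
have := push_coef_sizes (residues h (size d) g) ([::], [::]); rewrite /= muln0 addn0 add0n.
have : sumn [seq 2 + 2 * size r | r <- residues h (size d) g] <= size g * (2 + 2 * M).
  rewrite /residues; have := leqnn (size g); move: {2 3}(size g) => n.
  elim: n g {gM} => [|n IH] [|x g] //= gn.
  set r := trim _; have sr : size r <= M.
    rewrite /r /trim size_rev (leq_trans (size_strip _)) // size_rev.
    exact: leq_trans (size_reduce _ _) hM.
  set g' := drop _ _; have sg' : size g' <= size g.
    by rewrite size_drop /=; case: (size d) d0; lia.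
  have := IH g' (leq_trans sg' gn).
  have : size g' * (2 + 2 * M) <= size g * (2 + 2 * M) by rewrite leq_mul2r sg' orbT.
  lia.
set s' := foldl push_coef _ _ => h1 h2.
have s1 : size s'.1 + 2 * size s'.2 <= M * (2 + 2 * M).
  by apply: leq_trans h2 (leq_trans h1 _); rewrite leq_mul2r gM orbT.
have m : size g * (42 * (M * M) + 100 * M + 50) <= M * (42 * (M * M) + 100 * M + 50).
  by rewrite leq_mul2r gM orbT.
rewrite /Emit; eapply exec_le.
  eapply exec_seq.
    apply: (@EmitLoop_spec g out h d ([::], [::]) (size g) M) => //.
    by rewrite addn0.
  rewrite -/s' -/(residues h (size d) g); xcbn.
  eapply exec_seq; [xcall Clear_spec|xcbn].
  eapply exec_seq; [xs|xcbn].
  by eapply exec_eq; [xcall Move_spec|xcbn; rewrite catrevE].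
xcbn; rewrite /= -/s' -/(residues _ _ _); lia.
Qed.

(** * The program *)

(** In characteristic 2 the derivative keeps the coefficients of odd degree and
    kills the others. The highest coefficient is left on top, as the Horner
    product wants it. *)
Definition Deriv := While 0 (Seq (Pop 0) (Case 0 (Pop 0)
  (Seq (Pop 0) (Seq (Push 1 false) (Push 1 false)))
  (Seq (Pop 0) (Seq (Push 1 true) (Push 1 false))))).

Fixpoint deriv_bits (x : seq bool) :=
  if x is _ :: b :: x' then [:: b, false & deriv_bits x'] else [::].

Lemma Deriv_spec x g : exec Deriv [:: x; g] [:: [::]; catrev (deriv_bits x) g] (10 * size x + 1).
Proof.
have [n] := ubnP (size x); elim: n x g => // n IH [|a [|b x]] g xn.
- exact: exec_while0.
- by xloop (IH [::] g); [xs|move=> /=; lia].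
have lt : size x < n := ltn_trans (ltnSn _) xn; clear xn.
by case: b; [xloop (IH x (false :: true :: g) lt)|xloop (IH x (false :: false :: g) lt)];
  (try by xs); move=> /=; lia.
Qed.

Fixpoint PushWord w :=
  if w is b :: w' then Seq (PushWord w') (Push 0 b) else Seq (Push 0 true) (Pop 0).

Lemma PushWord_spec w a : exec (PushWord w) [:: a] [:: w ++ a] (2 * size w + 3).
Proof.
elim: w => [|b w IH]; first by rewrite /PushWord; eapply exec_le; [xs|].
eapply exec_le; first by eapply exec_seq; [exact: IH|xcbn; xs].
by move=> /=; lia.
Qed.

(** The codes of numerator and denominator of b = t / 1. *)
Definition text_of_b :=
  enc_seq enc_bits [:: [::]; [:: true]] ++ enc_seq enc_bits [:: [:: true]].

(** Stacks: 0 input and output, 1 to 3 tokens, 4 current place, 5 d in unary, 9 P,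
    10 Q, 12 accumulator, 13 modulus; the others are scratch space. The output
    starts with the code of the numerator, so it is pushed last. *)
Definition Finish :=
  Seq (relabel [:: 13; 8; 7] Copy) (
  Seq (relabel [:: 8; 4] Deriv) (
  Seq (relabel [:: 4; 10; 12; 6; 7] Horner) (
  Seq (relabel [:: 10] Clear) (
  Seq (relabel [:: 12; 10; 7] Transfer) (
  Seq (relabel [:: 5; 10; 7] PushZeros) (
  Seq (relabel [:: 13; 9; 7] PushZeros) (
  Seq (Pop 9) (
  Seq (Pop 9) (
  Seq (relabel [:: 0] (PushWord text_of_b)) (
  Seq (relabel [:: 10; 0; 13; 5; 6; 7; 4; 12; 8; 11; 2; 3; 1] Emit) (
  relabel [:: 9; 0; 13; 5; 6; 7; 4; 12; 8; 11; 2; 3; 1] Emit))))))))))).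

Definition Main :=
  Seq (relabel [:: 0; 5; 7] Copy) (
  Seq (relabel [:: 0; 1; 13; 7] ParseH) (
  Seq (Push 10 true) (
  Seq (relabel [:: 0; 1; 2; 3; 4; 5; 6; 7; 8; 9; 10; 11; 12] (Items PlaceBody))
  Finish))).

(** Numerator X^(k-1) P and denominator t h' Q of a, after t -> X^d. *)
Definition final_P (h p : seq bool) := nseq (size h - 2) false ++ p.
Definition final_Q h d q := nseq d false ++ horner_mul (rev (deriv_bits h)) q.

Lemma size_deriv_bits h : size (deriv_bits h) <= size h.
Proof.
have [n] := ubnP (size h); elim: n h => // n IH [|a [|b x]] // xn.
by rewrite /= !ltnS; apply: IH; move: xn => /=; lia.
Qed.

Lemma size_enc_bits c : size (enc_bits c) = 2 * size c + 1.
Proof.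
rewrite /enc_bits; elim: c => [|b c IHc] //.
by rewrite enc_seq_cons /= IHc; lia.
Qed.

Lemma size_places_state d s os : 0 < d -> all (small_place d d) os ->
  maxn (size (foldl (place_option_step d) s os).1) (size (foldl (place_option_step d) s os).2)
  <= maxn (size s.1) (size s.2) + d * sumn (map coef_count os).
Proof.
move=> d0; elim: os s => [|[cs|] os IH] s /=; first by rewrite muln0 addn0.
  case/andP=> /and3P[scs _ _] sos; apply: leq_trans (IH _ sos) _.
  rewrite mulnDr addnA leq_add2r geq_max /=; have fE := size_flatten_padded scs.
  rewrite size_xorl geq_max size_cat size_nseq.
  have := size_horner_mul (rev (flatten_padded d cs)) s.1; have := size_horner_mul (rev (flatten_padded d cs)) s.2.
  by rewrite size_rev fE; lia.
by move=> sos; rewrite add0n; apply: IH.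
Qed.

Lemma Finish_spec h w p q M (d := size w) : 0 < size w -> 1 < size h ->
  size h <= M -> size w <= M -> size p <= M -> size q <= M ->
  exec Finish
    [:: [::]; [::]; [::]; [::]; [::]; w; [::]; [::]; [::]; p; q; [::]; [::]; h]
    [:: coef_text (residues h d (final_P h p)) ++
        coef_text (residues h d (final_Q h d q)) ++ text_of_b;
        [::]; [::]; [::]; [::]; w; [::]; [::]; [::]; [::]; [::]; [::]; [::]; h]
    (190 * (100 * (M * (M * M)))).
Proof.
move=> d0 h1 hM wM pM qM.
have sF : size (deriv_bits h) <= M by have := size_deriv_bits h; lia.
have sQ : size (horner_mul (rev (deriv_bits h)) q) <= M + M.
  by rewrite (leq_trans (size_horner_mul _ _)) // size_rev leq_add.
have h0 : 0 < size h by lia.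
have fP : size (final_P h p) <= 3 * M by rewrite size_cat size_nseq; lia.
have fQ : size (final_Q h d q) <= 3 * M by rewrite size_cat size_nseq /d; lia.
have hM3 : size h <= 3 * M by lia.
have wM3 : size w <= 3 * M by lia.
have m1 : size (deriv_bits h) * (21 * size q + 11) <= M * (21 * M + 11) by apply: leq_mul; lia.
have hfP : behead (behead (nseq (size h) false ++ p)) = final_P h p.
  by rewrite /final_P; case: (size h) h1 => [|[|n]] // _; rewrite subn2.
have emitQ := @Emit_spec (final_Q h d q) text_of_b h w _ d0 h0 wM3 hM3 fQ.
have emitP := @Emit_spec (final_P h p)
  (coef_text (residues h d (final_Q h d q)) ++ text_of_b) h w _ d0 h0 wM3 hM3 fP.
eapply exec_le.
  eapply exec_seq; [xcall Copy_spec|xcbn; rewrite cats0].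
  eapply exec_seq; [xcall Deriv_spec|xcbn; rewrite catrevE cats0].
  eapply exec_seq; [xcall Horner_spec|xcbn; rewrite -/(horner_mul _ _)].
  eapply exec_seq; [xcall Clear_spec|xcbn].
  eapply exec_seq; [xcall Transfer_spec|xcbn; rewrite cats0].
  eapply exec_seq; [xcall PushZeros_spec|xcbn].
  eapply exec_seq; [xcall PushZeros_spec|xcbn].
  eapply exec_seq; [xs|xcbn].
  eapply exec_seq; [xs|xcbn; rewrite hfP].
  eapply exec_seq; [xcall PushWord_spec|xcbn; rewrite cats0].
  eapply exec_seq; [xcall emitQ|xcbn].
  xcall emitP.
xcbn; rewrite -/(horner_mul _ _) /= size_rev -/d.
have M1 : 0 < M by lia.
have M2 : M <= M * M by rewrite leq_pmulr.
have M3 : M * M <= M * (M * M) by rewrite leq_pmull.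
lia.
Qed.

Lemma Main_spec h os (w := enc_bits h ++ enc_seq enc_place_bits os) (d := size w) M :
  1 < size h -> all (small_place d d) os -> 1 + d * sumn (map coef_count os) + d <= M ->
  size os <= d ->
  let s := foldl (place_option_step d) ([::], [:: true]) os in
  exists l, exec Main (w :: nseq 13 [::])
    [:: coef_text (residues h d (final_P h s.1)) ++
        coef_text (residues h d (final_Q h d s.2)) ++ text_of_b & l]
    (200 * (100 * (M * (M * M)))).
Proof.
move=> h1 sos dM osd s.
have hd : size h <= d by rewrite /d size_cat size_enc_bits; lia.
have sM : maxn (size s.1) (size s.2) + d <= M.
  by apply: leq_trans dM; rewrite leq_add2r; apply: size_places_state sos; lia.
have sosM : all (small_place d M) os.
  apply: sub_all sos => -[cs|] //= /and3P[-> c1 c2] /=; lia.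
have HP : exec (Items PlaceBody)
    [:: enc_seq enc_place_bits os; [::]; [::]; [::]; [::]; w; [::]; [::]; [::]; [::]; [:: true]; [::]; [::]]
    [:: [::]; [::]; [::]; [::]; [::]; w; [::]; [::]; [::]; s.1; s.2; [::]; [::]]
    ((42 * (M * M) + 220 * M + 68) * size os + 9).
  rewrite -[enc_seq _ _]cats0.
  by apply: (@Places_spec w M os ([::], [:: true]) [::]) => //=; rewrite -/d; lia.
have m2 : (42 * (M * M) + 220 * M + 68) * size os <= (42 * (M * M) + 220 * M + 68) * M.
  by rewrite leq_mul2l; lia.
have fin := @Finish_spec h w s.1 s.2 M.
clearbody s; move: s HP fin sM => [p q] /= HP fin sM.
eexists; eapply exec_le.
  eapply exec_seq; [xcall Copy_spec|xcbn; rewrite cats0].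
  eapply exec_seq; [rewrite {1}/w; xcall ParseH_spec|xcbn].
  eapply exec_seq; [xs|xcbn].
  eapply exec_seq; [xcall HP|xcbn].
  by apply: fin; rewrite -/d; lia.
have M1 : 0 < M by lia.
have M2 : M <= M * M by rewrite leq_pmulr.
have M3 : M * M <= M * (M * M) by rewrite leq_pmull.
by xcbn; rewrite -/d; lia.
Qed.

Import Order.TTheory GRing.Theory Num.Theory.
Local Open Scope ring_scope.
Local Open Scope quotient_scope.

(** * Running time and output of a run without coins *)

Section Running.
Variables (P : program) (x : seq bool) (n T : nat) (l : seq (seq bool)).
Hypothesis P_exec : exec P (x :: nseq n [::]) l T.

Lemma start_store_of : start P x = ([:: P], store_of (x :: nseq n [::])).
Proof.
rewrite /start; congr pair; apply/funext => -[|i] //=.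
by rewrite /store_of /= nth_nseq if_same.
Qed.

Lemma foldl_halted s w : foldl step ([::], s) w = ([::], s).
Proof. by elim: w. Qed.

Lemma run_halted w : (T <= size w)%N -> run P x w = ([::], store_of l).
Proof.
have [m mT /big_step_foldl e] := P_exec; move=> /(leq_trans mT) mw.
rewrite /run start_store_of -(cat_take_drop m w) foldl_cat (e [::]) ?size_takel //.
exact: foldl_halted.
Qed.

(** After T steps the run has halted whatever the coins are, so that at most T
    terms of the sum differ from 0. *)
Lemma expected_time_exec : expected_time_le P x T.
Proof.
move=> N; apply: (@le_trans _ _ (\sum_(i < N | (i < T)%N) 1)).
  rewrite [leRHS]big_mkcond; apply: ler_sum => i _.
  rewrite /prob_running; case: ltnP => iT.
    rewrite ler_pdivrMr ?ltr0n ?expn_gt0 // mul1r ler_nat.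
    by rewrite (leq_trans (max_card _)) // card_tuple card_bool.
  rewrite (_ : #|_| = 0%N) ?mul0r //; apply: eq_card0 => w.
  by rewrite !inE run_halted ?size_tuple.
rewrite sumr_const ler_nat.
have [NT|TN] := leqP N T; first by rewrite (leq_trans (max_card _)) // card_ord.
rewrite -sum1_card -(big_ord_widen _ (fun=> 1%N)) ?(ltnW TN) //.
by rewrite sum1_card card_ord.
Qed.

(** A halted configuration does not change any more, so a run that halts can be
    prolonged until it is comparable with the known one. *)
Lemma may_output_exec y : may_output P x y -> y = nth [::] l 0.
Proof.
move=> [w []]; have := run_halted (w := w ++ nseq T false).
rewrite size_cat size_nseq leq_addl => /(_ isT).
rewrite /run foldl_cat -/(run _ _ _); case: (run P x w) => -[|//] s.
by rewrite foldl_halted => -[->].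
Qed.

End Running.

(** * Quaternion algebras in characteristic 2 *)

Lemma two_eq0 (R : nzRingType) : 2%N \in [pchar R] -> 1 + 1 = 0 :> R.
Proof. by move=> R2; rewrite -mulr2n (mulrn_pchar R2). Qed.

(** An identity in characteristic 2 is proved by exhibiting half of the difference
    of both sides, which reduces it to an identity over the integers. *)
Lemma eq_mod2 (R : comNzRingType) (R2 : 2%N \in [pchar R]) (z x y : R) :
  x - y = (1 + 1) * z -> x = y.
Proof. by rewrite two_eq0 // mul0r => /eqP; rewrite subr_eq0 => /eqP. Qed.

Section QuaternionSplitting.
Variables (K : fieldType) (a b : K).
Hypothesis K2 : 2%N \in [pchar K].

(** The element i + w + u j is a root of x (x + 1). *)
Lemma quat_split w u :
  a = w ^+ 2 + w + b * u ^+ 2 -> ~ division_algebra (quat a b).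
Proof.
move=> aE dA; pose x : quat a b := Quat a b w 1 u 0.
have x0 : x != 0 by apply/eqP => -[_ /eqP]; rewrite oner_eq0.
have x1 : x + 1 = 0.
  have [y [_ yx]] := dA x x0.
  suff xx1 : x * (x + 1) = 0 by rewrite -[LHS]mul1r -[X in X * _]yx -mulrA xx1 mulr0.
  congr Quat; rewrite ?aE.
  - by apply: (eq_mod2 K2 (z := w ^+ 2 + w + b * u ^+ 2)); ring.
  - by apply: (eq_mod2 K2 (z := w + 1)); ring.
  - by apply: (eq_mod2 K2 (z := u * w + u)); ring.
  - ring.
by case: x1 => _ /eqP; rewrite addr0 oner_eq0.
Qed.

(** An element x = (x0 + x2 j) + i (x1 + x3 j) is invertible when its norm is not
    zero. If the norm vanishes, then, as b is not a square, either x = 0 or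
    x1 + x3 j is invertible; dividing by it gives an element i + w + u j of
    norm 0, which means a = w^2 + w + b u^2. *)
Lemma quat_division :
  (forall r, b != r ^+ 2) ->
  (forall w u, a != w ^+ 2 + w + b * u ^+ 2) -> division_algebra (quat a b).
Proof.
move=> bns ans x x0.
pose nx := q0 x ^+ 2 + q0 x * q1 x - a * q1 x ^+ 2
           - b * (q2 x ^+ 2 + q2 x * q3 x - a * q3 x ^+ 2).
pose cx : quat a b := Quat a b (q0 x + q1 x) (- q1 x) (- q2 x) (- q3 x).
have nx0 : nx != 0; last first.
  exists (nx^-1 *: cx); rewrite -scalerAr -scalerAl.
  have -> : x * cx = nx *: 1.
    by rewrite /nx /cx; case: (x) => x0' x1 x2 x3 /=; congr Quat => /=; ring.
  have -> : cx * x = nx *: 1.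
    by rewrite /nx /cx; case: (x) => x0' x1 x2 x3 /=; congr Quat => /=; ring.
  by rewrite scalerA mulVf // scale1r.
have sq0 y z : y ^+ 2 + b * z ^+ 2 = 0 -> y = 0 /\ z = 0.
  move=> e; have [z0|z0] := eqVneq z 0.
    split=> //; apply/eqP; rewrite -sqrf_eq0.
    by rewrite -e z0 expr0n mulr0 addr0.
  case/eqP: (bns (y / z)); apply: (mulIf (expf_neq0 2 z0)).
  rewrite exprMn exprVn divfK ?expf_neq0 //.
  by apply: (eq_mod2 K2 (z := - y ^+ 2)); rewrite -[LHS]subr0 -[X in _ - X]e; ring.
apply/eqP; rewrite {}/nx {}/cx; case: x x0 => x0 x1 x2 x3 /= xn0 n0.
have [D0|D0] := eqVneq (x1 ^+ 2 + b * x3 ^+ 2) 0.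
  have [x10 x30] := sq0 _ _ D0; move: n0; rewrite x10 x30 => n0.
  have [|x00 x20] := sq0 x0 x2.
    apply: (eq_mod2 K2 (z := b * x2 ^+ 2)); rewrite -[LHS]subr0 -[X in _ - X]n0; ring.
  by case/eqP: xn0; rewrite x00 x10 x20 x30.
set D := x1 ^+ 2 + b * x3 ^+ 2 in D0.
case/eqP: (ans ((x0 * x1 + b * x2 * x3) / D) ((x0 * x3 + x1 * x2) / D)).
apply: (mulIf (expf_neq0 2 D0)).
have -> : (((x0 * x1 + b * x2 * x3) / D) ^+ 2 + (x0 * x1 + b * x2 * x3) / D +
   b * ((x0 * x3 + x1 * x2) / D) ^+ 2) * D ^+ 2 =
   (x0 * x1 + b * x2 * x3) ^+ 2 + (x0 * x1 + b * x2 * x3) * D +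
   b * (x0 * x3 + x1 * x2) ^+ 2 by field.
have aD : a * D = x0 ^+ 2 + x0 * x1 + b * (x2 ^+ 2 + x2 * x3).
  apply: (eq_mod2 K2 (z := a * b * x3 ^+ 2 - b * x2 ^+ 2 - b * x2 * x3)).
  by rewrite -[LHS]addr0 -[X in _ + X]n0 /D; ring.
rewrite expr2 mulrA aD; apply: (eq_mod2 K2 (z := - (b * x0 * x1 * x2 * x3 *+ 2))).
by rewrite /D; ring.
Qed.
End QuaternionSplitting.

(** * Equations over a completion *)

Section CompletionEquations.
Variables (F : fieldType) (v : valuation F).
Local Notation toc := (to_completion v).

Lemma null_eq0 (s : cauchy_seq v) : \pi_(completion v) s = 0 -> null v (val s).
Proof.
move/eqP; rewrite -[0](rmorph0 \pi_(completion v)) eqmodE /= /Quotient.equiv subr0.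
by move/asboolP.
Qed.

Lemma eq0_null (s : cauchy_seq v) : null v (val s) -> \pi_(completion v) s = 0.
Proof.
move=> ns; apply/eqP.
rewrite -[0](rmorph0 \pi_(completion v)) eqmodE /= /Quotient.equiv subr0.
exact/asboolP.
Qed.

Lemma approx_decomposition (a b : F) (w u : completion v) :
  toc a = w ^+ 2 + w + toc b * u ^+ 2 ->
  exists w0 u0, vge v 1 (a - (w0 ^+ 2 + w0 + b * u0 ^+ 2)).
Proof.
elim/quotW: w => s; elim/quotW: u => r /eqP; rewrite !expr2.
rewrite -subr_eq0 /to_completion -!rmorphM -!rmorphD -rmorphB => /eqP/null_eq0.
move=> /(_ 1)[N /(_ N (leqnn N))].
rewrite rmorphB !rmorphD !rmorphM /= => h.
by exists (val s N), (val r N).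
Qed.

Lemma approx_square (b : F) (r : completion v) (n : int) :
  toc b = r ^+ 2 -> exists r0, vge v n (b - r0 ^+ 2).
Proof.
elim/quotW: r => r /eqP; rewrite -subr_eq0 expr2 /to_completion -rmorphM -rmorphB => /eqP/null_eq0.
move=> /(_ n)[N /(_ N (leqnn N))]; rewrite rmorphB rmorphM /= => h.
by exists (val r N).
Qed.

Hypothesis F2 : 2%N \in [pchar F].

(** The series e + e^2 + e^4 + ... converges to a solution. *)
Lemma artin_schreier_solvable (e : F) :
  vge v 1 e -> exists w, toc e = w ^+ 2 + w.
Proof.
move=> e1.
have ve n : vge v n%:Z (e ^+ (2 ^ n)).
  elim: n => [|[|n] IH].
  - by apply: vge_le e1.
  - by rewrite expr2; apply: vge_le (vgeM e1 e1).
  rewrite expnS mulnC exprM expr2; apply: vge_le (vgeM IH IH).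
  by rewrite -PoszD lez_nat addSnnS leq_addl.
pose S n := \sum_(i < n) e ^+ (2 ^ i).
have SS n : S n ^+ 2 + S n = e + e ^+ (2 ^ n).
  elim: n => [|n IH].
    rewrite /S !big_ord0 expr0n addr0 expn0 expr1 /=.
    by apply: (eq_mod2 F2 (z := - e)); ring.
  rewrite /S big_ord_recr /= -/(S n) expnS mulnC exprM.
  apply: (eq_mod2 F2 (z := S n * e ^+ (2 ^ n) + e ^+ (2 ^ n))).
  rewrite -[RHS]addr0 -[X in _ = _ + X](subrr (e + e ^+ (2 ^ n))) -[X in _ = _ + (X - _)]IH.
  ring.
have Sn N j : (N <= j)%N -> vge v N%:Z (S j - S N).
  move=> /subnK <-; elim: (j - N)%N => [|m IH]; first by rewrite subrr vge0.
  rewrite addSn /S big_ord_recr /= -/(S _) addrAC; apply: vgeD => //.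
  by apply: vge_le (ve _); rewrite lez_nat leq_addl.
have cS : S \in cauchy_pred v.
  apply/asboolP => n; exists `|n|%N => i j ni nj.
  rewrite -(subrKA (S `|n|%N)) -[X in _ + X]opprB.
  apply: (@vge_le _ _ `|n|%N); first exact: lez_abs.
  by apply: vgeB; apply: Sn.
exists (\pi_(completion v) (Sub S cS : cauchy_seq v)); apply/eqP.
rewrite eq_sym -subr_eq0 expr2 /to_completion -rmorphM -rmorphD -rmorphB; apply/eqP/eq0_null => n.
exists `|n|%N => i ni; rewrite rmorphB rmorphD rmorphM /=.
have -> : (S * S + S - (fun=> e)) i = e ^+ (2 ^ i) by rewrite !fctE /= -expr2 SS addrC addKr.
by apply: vge_le (ve i); apply: le_trans (lez_abs n) _; rewrite lez_nat.
Qed.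

End CompletionEquations.

(** * The obstruction at a pole *)

Section PolynomialLemma.
Variable k : fieldType.
Hypotheses (k2 : 2%N \in [pchar k]) (k_perfect : forall x : k, exists y, x = y ^+ 2).
Implicit Types (f p A B : {poly k}).

Lemma poly_pchar2 : 2%N \in [pchar {poly k}].
Proof. by rewrite pchar_poly. Qed.
Local Notation p2 := poly_pchar2.

(** Even and odd parts, which are squares because k is perfect. *)
Lemma square_decomposition p : exists A B, p = A ^+ 2 + 'X * B ^+ 2.
Proof.
elim/poly_ind: p => [|p c [A [B pE]]].
  by exists 0, 0; rewrite expr0n mulr0 addr0.
have [e ->] := k_perfect c; exists ('X * B + e%:P), A.
apply: (eq_mod2 p2 (z := - ('X * B * e%:P))).
by rewrite pE rmorphXn /=; ring.
Qed.

Variables (f A B : {poly k}).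
Hypotheses (fP : is_prime_poly f) (fE : f = A ^+ 2 + 'X * B ^+ 2).

Let f_monic : f \is monic. Proof. by have /andP[] := fP. Qed.
Let f_irr : irreducible_poly f. Proof. by have /andP[_ /asboolP] := fP. Qed.
Let f0 : f != 0. Proof. exact: monic_neq0. Qed.

Lemma prime_poly_dvdM p q : f %| p * q -> (f %| p) || (f %| q).
Proof.
have [//|np /=] := boolP (f %| p).
by rewrite Gauss_dvdpr // irreducible_poly_coprime.
Qed.

Lemma prime_poly_dvdX p n : f %| p ^+ n -> f %| p.
Proof.
elim: n => [|n IH]; last by rewrite exprS => /prime_poly_dvdM/orP[|/IH].
rewrite expr0 dvdp1; case: (f_irr) => + _.
by case: size => [|[|]].
Qed.

(** B^2 is the derivative of f: irreducible polynomials over perfect fields are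
    separable. *)
Lemma prime_ndvd_odd_part : ~~ (f %| B).
Proof.
apply/negP => fB; have : f %| A ^+ 2.
  by rewrite -(dvdp_addl _ (dvdp_mull 'X (dvdp_exp (isT : 0 < 2)%N fB))) -fE.
move/prime_poly_dvdX => fA.
have : f ^+ 2 %| f.
  by rewrite {2}fE; apply: dvdp_add (dvdp_mull _ _); apply: dvdp_exp2r.
rewrite -[X in _ %| X]mulr1 expr2 dvdp_mul2l // dvdp1.
by case: (f_irr) => + _; case: size => [|[|]].
Qed.

Lemma prime_ndvd_even_part : f != 'X -> ~~ (f %| A).
Proof.
move=> fX; apply/negP => fA; have : f %| 'X * B ^+ 2.
  by rewrite -(dvdp_addr _ (dvdp_exp (isT : 0 < 2)%N fA)) -fE.
move=> /prime_poly_dvdM /orP[|/prime_poly_dvdX]; last exact/negP/prime_ndvd_odd_part.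
move=> fdX; case: (f_irr) => f1 _.
have : size f == size ('X : {poly k}).
  rewrite size_polyX eqn_leq; apply/andP; split.
    by have := dvdp_leq (monic_neq0 (monicX k)) fdX; rewrite size_polyX.
  by move: f1 f0; rewrite -size_poly_gt0; case: size => [|[|]].
by rewrite (dvdp_size_eqp fdX) eqp_monic ?monicX // (negPf fX).
Qed.

Lemma prime_root0 : f != 'X -> f.[0] != 0.
Proof.
move=> fX; apply/negP => /eqP e.
have : 'X %| f by rewrite -['X]subr0 -polyC0 dvdp_XsubCl /root e.
move=> Xf; case: (f_irr) => _ /(_ 'X); rewrite size_polyX => /(_ isT Xf).
by rewrite eqp_monic ?monicX // eq_sym (negPf fX).
Qed.

Variable c : k.
Hypothesis c_as : forall z, c != z ^+ 2 + z.

(** Dividing by A^2 = X B^2 = X f', one sees that such a y exists if and only if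
    c X^(d-1) / f' is of the form z^2 + z in the residue field of f. By Euler's
    formula the trace of that element is the trace of c. Here is a direct
    argument. Let W and U be the remainders of A y and B y. Then
    W^2 + X U^2 + W f + c X^d f is divisible by f^2, and comparing degrees
    shows that it is equal to c f^2. At X = 0 this gives
    c = z^2 + z for z = W(0) / f(0). *)
Theorem residue_obstruction y : f != 'X ->
  ~~ (f %| y ^+ 2 + A * y + c%:P * 'X^((size f).-1)).
Proof.
move=> fX; apply/negP => /dvdpP[q qE]; set d := (size f).-1 in qE.
have d_gt0 : (0 < d)%N by case: (f_irr) => f1 _; move: f1; rewrite /d -subn1 subn_gt0.
have sf : size f = d.+1 by rewrite /d prednK // size_poly_gt0.
pose W := (A * y) %% f; pose m := (A * y) %/ f.
pose U := (B * y) %% f; pose n := (B * y) %/ f.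
have WE : W = A * y - m * f by rewrite (divp_eq (A * y) f) addrC addKr.
have UE : U = B * y - n * f by rewrite (divp_eq (B * y) f) addrC addKr.
have sW : (size W <= d)%N by rewrite -ltnS -sf ltn_modp.
have sU : (size U <= d)%N by rewrite -ltnS -sf ltn_modp.
pose G := W ^+ 2 + 'X * U ^+ 2 + W * f + c%:P * 'X^d * f.
pose g := q + m ^+ 2 + 'X * n ^+ 2 - m.
have GE : G = f ^+ 2 * g.
  have -> : f ^+ 2 * g = f * (y ^+ 2 + A * y + c%:P * 'X^d) +
     f ^+ 2 * (m ^+ 2 + 'X * n ^+ 2 - m) by rewrite qE /g; ring.
  apply: (eq_mod2 p2 (z := - (f * (m * A * y + n * 'X * B * y)))).
  have -> : f * (y ^+ 2 + A * y + c%:P * 'X^d) = (A ^+ 2 + 'X * B ^+ 2) * y ^+ 2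
     + f * (A * y + c%:P * 'X^d) by rewrite -fE; ring.
  by rewrite /G WE UE; ring.
have fm2 : f ^+ 2 \is monic by rewrite monic_exp.
have sf2 : size (f ^+ 2) = (d * 2).+1 by rewrite expr2 size_monicM // sf; lia.
have sW2 : (size (W ^+ 2) <= d * 2)%N.
  apply: leq_trans (size_poly_exp_leq _ _) _.
  by case: (size W) sW => [|s] /=; lia.
have sU2 : (size ('X * U ^+ 2)%R <= d * 2)%N.
  apply: leq_trans (size_polyMleq _ _) _; rewrite size_polyX /=.
  have := size_poly_exp_leq U 2; move: (size (U ^+ 2)) => e.
  by case: (size U) sU => [|s] /=; lia.
have sWf : (size (W * f)%R <= d * 2)%N.
  by apply: leq_trans (size_polyMleq _ _) _; rewrite sf addnS muln2 -addnn leq_add2r.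
have scf : (size (c%:P * 'X^d * f)%R <= (d * 2).+1)%N.
  apply: leq_trans (size_polyMleq _ _) _; rewrite sf mul_polyC addnS muln2 -addnn -[leqRHS]addSn leq_add2r.
  by apply: leq_trans (size_scale_leq _ _) _; rewrite size_polyXn.
have sG : (size G <= (d * 2).+1)%N.
  rewrite /G; apply: leq_trans (size_polyD _ _) _; rewrite geq_max scf andbT.
  apply: leq_trans (size_polyD _ _) _; rewrite geq_max (leqW sWf) andbT.
  by apply: leq_trans (size_polyD _ _) _; rewrite geq_max !leqW.
have gC : g = (g`_0)%:P.
  apply: size1_polyC; have [->|g0] := eqVneq g 0; first by rewrite size_poly0.
  by move: sG; rewrite GE size_monicM // sf2 addSn -[leqRHS]addn1 leq_add2l.
have GE' : G = (g`_0)%:P * f ^+ 2 by rewrite GE {1}gC mulrC.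
have g0c : g`_0 = c.
  have := congr1 (fun p : {poly k} => p`_(d * 2)) GE'.
  rewrite /G !coefD (nth_default _ sW2) (nth_default _ sU2) (nth_default _ sWf).
  rewrite !add0r coefCM -mulrA coefCM coefXnM.
  have -> : (d * 2 < d)%N = false by lia.
  have -> : (d * 2 - d)%N = d by lia.
  have -> : (f ^+ 2)`_(d * 2) = 1.
    by have := monicP fm2; rewrite lead_coefE sf2.
  by rewrite -lead_coefE (monicP f_monic) !mulr1.
have fh0 := prime_root0 fX.
have := congr1 (fun p : {poly k} => p.[0]) GE'.
rewrite g0c /G !hornerE expr0n eqn0Ngt d_gt0 => e.
have := c_as (W.[0] / f.[0]); case/eqP; apply: (mulIf (expf_neq0 2 fh0)).
transitivity (W.[0] ^+ 2 + W.[0] * f.[0]); last by field.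
by rewrite expr2 mulrA -e mulr0 mul0r addr0.
Qed.

End PolynomialLemma.

(** * Valuations of squares *)

Section ValuationParity.
Variables (F : fieldType) (v : valuation F).

Lemma vge_sqrl n m (x : F) : 2 * m <= n + 1 -> vge v n (x ^+ 2) -> vge v m x.
Proof.
have [->|x0] := eqVneq x 0; first by rewrite vge0.
rewrite !vge_nz ?expf_neq0 // expr2 Defs.valM // => h1 h2; lia.
Qed.

Lemma vge_sqrr n m (x : F) : n <= 2 * m -> vge v m x -> vge v n (x ^+ 2).
Proof. by move=> h hx; rewrite expr2; apply: vge_le (vgeM hx hx); lia. Qed.

Lemma vge_sum (I : Type) (r : seq I) (P : pred I) (G : I -> F) n :
  (forall i, P i -> vge v n (G i)) -> vge v n (\sum_(i <- r | P i) G i).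
Proof.
move=> h; elim/big_ind: _ => //; first exact: vge0.
by move=> x y; apply: vgeD.
Qed.

Lemma vge_addl n (x y : F) : vge v n y -> vge v n (x + y) = vge v n x.
Proof.
move=> hy; apply/idP/idP => h; last exact: vgeD.
by rewrite -(addrK y x); apply: vgeB.
Qed.

Lemma vge_add_lt n (x y : F) : x != 0 -> y != 0 ->
  v x < v y -> vge v n (x + y) -> n <= v x.
Proof.
move=> x0 y0 xy h; rewrite leNgt; apply/negP => lt.
have : vge v (v x + 1) x.
  rewrite -[z in vge _ _ z](addrK y x); apply: vgeB; last by rewrite vge_nz //; lia.
  by apply: vge_le h; lia.
by rewrite vge_nz //; lia.
Qed.

(** The valuations of both terms have different parities, so that there is no
    cancellation. *)
Lemma vge_odd_even n m (p x y : F) : p != 0 -> v p = 2 * m + 1 ->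
  vge v n (x ^+ 2 + p * y ^+ 2) -> vge v n (x ^+ 2) /\ vge v n (p * y ^+ 2).
Proof.
move=> p0 vp; have [->|x0] := eqVneq x 0.
  by rewrite expr0n add0r vge0.
have [->|y0] := eqVneq y 0; first by rewrite expr0n mulr0 addr0 vge0.
have X0 : x ^+ 2 != 0 by rewrite expf_neq0.
have Y0 : p * y ^+ 2 != 0 by rewrite mulf_neq0 ?expf_neq0.
have vX : v (x ^+ 2) = v x + v x by rewrite expr2 Defs.valM.
have vY : v (p * y ^+ 2) = 2 * m + 1 + (v y + v y).
  by rewrite Defs.valM ?expf_neq0 // vp expr2 Defs.valM.
move: X0 Y0 vX vY; move: (x ^+ 2) (p * y ^+ 2) => X Y X0 Y0 vX vY h.
have [lXY|lYX] : v X < v Y \/ v Y < v X by lia.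
  have nX := vge_add_lt X0 Y0 lXY h.
  by rewrite !vge_nz // nX; split=> //; lia.
rewrite addrC in h; have nY := vge_add_lt Y0 X0 lYX h.
by rewrite !vge_nz // nY; split=> //; lia.
Qed.

Lemma vge_odd_sqrl n m l (p y : F) : p != 0 -> v p = 2 * m + 1 ->
  2 * l + 2 * m <= n -> vge v n (p * y ^+ 2) -> vge v l y.
Proof.
move=> p0 vp; have [->|y0] := eqVneq y 0; first by rewrite vge0.
rewrite !vge_nz ?mulf_neq0 ?expf_neq0 // expr2 !Defs.valM ?mulf_neq0 // vp; lia.
Qed.

Lemma vge_odd_sqrr n m l (p y : F) : p != 0 -> v p = 2 * m + 1 ->
  n <= 2 * l + 2 * m + 1 -> vge v l y -> vge v n (p * y ^+ 2).
Proof.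
move=> p0 vp; have [->|y0] := eqVneq y 0.
  by rewrite expr0n /= mulr0 !vge0.
rewrite !vge_nz ?mulf_neq0 ?expf_neq0 // expr2 !Defs.valM ?mulf_neq0 // vp; lia.
Qed.

Lemma vge_neg (x : F) : exists M : nat, vge v (- M%:Z) x.
Proof.
have [->|x0] := eqVneq x 0; first by exists 0%N; rewrite vge0.
by exists `|v x|%N; rewrite vge_nz //; lia.
Qed.

End ValuationParity.

(** * Local splitting of [a, t) *)

(** As w^2 + w is additive in characteristic 2, an error term e of the form
    z^2 + z is absorbed by passing from w to w + z. *)
Lemma artin_schreier_shift (R S : comNzRingType) (f : {rmorphism R -> S})
    (a b w u : R) (z : S) : 2%N \in [pchar S] ->
  f (a - (w ^+ 2 + w + b * u ^+ 2)) = z ^+ 2 + z ->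
  f a = (f w + z) ^+ 2 + (f w + z) + f b * f u ^+ 2.
Proof.
move=> S2; rewrite rmorphB !rmorphD rmorphXn rmorphM rmorphXn => /eqP.
rewrite subr_eq => /eqP ->; apply: (eq_mod2 S2 (z := - (f w * z))); ring.
Qed.

Section LocalSplitting.
Variable k : fieldType.
Hypothesis k2 : 2%N \in [pchar k].
Local Notation F := (ratfun k).
Local Notation t := ('X%:F : F).
Implicit Types (v : place k) (a : F).

Lemma ratfun_pchar2 : 2%N \in [pchar F].
Proof.
rewrite inE /= -(rmorph_nat (@FracField.tofrac {poly k})) tofrac_eq0.
by rewrite -polyC_natr polyC_eq0; have := k2; rewrite inE.
Qed.
Local Notation F2 := ratfun_pchar2.

(** The condition for [a, t) to be split over the completion at v, in terms of F
    alone. *)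
Definition locally_split v a :=
  exists w u : F, vge (place_val v) 1 (a - (w ^+ 2 + w + t * u ^+ 2)).

(** The hypothesis says that t is not a square in the completion. *)
Lemma ramified_split v a :
  (exists n, forall r, ~~ vge (place_val v) n (t - r ^+ 2)) ->
  ramified a t v <-> ~ locally_split v a.
Proof.
have K2 : 2%N \in [pchar completion (place_val v)] by rewrite completion_pchar.
move=> [n tn]; split=> [ram [w [u]]|nsp].
  move=> /(artin_schreier_solvable F2)[z zE]; move: ram.
  exact: (quat_split K2 (artin_schreier_shift K2 zE)).
apply: (quat_division K2) => [r|w u].
  by apply/eqP => /(approx_square n)[r0]; apply/negP.
by apply/eqP => /approx_decomposition[w0 [u0 h]]; apply: nsp; exists w0, u0.
Qed.

End LocalSplitting.

Lemma natr_odd (R : nzRingType) (n : nat) :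
  2%N \in [pchar R] -> n%:R = (odd n)%:R :> R.
Proof.
by move=> R2; rewrite -[in LHS](odd_double_half n) natrD -mul2n natrM (pcharf0 R2) mul0r addr0.
Qed.

Lemma integral_split_identity (K : fieldType) (a A B f t Y : K) :
  A != 0 -> f = A ^+ 2 + t * B ^+ 2 ->
  a - ((A * Y) ^+ 2 + A * Y + t * (B * Y) ^+ 2) = A * (a / A - Y) - f * Y ^+ 2.
Proof. by move=> A0 ->; field. Qed.

Section PoleReduction.
Variables (F : fieldType) (v : valuation F).
Hypothesis F2 : 2%N \in [pchar F].

(** Put z = B w + A u; then B^2 (w^2 + t u^2) = z^2 + f u^2 in characteristic 2,
    and the terms on the right have valuations of different parity. A pole of
    z, or a pole of u of order at least 2, would therefore be dominant in
    B^2 (w^2 + w + t u^2), which has a pole of order at most 1. Multiplying the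
    remaining congruence by f and dividing by B^2 gives the equation for
    y = f u / B. *)
Lemma pole_reduction (t f A B a b g w u : F) :
  f != 0 -> B != 0 -> v f = 2 * 0 + 1 -> f = A ^+ 2 + t * B ^+ 2 ->
  vge v 0 A -> vge v 0 B -> vge v 0 B^-1 -> vge v 0 g -> vge v 0 b ->
  a = g / f + b -> vge v 1 (a - (w ^+ 2 + w + t * u ^+ 2)) ->
  exists2 y, vge v 0 y & vge v 1 (y ^+ 2 + A * y + g).
Proof.
move=> fF0 BF0 vf fE A0 B0 Bi0 g0 b0 aE h.
have f1 : vge v 1 f by rewrite vge_nz // vf.
have fi : vge v (-1) f^-1 by rewrite vge_nz ?invr_eq0 // valV // vf.
have a1 : vge v (-1) a.
  rewrite aE; apply: vgeD; last by apply: vge_le b0.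
  by rewrite -[-1]add0r; apply: vgeM.
pose z := B * w + A * u.
have E : vge v 1 (z ^+ 2 + f * u ^+ 2 + (B * z + A * B * u + B ^+ 2 * a)).
  have : vge v 1 (B ^+ 2 * (a - (w ^+ 2 + w + t * u ^+ 2))).
    by rewrite -[1]add0r; apply: vgeM => //; apply: (vge_sqrr (m := 0)).
  congr vge; rewrite /z fE.
  apply: (eq_mod2 F2 (z := - (B ^+ 2 * (w ^+ 2 + w + t * u ^+ 2)
    + A * B * w * u + A ^+ 2 * u ^+ 2 + A * B * u))).
  by ring.
(* Each round uses that the linear terms have smaller poles than the quadratic
   ones. It lowers the bound on the pole orders down to 1. *)
have descent M : vge v (- M%:Z - 1) z -> vge v (- M%:Z - 1) u ->
    vge v (-1) z /\ vge v (-1) u.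
  elim: M => [|M IH] hz hu; first by rewrite oppr0 add0r in hz hu.
  have : vge v (- M.+1%:Z - 1) (z ^+ 2 + f * u ^+ 2).
    rewrite -(@vge_addl _ _ _ _ (B * z + A * B * u + B ^+ 2 * a)).
      by apply: vge_le E; clear; lia.
    apply: vgeD; last first.
      apply: (@vge_le _ _ (0 + -1)); first by clear; lia.
      by apply: vgeM => //; apply: (vge_sqrr (m := 0)).
    apply: vgeD; rewrite -[_ - 1]add0r; apply: vgeM => //.
    by rewrite -[0]addr0; apply: vgeM.
  case/(vge_odd_even fF0 vf) => hz2 hu2; apply: IH; first by apply: vge_sqrl hz2; clear; lia.
  by apply: (vge_odd_sqrl fF0 vf _ hu2); clear; lia.
have [z1 u1] : vge v (-1) z /\ vge v (-1) u.
  have [M hM] := vge_neg v z; have [N hN] := vge_neg v u.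
  by apply: (descent (maxn M N)); [apply: vge_le hM|apply: vge_le hN]; clear; lia.
have z0 : vge v 0 z.
  have : vge v (-1) (z ^+ 2 + f * u ^+ 2).
    rewrite -(@vge_addl _ _ _ _ (B * z + A * B * u + B ^+ 2 * a)).
      by apply: vge_le E.
    apply: vgeD; last first.
      by rewrite -[-1]add0r; apply: vgeM => //; apply: (vge_sqrr (m := 0)).
    apply: vgeD; rewrite -[-1]add0r; apply: vgeM => //.
    by rewrite -[0]addr0; apply: vgeM.
  by case/(vge_odd_even fF0 vf) => + _; apply: vge_sqrl.
pose y := f * u / B.
have y0 : vge v 0 y.
  by rewrite -[0]addr0; apply: vgeM => //; rewrite -[0](addrN 1); apply: vgeM.
have yE : vge v 1 (y ^+ 2 + A * y + g).
  have -> : y ^+ 2 + A * y + g =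
    f * (z ^+ 2 + f * u ^+ 2 + (B * z + A * B * u + B ^+ 2 * a))
      * (B^-1 * B^-1) -
    f * (z ^+ 2 * (B^-1 * B^-1) + z * B^-1 + b).
    rewrite aE /y; field.
    by rewrite fF0 BF0.
  apply: vgeB.
    rewrite -[1]addr0; apply: vgeM; last by rewrite -[0]addr0; apply: vgeM.
    by apply: (@vge_le _ _ (1 + 1)) => //; apply: vgeM.
  rewrite -[1]addr0; apply: vgeM => //; apply: vgeD => //; apply: vgeD.
    rewrite -[0]addr0; apply: vgeM; first exact: (vge_sqrr (m := 0)).
    by rewrite -[0]addr0; apply: vgeM.
  by rewrite -[0]addr0; apply: vgeM.
by exists y.
Qed.

(** A root modulo the maximal ideal may be replaced by any approximation. *)
Lemma vge_root_approx (A g y Y : F) : vge v 0 A -> vge v 1 (y - Y) ->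
  vge v 1 (y ^+ 2 + A * y + g) -> vge v 1 (Y ^+ 2 + A * Y + g).
Proof.
move=> A0 hY yE.
have -> : Y ^+ 2 + A * Y + g =
   y ^+ 2 + A * y + g - (y - Y) * (y - Y) - A * (y - Y).
  by apply: (eq_mod2 F2 (z := Y ^+ 2 - y * Y)); ring.
apply: vgeB; last by rewrite -[1]add0r; apply: vgeM.
by apply: vgeB => //; apply: (@vge_le _ _ (1 + 1)) => //; apply: vgeM.
Qed.

End PoleReduction.

Lemma frac_diff (K : fieldType) (P J Q G H : K) : J != 0 -> Q != 0 ->
  G * Q + H = 1 -> P * J / (J * Q) - P * G = P * H / Q.
Proof. by move=> J0 Q0 /(canRL (addKr _)) ->; field; rewrite J0 Q0. Qed.

(** * The places of k(t) *)

Section LocalAnalysis.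
Variable k : fieldType.
Hypotheses (k2 : 2%N \in [pchar k]) (k_perfect : forall x : k, exists y, x = y ^+ 2).
Variable c : k.
Hypothesis c_as : forall z, c != z ^+ 2 + z.
Local Notation F := (ratfun k).
Local Notation t := ('X%:F : F).
Local Notation cF := (c%:P%:F : F).
Local Notation F2 := (ratfun_pchar2 k2).
Local Notation pv := (@place_val k).
Implicit Types (v : place k) (a : F) (p q : {poly k}).

Lemma ford_poly v p : p != 0 -> ford v p%:F = pord v p.
Proof.
move=> p0; rewrite -[p%:F]divr1 -tofrac1 ford_frac ?oner_neq0 //.
have := pordM v (oner_neq0 _) (oner_neq0 {poly k}).
by rewrite mulr1 -{1}[pord v 1]addr0 => /addrI <-; rewrite subr0.
Qed.

Lemma vge_poly_finite f (fP : is_prime_poly f) (n : nat) p :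
  vge (pv (Some (exist _ f fP))) n p%:F = (f ^+ n %| p).
Proof.
have [->|p0] := eqVneq p 0; first by rewrite tofrac0 vge0 dvdp0.
by rewrite vge_nz ?tofrac_eq0 //= ford_poly // pord_ge.
Qed.

Lemma vge_poly_finite0 f (fP : is_prime_poly f) p :
  vge (pv (Some (exist _ f fP))) 0 p%:F.
Proof. by rewrite vge_poly_finite expr0 dvd1p. Qed.

Lemma vge_poly_finite1 f (fP : is_prime_poly f) p :
  vge (pv (Some (exist _ f fP))) 1 p%:F = (f %| p).
Proof. by rewrite (vge_poly_finite fP 1) expr1. Qed.

Lemma vge_invr_unit f (fP : is_prime_poly f) p :
  ~~ (f %| p) -> vge (pv (Some (exist _ f fP))) 0 (p%:F)^-1.
Proof.
move=> np; have p0 : p != 0 by apply: contraNneq np => ->.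
have pF0 : p%:F != 0 by rewrite tofrac_eq0.
rewrite vge_nz ?invr_eq0 // valV // oppr_ge0 leNgt; apply/negP => h.
by move: np; rewrite -(vge_poly_finite1 fP) vge_nz // -gtz0_ge1 h.
Qed.

(** The residue field at f is k[t] / f: a denominator prime to f can be inverted
    modulo f. *)
Lemma finite_residue f (fP : is_prime_poly f) (x : F) :
  vge (pv (Some (exist _ f fP))) 0 x ->
  exists Y : {poly k}, vge (pv (Some (exist _ f fP))) 1 (x - Y%:F).
Proof.
have [->|x0] := eqVneq x 0; first by exists 0; rewrite tofrac0 subrr vge0.
have [p [q [p0 q0 ->]]] := ford_factor x0.
have [i [p' [pE np]]] := prime_poly_factor fP p0.
have [j [q' [qE nq]]] := prime_poly_factor fP q0.
have p'0 : p' != 0 by apply: contraNneq np => ->.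
have q'0 : q' != 0 by apply: contraNneq nq => ->.
have fF0 : f%:F != 0 by rewrite tofrac_eq0 monic_neq0 //; case/andP: fP.
rewrite vge_nz ?mulf_neq0 ?invr_eq0 ?tofrac_eq0 //= ford_frac // pE qE.
rewrite !pord_factor // subr_ge0 lez_nat => ji.
have /Bezout_eq1_coprimepP[[g h] /= gh] : coprimep q' f.
  by rewrite coprimep_sym -[f]expr1 prime_poly_coprime.
exists (f ^+ (i - j) * p' * g).
have -> : (f ^+ i * p')%:F / (f ^+ j * q')%:F - (f ^+ (i - j) * p' * g)%:F =
   (f ^+ (i - j) * p')%:F * (h * f)%:F / q'%:F.
  rewrite -(@frac_diff F _ (f ^+ j)%:F _ g%:F).
  - rewrite -!tofracM; congr (_%:F / _ - _).
    by rewrite -{1}(subnK ji) exprD; ring.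
  - by rewrite tofrac_eq0 expf_neq0 // -tofrac_eq0.
  - by rewrite tofrac_eq0.
  - by rewrite -tofracM -tofracD gh tofrac1.
rewrite -[1]addr0; apply: vgeM; last exact: vge_invr_unit.
rewrite -tofracM vge_poly_finite1 mulrA dvdp_mull //.
Qed.

(** In characteristic 2 one has B^2 (t - r^2) = (A + B r)^2 + p, and a square cannot
    cancel an element of odd valuation. *)
Lemma nonsquare_of_odd v (A B p : F) m : p != 0 -> pv v p = 2 * m + 1 ->
  vge (pv v) 0 B -> p = A ^+ 2 + t * B ^+ 2 ->
  exists n, forall r, ~~ vge (pv v) n (t - r ^+ 2).
Proof.
move=> p0 vp B0 pE; exists (pv v p + 1) => r; apply/negP => h.
have : vge (pv v) (pv v p + 1) ((A + B * r) ^+ 2 + p * 1 ^+ 2).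
  have -> : (A + B * r) ^+ 2 + p * 1 ^+ 2 = B * B * (t - r ^+ 2).
    rewrite pE; apply: (eq_mod2 F2 (z := A * B * r + A ^+ 2 + B ^+ 2 * r ^+ 2)).
    by ring.
  by rewrite -[X in vge _ X]add0r; apply: vgeM h; rewrite -[0]addr0; apply: vgeM.
case/(vge_odd_even p0 vp) => _; by rewrite expr1n mulr1 vge_nz // lezD1 ltxx.
Qed.

Lemma split_of_vge1 v a : vge (pv v) 1 a -> locally_split v a.
Proof. by move=> h; exists 0, 0; rewrite expr0n /= mulr0 !addr0 subr0. Qed.

(** The residue field at [v] is the field of constants. *)
Definition rational_place v := [/\ forall l : k, vge (pv v) 0 (l%:P%:F : F),
  forall l : k, vge (pv v) 1 (l%:P%:F : F) -> l = 0 &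
  forall x : F, vge (pv v) 0 x -> exists l : k, vge (pv v) 1 (x - l%:P%:F)].

(** As the valuation of t is odd, poles of w^2 and t u^2 cannot cancel, and poles
    of w^2 dominate those of w. So w is integral, t u^2 has positive
    valuation, and c = l^2 + l for the residue l of w. *)
Lemma not_split_const v a m : pv v t = 2 * m + 1 -> rational_place v ->
  vge (pv v) 1 (a - cF) -> ~ locally_split v a.
Proof.
have t0 : t != 0 by rewrite tofrac_eq0 monic_neq0 ?monicX.
move=> vt rat ac [w [u]] h.
have c0 : vge (pv v) 0 cF by case: rat.
have h1 : vge (pv v) 1 (w ^+ 2 + t * u ^+ 2 + (w + cF)).
  have := vgeB ac h; rewrite -vgeN; congr vge.
  by apply: (eq_mod2 F2 (z := - (w ^+ 2 + w + t * u ^+ 2))); ring.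
have w0 : vge (pv v) 0 w.
  have [M] := vge_neg (pv v) w; elim: M => // M IH hw; apply: IH.
  have : vge (pv v) (- M.+1%:Z) (w ^+ 2 + t * u ^+ 2).
    rewrite -(@vge_addl _ _ _ _ (w + cF)) ?(vge_le _ h1) //.
    apply: vgeD; first exact: hw.
    by apply: vge_le c0.
  by case/(vge_odd_even t0 vt) => + _; apply: vge_sqrl; lia.
have tu : vge (pv v) 1 (t * u ^+ 2).
  have : vge (pv v) 0 (w ^+ 2 + t * u ^+ 2).
    rewrite -(@vge_addl _ _ _ _ (w + cF)) ?(vge_le _ h1) //.
    exact: vgeD.
  case/(vge_odd_even t0 vt) => _ tu0.
  have hu : vge (pv v) (- m) u by apply: (vge_odd_sqrl t0 vt _ tu0); lia.
  by apply: (vge_odd_sqrr t0 vt _ hu); lia.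
have [_ inj res] := rat; have [l wl] := res w w0; clear rat res.
case/eqP: (c_as l); apply/eqP; rewrite -subr_eq0; apply/eqP/inj; clear inj.
have -> : (c - (l ^+ 2 + l))%:P%:F = w ^+ 2 + t * u ^+ 2 + (w + cF) - t * u ^+ 2
   - (w - l%:P%:F) * (w - l%:P%:F) - (w - l%:P%:F) :> F.
  rewrite !rmorphB !rmorphD rmorphXn /= tofracXn.
  apply: (eq_mod2 F2 (z := - (w * l%:P%:F) - l%:P%:F)).
  ring.
apply: vgeB => //; apply: vgeB; last by apply: vge_le (vgeM wl wl).
exact: vgeB.
Qed.

Lemma finite_uniformizer f (fP : is_prime_poly f) :
  pv (Some (exist _ f fP)) f%:F = 2 * 0 + 1.
Proof.
have f_mon : f \is monic by case/andP: fP.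
have nf1 : ~~ (f %| 1).
  by rewrite dvdp1; case/andP: fP => _ /asboolP[+ _]; case: size => [|[|]].
rewrite /= ford_poly ?monic_neq0 //.
by have := pord_factor fP 1 (oner_neq0 _) nf1; rewrite mulr1 expr1 => ->.
Qed.

Lemma not_split_pole f (fP : is_prime_poly f) a b : f != 'X ->
  let v := Some (exist _ f fP) in
  a = cF * (t ^+ (size f).-1 / f%:F) + b -> vge (pv v) 0 b -> ~ locally_split v a.
Proof.
move=> fX v aE b0 [w [u]] h.
have [A [B fE]] := square_decomposition k2 k_perfect f.
have nB := prime_ndvd_odd_part fP fE.
have fF0 : f%:F != 0 by rewrite tofrac_eq0 monic_neq0 //; case/andP: (fP).
have fFE : f%:F = A%:F ^+ 2 + t * B%:F ^+ 2 by rewrite -!tofracXn -tofracM -tofracD -fE.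
have BF0 : B%:F != 0 by rewrite tofrac_eq0; apply: contraNneq nB => ->.
have gE : cF * t ^+ (size f).-1 = (c%:P * 'X^((size f).-1))%:F by rewrite tofracM tofracXn.
rewrite mulrA gE in aE.
have [y y0 yE] := pole_reduction F2 fF0 BF0 (finite_uniformizer fP) fFE
  (vge_poly_finite0 fP A) (vge_poly_finite0 fP B) (vge_invr_unit fP nB)
  (vge_poly_finite0 fP _) b0 aE h.
have [Y hY] := finite_residue y0.
have := residue_obstruction k2 fP fE c_as Y fX; case/negP.
rewrite -(vge_poly_finite1 fP) !tofracD tofracXn (tofracM A Y).
exact: (vge_root_approx F2 (vge_poly_finite0 fP A) hY yE).
Qed.

(** With w = A Y and u = B Y one has w^2 + t u^2 = f Y^2. So it is enough to solve
    a = A Y modulo f. *)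
Lemma split_of_integral f (fP : is_prime_poly f) a : f != 'X ->
  let v := Some (exist _ f fP) in vge (pv v) 0 a -> locally_split v a.
Proof.
move=> fX v a0.
have [A [B fE]] := square_decomposition k2 k_perfect f.
have nA := prime_ndvd_even_part fP fE fX.
have AF0 : A%:F != 0 by rewrite tofrac_eq0; apply: contraNneq nA => ->.
have A0 := vge_poly_finite0 fP A.
have [Y hY] : exists Y : {poly k}, vge (pv v) 1 (a / A%:F - Y%:F).
  apply: finite_residue; rewrite -[0]addr0; apply: vgeM => //.
  exact: vge_invr_unit.
exists (A%:F * Y%:F), (B%:F * Y%:F).
have fFE : f%:F = A%:F ^+ 2 + t * B%:F ^+ 2 by rewrite -!tofracXn -tofracM -tofracD -fE.
rewrite (integral_split_identity _ _ AF0 fFE).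
apply: vgeB; first by rewrite -[1]add0r; apply: vgeM.
by rewrite -tofracXn -tofracM vge_poly_finite1 dvdp_mulr.
Qed.

Lemma const_vge0 v (l : k) : vge (pv v) 0 (l%:P%:F : F).
Proof.
case: v => [[f fP]|]; first exact: vge_poly_finite0.
have [->|l0] := eqVneq l 0; first by rewrite polyC0 tofrac0 vge0.
by rewrite vge_nz ?tofrac_eq0 ?polyC_eq0 //= ford_poly ?polyC_eq0 //= size_polyC l0.
Qed.

Lemma vge_infty1 p : vge (pv None) 1 (p%:F : F) -> p = 0.
Proof.
apply: contraTeq => p0; rewrite vge_nz ?tofrac_eq0 //= ford_poly //=.
by rewrite -ltNge (@le_lt_trans _ _ 0) // oppr_le0.
Qed.

Lemma infty_residue (x : F) : vge (pv None) 0 x ->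
  exists l : k, vge (pv None) 1 (x - l%:P%:F).
Proof.
have [->|x0] := eqVneq x 0; first by exists 0; rewrite polyC0 tofrac0 subrr vge0.
have [p [q [p0 q0 ->]]] := ford_factor x0.
have qF0 : q%:F != 0 by rewrite tofrac_eq0.
rewrite vge_nz ?mulf_neq0 ?invr_eq0 ?tofrac_eq0 //= ford_frac //= => pq.
have {}pq : (size p <= size q)%N.
  move: pq p0 q0; rewrite opprK addrC subr_ge0 lez_nat -!size_poly_gt0.
  by case: (size p) (size q) => [|m] [|n].
exists (p`_(size q).-1 / lead_coef q); set l : k := _ / lead_coef q.
have -> : p%:F / q%:F - l%:P%:F = (p - l *: q)%:F / q%:F.
  by rewrite -mul_polyC tofracB tofracM mulrBl mulfK.
have [->|r0] := eqVneq (p - l *: q) 0; first by rewrite tofrac0 mul0r vge0.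
rewrite vge_nz ?mulf_neq0 ?invr_eq0 ?tofrac_eq0 //= ford_frac //=.
have : (size (p - l *: q)%R <= (size q).-1)%N.
  apply/leq_sizeP => j; rewrite leq_eqVlt => /orP[/eqP<-|qj].
    by rewrite coefB coefZ -lead_coefE divfK ?lead_coef_eq0 // subrr.
  rewrite prednK ?size_poly_gt0 // in qj.
  by rewrite coefB coefZ !nth_default ?mulr0 ?subrr // (leq_trans pq).
move: r0 q0; rewrite -!size_poly_gt0.
by case: (size _) (size _) => [|m] [|n] //=; lia.
Qed.

Lemma vge_X1 v fP p : v = Some (exist _ ('X : {poly k}) fP) ->
  vge (pv v) 1 p%:F = (p.[0] == 0).
Proof. by move=> ->; rewrite vge_poly_finite1 -['X]subr0 -polyC0 dvdp_XsubCl. Qed.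

Lemma X_residue fP (x : F) : let v := Some (exist _ ('X : {poly k}) fP) in
  vge (pv v) 0 x -> exists l : k, vge (pv v) 1 (x - l%:P%:F).
Proof.
move=> v /finite_residue[Y hY]; exists Y.[0].
rewrite -(subrKA Y%:F); apply: vgeD => //.
by rewrite -tofracB (vge_X1 _ (fP := fP)) // !hornerE subrr.
Qed.

(** The differential [place_term v] dt / t = t^(d-1) dt / f has a residue of trace 1
    over k at f, and also at infinity. *)
Definition place_term v : F :=
  if v is Some f then t ^+ (size (sval f)).-1 / (sval f)%:F else 0.

Lemma prime_dvd_prime (f g : {poly k}) : is_prime_poly f -> is_prime_poly g -> f %| g -> f = g.
Proof.
move=> /andP[fm /asboolP[f1 _]] /andP[gm /asboolP[_ gi]] fg.
have : size f != 1.
  by move: f1; case: size => [|[|]].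
by move=> /gi/(_ fg); rewrite eqp_monic // => /eqP.
Qed.

Lemma place_eq (f g : {poly k}) fP gP :
  (Some (exist _ f fP) == Some (exist _ g gP) :> place k) = (f == g).
Proof. by []. Qed.

Lemma place_term_integral v w : v != w -> v != None -> vge (pv v) 0 (place_term w).
Proof.
case: v => // -[f fP]; case: w => [[g gP]|] /=; last by rewrite vge0.
rewrite place_eq => fg _; rewrite -tofracXn -[0]addr0.
apply: vgeM; first exact: vge_poly_finite0.
apply: vge_invr_unit; apply: contra fg => /prime_dvd_prime -> //.
Qed.

Lemma place_term_X v fP w : v = Some (exist _ ('X : {poly k}) fP) ->
  vge (pv v) 1 (place_term w - (v == w)%:R).
Proof.
move=> ->; case: w => [[g gP]|]; last by rewrite subr0 vge0.
rewrite place_eq /=; have [<-|gX] := eqVneq 'X g.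
  by rewrite size_polyX expr1 divff ?subrr ?vge0 // tofrac_eq0 monic_neq0 ?monicX.
rewrite subr0 -tofracXn -[1]addr0; apply: vgeM.
  rewrite (vge_X1 _ (fP := fP)) // hornerXn expr0n.
  have [gm [g1 _]] : g \is monic /\ irreducible_poly g.
    by case/andP: gP => ? /asboolP.
  by move: g1; case: size => [|[|]].
apply: vge_invr_unit; apply: contra gX => /prime_dvd_prime -> //.
Qed.

Lemma place_term_infty w : vge (pv None) 1 (place_term w - (w != None)%:R).
Proof.
case: w => [[g gP]|] /=; last by rewrite subr0 vge0.
have [gm [g1 _]] : g \is monic /\ irreducible_poly g.
  by case/andP: gP => ? /asboolP.
have g0 := monic_neq0 gm; have gF0 : g%:F != 0 by rewrite tofrac_eq0.
have -> : t ^+ (size g).-1 / g%:F - 1 = ('X^((size g).-1) - g)%:F / g%:F.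
  by rewrite tofracB mulrBl tofracXn divff.
have [->|r0] := eqVneq ('X^((size g).-1) - g) 0; first by rewrite tofrac0 mul0r vge0.
rewrite vge_nz ?mulf_neq0 ?invr_eq0 ?tofrac_eq0 //= ford_frac //=.
have : (size ('X^((size g).-1) - g)%R <= (size g).-1)%N.
  apply/leq_sizeP => j; rewrite leq_eqVlt => /orP[/eqP<-|qj].
    by rewrite coefB coefXn eqxx -lead_coefE (monicP gm) subrr.
  rewrite coefB coefXn gtn_eqF // nth_default ?subrr //.
  by move: qj; rewrite prednK // size_poly_gt0.
move: r0 g0; rewrite -!size_poly_gt0.
by case: (size _) (size _) => [|m] [|n] //=; lia.
Qed.

(** At a finite place other than t only the term of the place itself has a pole.
    At t and at infinity all terms are congruent to 0 or 1, and their sum is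
    congruent to the number of occurrences of t, resp. to the number of finite
    places; as the total number of places is even, both agree modulo 2 with the
    number of occurrences of v. *)
Theorem ramified_place_sum (vs : seq (place k)) v : uniq vs -> ~~ odd (size vs) ->
  ramified (cF * \sum_(w <- vs) place_term w) t v <-> v \in vs.
Proof.
move=> uvs evs; set a := cF * _.
have sum_count (P : pred (place k)) : \sum_(w <- vs) (P w)%:R = (count P vs)%:R :> F.
  by rewrite -sum1_count [in RHS]big_mkcond natr_sum; apply: eq_bigr => w _; case: (P w).
apply: (iff_trans (B := ~ locally_split v a)).
  apply: (ramified_split k2).
  case: v => [[f fP]|].
    have [A [B fE]] := square_decomposition k2 k_perfect f.
    have f_mon : f \is monic by case/andP: fP.
    apply: (@nonsquare_of_odd _ A%:F B%:F f%:F 0).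
    - by rewrite tofrac_eq0 monic_neq0.
    - exact: finite_uniformizer.
    - exact: vge_poly_finite0.
    - by rewrite -!tofracXn -tofracM -tofracD -fE.
  apply: (@nonsquare_of_odd _ 0 1 t (-1)).
  - by rewrite tofrac_eq0 monic_neq0 ?monicX.
  - by rewrite /= ford_poly ?monic_neq0 ?monicX //= size_polyX.
  - by rewrite -tofrac1; apply: (const_vge0 None 1).
  - by rewrite expr0n expr1n add0r mulr1.
have odd_place m : pv v t = 2 * m + 1 ->
  (forall l : k, vge (pv v) 1 (l%:P%:F : F) -> l = 0) ->
  (forall x, vge (pv v) 0 x -> exists l : k, vge (pv v) 1 (x - l%:P%:F)) ->
  vge (pv v) 1 (\sum_(w <- vs) place_term w - (v \in vs)%:R) ->
  ~ locally_split v a <-> v \in vs.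
  move=> vt inj res h.
  have {}h : vge (pv v) 1 (a - cF * (v \in vs)%:R).
    by rewrite -mulrBr -[1]add0r; apply: vgeM h; apply: const_vge0.
  case: (boolP (v \in vs)) h => vvs; last first.
    by rewrite mulr0 subr0 => h; split=> // nsp; case: nsp; apply: split_of_vge1.
  rewrite mulr1 => h; split=> // _.
  by apply: (not_split_const vt) h; split; [exact: const_vge0|exact: inj|exact: res].
case: v @a odd_place => [[f fP]|] a odd_place.
  have [fX|fX] := eqVneq f 'X.
    move: fP @a odd_place; rewrite fX => fP a odd_place.
    apply: (odd_place 0); [exact: finite_uniformizer| |exact: X_residue|].
      by move=> l; rewrite (vge_X1 _ (fP := fP)) // hornerC => /eqP.
    rewrite -count_uniq_mem // -sum_count -sumrB.
    apply: vge_sum => w _; have := place_term_X w (erefl (Some (exist _ 'X fP))).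
    by rewrite eq_sym.
  have sum_int (P : pred (place k)) : (forall w, w \in vs -> P w -> Some (exist _ f fP) != w) ->
      vge (pv (Some (exist _ f fP))) 0 (\sum_(w <- vs | P w) place_term w).
    move=> h; rewrite big_seq_cond; apply: vge_sum => w /andP[wvs Pw].
    by apply: place_term_integral => //; apply: h.
  split=> [|vvs].
    apply: contra_notT => vvs; apply: split_of_integral => //.
    rewrite /a -[0]addr0; apply: vgeM; first exact: const_vge0.
    by apply: sum_int => w wvs _; apply: contraNneq vvs => ->.
  apply: (@not_split_pole _ _ _ (cF * \sum_(w <- vs | w != Some (exist _ f fP)) place_term w)) => //.
    by rewrite /a (bigD1_seq _ vvs uvs) /= mulrDr.
  rewrite -[0]addr0; apply: vgeM; first exact: const_vge0.
  by apply: sum_int => w _; rewrite eq_sym.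
apply: (odd_place (-1)).
- by rewrite /= ford_poly ?monic_neq0 ?monicX //= size_polyX.
- by move=> l /vge_infty1/eqP; rewrite polyC_eq0 => /eqP.
- exact: infty_residue.
have -> : (None \in vs)%:R = \sum_(w <- vs) (w != None)%:R :> F.
  rewrite (sum_count (predC1 None)).
  rewrite -count_uniq_mem // (natr_odd _ F2) [RHS](natr_odd _ F2).
  have := congr1 odd (count_predC (pred1 None) vs).
  by rewrite oddD (negPf evs); case: odd; case: odd.
rewrite -sumrB; apply: vge_sum => w _; exact: place_term_infty.
Qed.
End LocalAnalysis.

(** * A constant of trace one *)

Lemma artin_schreier_scale (K : fieldType) (a b x r z : K) :
  2%N \in [pchar K] -> b ^+ 2 != 0 -> a ^+ 2 = x * b ^+ 2 ->
  z ^+ 2 + z = r / b ^+ 2 -> (a * z) ^+ 2 + a * (a * z) + x * r = 0.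
Proof.
move=> K2 b0 ab zE; apply: (eq_mod2 K2 (z := x * r)).
have -> : (a * z) ^+ 2 + a * (a * z) = a ^+ 2 * (z ^+ 2 + z) by ring.
by rewrite ab zE -mulrA [b ^+ 2 * _]mulrC divfK //; ring.
Qed.

Section FieldConstant.
Variable h : {poly 'F_2}.
Hypothesis hI : monic_irreducible_poly h.
Local Notation k := {poly %/ h with hI}.

Definition in_field (p : {poly 'F_2}) : k := in_qpoly h p.

Lemma in_field_zmod : zmod_morphism in_field.
Proof. by move=> p q; rewrite /in_field rmorphB. Qed.
Lemma in_field_monoid : monoid_morphism in_field.
Proof. by split=> [|p q]; rewrite /in_field ?rmorph1 ?rmorphM. Qed.
HB.instance Definition _ := GRing.isZmodMorphism.Build _ _ in_field in_field_zmod.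
HB.instance Definition _ := GRing.isMonoidMorphism.Build _ _ in_field in_field_monoid.

Lemma in_fieldD p q : in_field (p + q) = in_field p + in_field q.
Proof. exact: rmorphD. Qed.
Lemma in_fieldM p q : in_field (p * q) = in_field p * in_field q.
Proof. exact: rmorphM. Qed.
Lemma in_fieldXn p n : in_field (p ^+ n) = in_field p ^+ n.
Proof. exact: rmorphXn. Qed.
Lemma in_field1 : in_field 1 = 1. Proof. exact: rmorph1. Qed.

Lemma in_field_eq0 p : (in_field p == 0) = (h %| p).
Proof.
have hE : mk_monic h = h := mk_monicE hI.
rewrite /in_field -val_eqE /= hE.
by rewrite -Pdiv.IdomainMonic.modpE ?hI.
Qed.

Lemma in_fieldK (c : k) : in_field (c : {poly 'F_2}) = c.
Proof. by apply/val_inj; exact: in_qpoly_small (size_mk_monic c). Qed.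

Lemma size_in_field p : (size (in_field p : {poly 'F_2}) < size h)%N.
Proof. have <- : size (mk_monic h) = size h by rewrite mk_monicE.
exact: size_mk_monic. Qed.

Lemma field_pchar2 : 2%N \in [pchar k]. Proof. exact: qfpoly_pchar2. Qed.

Lemma field_perfect (x : k) : exists y, x = y ^+ 2.
Proof.
have sq_inj : injective (fun y : k => y ^+ 2).
  move=> y z e; apply/eqP; rewrite -subr_eq0 -sqrf_eq0; apply/eqP.
  by apply: (eq_mod2 field_pchar2 (z := z ^+ 2 - y * z)); rewrite -[RHS]addr0 -(subrr (z ^+ 2)) -{1}e; ring.
by have [g _ gK] := injF_bij sq_inj; exists (g x); rewrite gK.
Qed.

Lemma F2_pchar2 : 2%N \in [pchar 'F_2]. Proof. by apply: pchar_Fp. Qed.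

Lemma F2_cases (x : 'F_2) : x = 0 \/ x = 1.
Proof. by case: x => -[|[|//]] i; [left|right]; apply: val_inj. Qed.

Lemma F2_perfect (x : 'F_2) : exists y, x = y ^+ 2.
Proof. by exists x; case: (F2_cases x) => ->; apply: val_inj. Qed.

Lemma F2_artin_schreier (z : 'F_2) : 1 != z ^+ 2 + z.
Proof. by case: (F2_cases z) => ->. Qed.

Lemma modulus_prime : is_prime_poly h.
Proof. by rewrite /is_prime_poly !hI /=; apply/asboolP; case: hI. Qed.

(** The trace of this element to F_2 is 1, by Euler's formula. *)
Definition trace_one : k := in_field 'X^((size h).-2) / in_field h^`().

Lemma deriv_square_decomposition (A B : {poly 'F_2}) :
  (A ^+ 2 + 'X * B ^+ 2)^`() = B ^+ 2.
Proof.
rewrite !expr2 derivD !derivM derivX.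
apply: (eq_mod2 (poly_pchar2 F2_pchar2) (z := A^`() * A + 'X * (B^`() * B))).
by ring.
Qed.

Lemma in_field_deriv_neq0 : in_field h^`() != 0.
Proof.
have [A [B hE]] := square_decomposition F2_pchar2 F2_perfect h.
have nB := prime_ndvd_odd_part modulus_prime hE.
rewrite in_field_eq0 hE deriv_square_decomposition -hE.
by apply: contra nB => /(prime_poly_dvdX modulus_prime).
Qed.

(** This is [residue_obstruction] over F_2, with c = 1 and f = h. *)
Lemma trace_one_not_artin_schreier (z : k) : trace_one != z ^+ 2 + z.
Proof.
apply/eqP => e; pose Z : {poly 'F_2} := z; have zE : in_field Z = z := in_fieldK z.
have [hX|hX] := eqVneq h 'X.
  have : in_field (Z ^+ 2 + Z + 1) == 0.
    rewrite !in_fieldD in_fieldXn in_field1 zE -e /trace_one.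
    have -> : h^`() = 1 by rewrite hX derivX.
    have -> : size h = 2%N by rewrite hX size_polyX.
    rewrite expr0 in_field1 divff ?oner_neq0 //.
    by rewrite two_eq0 // field_pchar2.
  rewrite in_field_eq0 {1}hX -['X]subr0 -polyC0 dvdp_XsubCl /root !hornerE.
  case: (F2_cases Z.[0]) => ->; by rewrite ?expr0n.
have [A [B hE]] := square_decomposition F2_pchar2 F2_perfect h.
have := residue_obstruction F2_pchar2 modulus_prime hE F2_artin_schreier (A * Z) hX.
have hB : h^`() = B ^+ 2 by rewrite -(deriv_square_decomposition A) -hE.
have x0 : in_field B ^+ 2 != 0 by rewrite -in_fieldXn -hB in_field_deriv_neq0.
have AB : in_field A ^+ 2 = in_field 'X * in_field B ^+ 2.
  apply: (eq_mod2 field_pchar2 (z := - in_field 'X * in_field B ^+ 2)).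
  have e0 : in_field A ^+ 2 + in_field 'X * in_field B ^+ 2 = 0.
    by rewrite -!in_fieldXn -in_fieldM -in_fieldD -hE; apply/eqP; rewrite in_field_eq0.
  by rewrite -[LHS]subr0 -[X in _ - X]e0; ring.
case/negP; rewrite -in_field_eq0 polyC1 mul1r !in_fieldD !in_fieldXn !in_fieldM zE.
have -> : (size h).-1 = (size h).-2.+1.
  by case: (modulus_prime) => /andP[_ /asboolP[]]; case: (size h) => [|[]].
rewrite (exprS (in_field 'X)); apply/eqP; apply: (artin_schreier_scale field_pchar2 x0 AB).
by rewrite -e /trace_one hB !in_fieldXn.
Qed.
End FieldConstant.

(** * Bit lists as polynomials *)

Section Bits.

Fixpoint bits_poly (s : seq bool) : {poly 'F_2} :=
  if s is b :: s then bits_poly s * 'X + (b%:R)%:P else 0.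

Definition bits (p : {poly 'F_2}) : seq bool := [seq c != 0 | c <- p].

Lemma F2_nat (c : 'F_2) : (c != 0)%:R = c.
Proof. by case: (F2_cases c) => ->; rewrite ?eqxx ?oner_neq0. Qed.

Lemma bits_polyE s : bits_poly s = Poly [seq (nat_of_bool b)%:R | b <- s].
Proof. by elim: s => //= b s ->; rewrite cons_poly_def. Qed.

Lemma bitsK p : bits_poly (bits p) = p.
Proof.
rewrite bits_polyE /bits -map_comp (eq_map (g := id)) ?map_id ?polyseqK //.
by move=> c /=; rewrite F2_nat.
Qed.

Lemma size_bits p : size (bits p) = size p. Proof. exact: size_map. Qed.

Lemma bits_poly_cat s r : bits_poly (s ++ r) = bits_poly s + 'X^(size s) * bits_poly r.
Proof.
elim: s => [|b s IH] /=; first by rewrite add0r expr0 mul1r.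
by rewrite IH exprS; ring.
Qed.

Lemma bits_poly_nseq n : bits_poly (nseq n false) = 0.
Proof. by elim: n => //= n ->; rewrite mul0r add0r. Qed.

Lemma bits_poly_shift n s : bits_poly (nseq n false ++ s) = 'X^n * bits_poly s.
Proof. by rewrite bits_poly_cat bits_poly_nseq add0r size_nseq. Qed.

Lemma bits_poly_xorl a b : bits_poly (xorl a b) = bits_poly a + bits_poly b.
Proof.
elim: a b => [|x a IH] [|y b] /=; rewrite ?add0r ?addr0 // IH.
have -> : (x (+) y)%:R = x%:R + y%:R :> 'F_2.
  by case: x; case: y; rewrite ?addr0 ?add0r //; apply: val_inj.
by rewrite polyCD; ring.
Qed.

Lemma size_bits_poly s : (size (bits_poly s) <= size s)%N.
Proof. by rewrite bits_polyE (leq_trans (size_Poly _)) ?size_map. Qed.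

Lemma bits_poly_horner_step p acc b : bits_poly (horner_step p acc b) = bits_poly acc * 'X + (b%:R)%:P * bits_poly p.
Proof.
rewrite /horner_step; case: b; rewrite ?bits_poly_xorl /= polyC0 addr0 ?polyC1 ?mul1r //.
by rewrite mul0r addr0.
Qed.

Lemma bits_poly_horner_mul f p : bits_poly (horner_mul (rev f) p) = bits_poly f * bits_poly p.
Proof.
rewrite /horner_mul; elim: f => [|b f IH] /=; first by rewrite mul0r.
by rewrite rev_cons foldl_rcons bits_poly_horner_step IH; ring.
Qed.

Lemma bits_poly_padto n c : bits_poly (padto n c) = bits_poly c.
Proof. by rewrite /padto bits_poly_cat bits_poly_nseq mulr0 addr0. Qed.

Lemma strip_rcons a b : strip (rcons a b) =
  if strip a is [::] then (if b then [:: b] else [::]) else rcons (strip a) b.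
Proof. by elim: a => [|[] a IH] //=; case: b {IH}. Qed.

Lemma trim_cons b s : trim (b :: s) =
  if trim s is [::] then (if b then [:: b] else [::]) else b :: trim s.
Proof.
rewrite /trim rev_cons strip_rcons; case E: (strip (rev s)) => [|x r]; first by case: b.
case F: (rev (x :: r)) => [|y r'].
  by have := congr1 size F; rewrite size_rev.
by rewrite rev_rcons F.
Qed.

Lemma bits_bits_poly s : bits (bits_poly s) = trim s.
Proof.
elim: s => [|b s IH]; first by rewrite /bits polyseq0.
rewrite trim_cons -IH /= -cons_poly_def /bits polyseq_cons.
have be : (b%:R != 0 :> 'F_2) = b by case: b.
case: nilP => [/= e|/eqP ne]; rewrite /nilp.
  by rewrite e /= polyseqC be; case: b be => //= ->.
by case E: (bits_poly s : seq _) ne => [|c r] //= _; rewrite be.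
Qed.

End Bits.

Lemma coef_bits_poly s i : (bits_poly s)`_i = (nth false s i : nat)%:R.
Proof.
elim: s i => [|b s IH] [|i] /=; rewrite ?coef0 ?nth_nil //.
  by rewrite coefD coefMX coefC add0r.
by rewrite coefD coefMX coefC addr0 IH.
Qed.

Lemma size_bits_poly_cons b s : (size (bits_poly (b :: s)) <= (size (bits_poly s)).+1)%N.
Proof. by rewrite /= -cons_poly_def size_cons_poly; case: ifP. Qed.

Lemma size_bits_poly_behead b s n : (size (bits_poly (b :: s)) <= n.+1)%N -> (size (bits_poly s) <= n)%N.
Proof.
rewrite /= -cons_poly_def size_cons_poly; case: ifP => // /andP[/nilP -> _] //.
Qed.

Lemma bits_poly_pad_take n a : (size (bits_poly a) <= n)%N -> bits_poly (pad_take n a) = bits_poly a.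
Proof.
elim: n a => [|n IH] [|b a] an //=.
- by move: an; rewrite leqn0 size_poly_eq0 => /eqP.
- by rewrite IH ?size_poly0 // mul0r add0r.
by rewrite IH ?(size_bits_poly_behead an).
Qed.

Section Reduction.
Variables (h : {poly 'F_2}) (hI : monic_irreducible_poly h).
Local Notation k := {poly %/ h with hI}.
Local Notation inF := (in_field hI).
Local Notation hb := (bits h).

Lemma modulus_size_gt1 : (1 < size h)%N. Proof. by case: (hI.1). Qed.

Lemma in_field_small (p : {poly 'F_2}) : (size p < size h)%N -> inF p = p :> {poly 'F_2}.
Proof.
move=> ph; rewrite -[RHS](@in_qpoly_small _ h) //.
by rewrite mk_monicE.
Qed.

Lemma mod_step_spec acc b : (size (bits_poly acc) < size h)%N ->
  inF (bits_poly (mod_step hb acc b)) = inF (bits_poly (b :: acc)) /\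
  (size (bits_poly (mod_step hb acc b)) < size h)%N.
Proof.
move=> ah; have h0 : (0 < size h)%N := ltnW modulus_size_gt1.
rewrite /mod_step; set a := pad_take _ _.
have aE : bits_poly a = bits_poly (b :: acc).
  by apply: bits_poly_pad_take; rewrite size_bits (leq_trans (size_bits_poly_cons _ _)).
have sa : size a = size h by rewrite size_pad_take size_bits.
have small (p : {poly 'F_2}) : (size p <= size h)%N -> p`_(size h).-1 = 0 -> (size p < size h)%N.
  move=> ph p0; rewrite -[X in (_ < X)%N](prednK h0) ltnS; apply/leq_sizeP => j.
  rewrite leq_eqVlt => /orP[/eqP<- //|]; rewrite prednK // => hj.
  by rewrite nth_default // (leq_trans ph).
have lastE : (bits_poly a)`_(size h).-1 = (last false a : nat)%:R by rewrite coef_bits_poly -sa nth_last.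
have sba : (size (bits_poly a) <= size h)%N by rewrite -sa size_bits_poly.
case: ifP => la; last by rewrite aE; split=> //; rewrite -aE; apply: small; rewrite // lastE la.
rewrite bits_poly_xorl bitsK aE in_fieldD; split.
  by have /eqP-> : inF h == 0 by [rewrite in_field_eq0]; rewrite addr0.
rewrite -aE; apply: small.
  by rewrite (leq_trans (size_polyD _ _)) // geq_max sba /=.
rewrite coefD lastE la -lead_coefE (monicP hI.2).
by apply: val_inj.
Qed.

Lemma reduce_spec s :
  inF (bits_poly (reduce hb s)) = inF (bits_poly s) /\ (size (bits_poly (reduce hb s)) < size h)%N.
Proof.
rewrite /reduce; elim: s => [|b s [IH1 IH2]] /=.
  by rewrite size_poly0 (ltnW modulus_size_gt1).
rewrite rev_cons foldl_rcons; have [-> ->] := mod_step_spec b IH2; split=> //.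
by rewrite /= !in_fieldD !in_fieldM IH1.
Qed.

Lemma trim_reduce s : trim (reduce hb s) = bits (inF (bits_poly s)).
Proof.
have [<- small] := reduce_spec s.
by rewrite in_field_small // bits_bits_poly.
Qed.

Lemma enc_seq_map (A B : Type) (e : B -> seq bool) (g : A -> B) s :
  enc_seq e [seq g x | x <- s] = enc_seq (e \o g) s.
Proof. by rewrite /enc_seq -map_comp. Qed.

Lemma enc_poly2E (p : {poly 'F_2}) : enc_poly2 p = enc_bits (bits p).
Proof. by rewrite /enc_bits /bits enc_seq_map. Qed.

Lemma enc_fieldE (c : k) : enc_field c = enc_bits (bits c).
Proof. exact: enc_poly2E. Qed.

Lemma enc_polyE (p : {poly k}) :
  enc_poly (@enc_field h hI) p = enc_seq enc_bits [seq bits c | c : k <- p].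
Proof.
rewrite enc_seq_map /enc_poly; congr enc_seq; apply/funext => c.
exact: enc_fieldE.
Qed.
End Reduction.

Fixpoint rstrip (rs : seq (seq bool)) :=
  if rs is r :: rs' then
    if rstrip rs' is [::] then (if r is [::] then [::] else [:: r])
    else r :: rstrip rs'
  else [::].

(** The held back zeros, counted by z, precede those of the list; they only show
    up when a nonzero coefficient follows. *)
Lemma push_coef_rstrip rs o z : (foldl push_coef (o, z) rs).1 =
  if rstrip rs is [::] then o
  else catrev (flatten [seq true :: enc_bits r | r <- nseq (size z) [::] ++ rstrip rs]) o.
Proof.
have flz n o' : flushz n o' = catrev (flatten [seq true :: enc_bits r | r <- nseq n [::]]) o'.
  by elim: n o' => // n IH o'; rewrite /flushz iterSr; apply: IH.
have snoc n (l : seq (seq bool)) : nseq n.+1 [::] ++ l = nseq n [::] ++ [::] :: l.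
  by elim: n => //= n ->.
elim: rs o z => [|r rs IH] o z //=.
rewrite {1}/push_coef; case: r => [|b r]; rewrite IH.
  by case: (rstrip rs) => [|r' rs'] //=; rewrite -snoc.
have codeE l u : catrev (flatten [seq true :: enc_bits r0 | r0 <- nseq (size z) [::] ++ (b :: r) :: l]) u
   = catrev (flatten [seq true :: enc_bits r0 | r0 <- l])
       (catrev (enc_bits (b :: r)) (true :: flushz (size z) u)).
  by rewrite map_cat flatten_cat catrev_catl -flz /= catrev_catl.
by case: (rstrip rs) => [|r' rs']; rewrite codeE.
Qed.

Lemma coef_textE rs : coef_text rs = enc_seq enc_bits (rstrip rs).
Proof.
rewrite /coef_text push_coef_rstrip /enc_seq; case E: (rstrip rs) => [|r rs'] //.
by rewrite catrevE cats0 rev_cons revK cats1.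
Qed.

Lemma emit_residues (h : {poly 'F_2}) (hI : monic_irreducible_poly h) d g :
  coef_text (residues (bits h) d g) =
  enc_poly (@enc_field h hI) (Poly [seq in_field hI (bits_poly b) | b <- chop (size g) d g]).
Proof.
rewrite coef_textE enc_polyE; congr enc_seq; rewrite /residues.
elim: (chop _ _ _) => [|b bs IH] /=; first by rewrite polyseq0.
rewrite IH trim_reduce polyseq_cons; move: (in_field hI (bits_poly b)) => c.
case E: (Poly _ : seq _) => [|c' cs] //=.
rewrite polyseqC; have -> : (c != 0) = (bits c != [::]).
  by rewrite -size_eq0 size_bits size_poly_eq0.
by case E': (bits c) => [|b' l] //=; rewrite E'.
Qed.

(** * Kronecker substitution *)

Section Kronecker.
Local Notation R := {poly 'F_2}.
Local Notation RT := {poly {poly 'F_2}}.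
Implicit Types (P Q : RT) (d m : nat).

(** The constant coefficient is a multiple of X^d of degree less than d. *)
Lemma kronecker_eq0 d P : (forall j, (size (P`_j)%R <= d)%N) -> P.['X^d] = 0 -> P = 0.
Proof.
elim/poly_ind: P => [//|P c IH] sPc.
have sc : (size c <= d)%N by have := sPc 0; rewrite coefD coefMX coefC add0r.
have sP j : (size (P`_j)%R <= d)%N by have := sPc j.+1; rewrite coefD coefMX coefC addr0.
rewrite hornerMXaddC => e; have [q0|q0] := eqVneq P.['X^d] 0.
  by move: e; rewrite q0 mul0r add0r IH // mul0r add0r => ->.
move/eqP: e; rewrite addr_eq0 => /eqP/(congr1 (fun p : R => size p)).
rewrite size_polyN size_mulXn // => e; move: sc.
by rewrite -e -[leqRHS]addn0 leq_add2l leqn0 size_poly_eq0 (negPf q0).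
Qed.

Lemma kronecker_inj d P Q : (forall j, (size (P`_j)%R <= d)%N) ->
  (forall j, (size (Q`_j)%R <= d)%N) -> P.['X^d] = Q.['X^d] -> P = Q.
Proof.
move=> sP sQ e; apply/eqP; rewrite -subr_eq0; apply/eqP; apply: (@kronecker_eq0 d).
  by move=> j; rewrite coefB (leq_trans (size_polyD _ _)) // size_polyN geq_max sP sQ.
by rewrite hornerD hornerN e subrr.
Qed.

Lemma horner_chop fuel d g : (0 < d)%N -> (size g <= fuel)%N ->
  (Poly [seq bits_poly b | b <- chop fuel d g]).['X^d] = bits_poly g.
Proof.
move=> d0; elim: fuel g => [|fuel IH] [|x g] //= gf; rewrite ?horner0 //.
set b := take d _; set g' := drop d _.
rewrite horner_cons IH; last by rewrite size_drop /=; move: gf; case: (d) d0 => //; lia.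
rewrite -[bits_poly g * 'X + _]/(bits_poly (x :: g)) -(cat_take_drop d (x :: g)) bits_poly_cat -/b -/g'.
rewrite addrC mulrC; have [gd|dg] := leqP (size (x :: g)) d.
  by rewrite /g' drop_oversize //= !mulr0.
by rewrite /b size_takel // ltnW.
Qed.

Lemma size_chop fuel d g b : b \in chop fuel d g -> (size b <= d)%N.
Proof.
elim: fuel g => [|fuel IH] [|x g] //=; rewrite inE => /orP[/eqP->|/IH//].
by rewrite size_take_min geq_minl.
Qed.

Lemma chop_kronecker d g P : (0 < d)%N -> (forall j, (size (P`_j)%R <= d)%N) ->
  bits_poly g = P.['X^d] -> Poly [seq bits_poly b | b <- chop (size g) d g] = P.
Proof.
move=> d0 sP gP; apply: (@kronecker_inj d) => // [j|]; last by rewrite horner_chop.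
rewrite coef_Poly; have [jn|nj] := ltnP j (size (chop (size g) d g)).
  rewrite (nth_map [::]) // (leq_trans (size_bits_poly _)) //.
  by apply: size_chop; apply: mem_nth.
by rewrite nth_default ?size_map // size_poly0.
Qed.

(** The degree in X, the inner variable. *)
Definition xdeg_le m P := forall j, (size (P`_j)%R <= m.+1)%N.

Lemma xdeg_leD m P Q : xdeg_le m P -> xdeg_le m Q -> xdeg_le m (P + Q).
Proof. by move=> hP hQ j; rewrite coefD (leq_trans (size_polyD _ _)) // geq_max hP hQ. Qed.

Lemma xdeg_leM m n P Q : xdeg_le m P -> xdeg_le n Q -> xdeg_le (m + n) (P * Q).
Proof.
move=> hP hQ j; rewrite coefM; apply: (leq_trans (size_sum _ _ _)).
apply/bigmax_leqP => i _; apply: leq_trans (size_polyMleq _ _) _.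
by have := hP i; have := hQ (j - i)%N; lia.
Qed.

Lemma xdeg_leW m n P : (m <= n)%N -> xdeg_le m P -> xdeg_le n P.
Proof. by move=> mn hP j; rewrite (leq_trans (hP j)). Qed.

Lemma xdeg_leC m (c : R) : (size c <= m.+1)%N -> xdeg_le m c%:P.
Proof. by move=> h j; rewrite coefC; case: ifP; rewrite ?size_poly0. Qed.

Lemma xdeg_leXn n : xdeg_le 0 'X^n.
Proof. by move=> j; rewrite coefXn; case: eqP; rewrite ?size_poly0 ?size_poly1. Qed.

Definition coefs_poly (cs : seq (seq bool)) : RT := Poly [seq bits_poly c | c <- cs].

Lemma bits_poly_flatten_padded d cs : all (fun c => size c <= d)%N cs ->
  bits_poly (flatten_padded d cs) = (coefs_poly cs).['X^d].
Proof.
elim: cs => [|c cs IH] /=; first by rewrite horner0.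
case/andP=> cd /IH; rewrite /flatten_padded /= bits_poly_cat bits_poly_padto => ->.
rewrite /coefs_poly /= horner_cons size_cat size_nseq subnKC //.
by rewrite addrC mulrC.
Qed.

Lemma xdeg_coefs_poly cs : xdeg_le (sumn (map size cs)) (coefs_poly cs).
Proof.
move=> j; rewrite coef_Poly; elim: cs j => [|c cs IH] [|j] /=; rewrite ?nth_nil ?size_poly0 //.
  by rewrite (leq_trans (size_bits_poly _)) // leqW // leq_addr.
by rewrite (leq_trans (IH j)) // ltnS leq_addl.
Qed.

(** The update of the program before the substitution t -> X^d. *)
Definition bivariate_step (S : RT * RT) (o : option (seq (seq bool))) :=
  if o is Some cs then
    (coefs_poly cs * S.1 + 'X^(size cs) * S.2, coefs_poly cs * S.2)
  else S.

Lemma place_step_kronecker d s S os : all (small_place d d) os ->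
  bits_poly s.1 = S.1.['X^d] -> bits_poly s.2 = S.2.['X^d] ->
  bits_poly (foldl (place_option_step d) s os).1 = (foldl bivariate_step S os).1.['X^d] /\
  bits_poly (foldl (place_option_step d) s os).2 = (foldl bivariate_step S os).2.['X^d].
Proof.
elim: os s S => [|[cs|] os IH] s S //=; last exact: IH.
case/andP=> /and3P[cd _ _] sos h1 h2; apply: IH => //=.
  by rewrite bits_poly_xorl bits_poly_horner_mul bits_poly_shift bits_poly_flatten_padded // h1 h2 hornerD !hornerM hornerXn exprM.
by rewrite bits_poly_horner_mul bits_poly_flatten_padded // h2 hornerM.
Qed.

Definition bit_count (o : option (seq (seq bool))) :=
  if o is Some cs then sumn (map size cs) else 0%N.

Lemma xdeg_bivariate_step m S os : xdeg_le m S.1 -> xdeg_le m S.2 ->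
  xdeg_le (m + sumn (map bit_count os)) (foldl bivariate_step S os).1 /\
  xdeg_le (m + sumn (map bit_count os)) (foldl bivariate_step S os).2.
Proof.
elim: os m S => [|[cs|] os IH] m S /= h1 h2; first by rewrite addn0.
  rewrite addnA; apply: IH => /=; rewrite addnC.
    apply: xdeg_leD; first by apply: xdeg_leM => //; apply: xdeg_coefs_poly.
    apply: (@xdeg_leW (0 + m)); first by rewrite leq_add2r.
    by apply: xdeg_leM => //; apply: xdeg_leXn.
  by apply: xdeg_leM => //; apply: xdeg_coefs_poly.
by rewrite add0n; apply: IH.
Qed.

Lemma bits_poly_deriv s : bits_poly (deriv_bits s) = (bits_poly s)^`().
Proof.
have [n] := ubnP (size s); elim: n s => // n IH [|a [|b x]] xn.
- by rewrite /= deriv0.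
- by rewrite /= mul0r add0r derivC.
rewrite [deriv_bits _]/= ![bits_poly (_ :: _)]/= IH; last by move: xn => /=; lia.
rewrite !(derivD, derivM, derivX, derivC) polyC0.
apply: (eq_mod2 (poly_pchar2 F2_pchar2) (z := - (bits_poly x * 'X))).
by ring.
Qed.

End Kronecker.

(** * The algebra that the program writes *)

Lemma partial_fraction_step (K : fieldType) (f q x y s : K) : f != 0 ->
  f * (q * x * s) + x * y * q = f * q * x * (s + y / f).
Proof. by move=> f0; field. Qed.

Lemma cancel_fraction (K : fieldType) (z r y q x : K) (s : K) :
  r * y = z -> y != 0 -> q != 0 -> x != 0 ->
  z * (q * x * s) / (x * (y * q)) = r * s.
Proof. by move=> <- y0 q0 x0; field; rewrite y0 q0 x0. Qed.

Section Output.
Variables (h : {poly 'F_2}) (hI : monic_irreducible_poly h).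
Local Notation k := {poly %/ h with hI}.
Local Notation inF := (in_field hI).
Local Notation mapF := (map_poly inF).
Local Notation F := (ratfun k).
Local Notation t := ('X%:F : F).

Definition place_bits (v : place k) : option (seq (seq bool)) :=
  if v is Some f then Some [seq bits (c : k) | c <- sval f] else None.

Lemma enc_inputE (vs : seq (place k)) :
  enc_input vs = enc_bits (bits h) ++ enc_seq enc_place_bits [seq place_bits v | v <- vs].
Proof.
rewrite /enc_input enc_poly2E enc_seq_map; congr (_ ++ enc_seq _ _).
by apply/funext => -[f|] //=; rewrite enc_polyE.
Qed.

Lemma map_coefs_poly (f : {poly k}) : mapF (coefs_poly [seq bits (c : k) | c <- f]) = f.
Proof.
apply/polyP => i; rewrite coef_map /= coef_Poly -map_comp.
have [fi|fi] := ltnP i (size f); last by rewrite !nth_default ?size_map // rmorph0.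
by rewrite (nth_map 0) //= bitsK in_fieldK.
Qed.

(** The update of the program with coefficients in F_q. *)
Definition fraction_step (S : {poly k} * {poly k}) (v : place k) :=
  if v is Some f then (sval f * S.1 + 'X^(size (sval f)) * S.2, sval f * S.2) else S.

Lemma map_bivariate_step S vs : (mapF (foldl bivariate_step S (map place_bits vs)).1,
    mapF (foldl bivariate_step S (map place_bits vs)).2) =
  foldl fraction_step (mapF S.1, mapF S.2) vs.
Proof.
elim: vs S => [|[[f fP]|] vs IH] S //=; rewrite IH //=.
by rewrite rmorphD !rmorphM rmorphXn /= map_polyX map_coefs_poly size_map.
Qed.

(** P / (t Q) is the sum of the terms of the places that have been read. *)
Lemma foldl_fraction_step S vs (S0 : F) : S.2 != 0 -> S.1%:F = S.2%:F * t * S0 ->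
  (foldl fraction_step S vs).2 != 0 /\
  (foldl fraction_step S vs).1%:F =
    (foldl fraction_step S vs).2%:F * t * (S0 + \sum_(v <- vs) place_term v).
Proof.
elim: vs S S0 => [|[[f fP]|] vs IH] S S0 S20 SE; first by rewrite big_nil addr0.
  have f0 : f != 0 by case/andP: (fP) => /monic_neq0.
  have fF0 : f%:F != 0 by rewrite tofrac_eq0.
  rewrite big_cons addrA; apply: IH => /=; first by rewrite mulf_neq0.
  have sf : size f = (size f).-1.+1 by rewrite prednK // size_poly_gt0.
  rewrite tofracD !tofracM SE tofracXn [in X in t ^+ X]sf exprS.
  exact: partial_fraction_step.
by rewrite big_cons add0r; apply: IH.
Qed.

Lemma map_polyPoly (s : seq {poly 'F_2}) : mapF (Poly s) = Poly [seq inF c | c <- s].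
Proof.
apply/polyP => i; rewrite coef_map /= !coef_Poly.
have [si|si] := ltnP i (size s); first by rewrite (nth_map 0).
by rewrite !nth_default ?size_map // rmorph0.
Qed.

Lemma emit_kronecker d g (G : {poly {poly 'F_2}}) m : (m < d)%N -> xdeg_le m G ->
  bits_poly g = G.['X^d] -> coef_text (residues (bits h) d g) = enc_poly (@enc_field h hI) (mapF G).
Proof.
move=> md Gm gG; rewrite (emit_residues hI) (map_comp inF) -map_polyPoly.
rewrite (@chop_kronecker d g G) //; first by apply: leq_ltn_trans md.
by move=> j; rewrite (leq_trans (Gm j)).
Qed.

Lemma bits1 : bits (1 : k) = [:: true].
Proof.
have -> : (1 : k) = inF 1 by rewrite in_field1.
by rewrite in_field_small ?size_poly1 ?(modulus_size_gt1 hI) // /bits polyseq1.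
Qed.

Lemma text_of_bE : text_of_b =
  enc_poly (@enc_field h hI) 'X ++ enc_poly (@enc_field h hI) 1.
Proof.
rewrite !enc_polyE polyseqX polyseq1 /= bits1.
by rewrite {1}/bits polyseq0.
Qed.

Lemma fraction_identity (p q : {poly k}) (x y : k) (S : F) :
  y != 0 -> q != 0 -> p%:F = q%:F * t * S ->
  (x%:P * p)%:F / ('X * (y%:P * q))%:F = (x / y)%:P%:F * S.
Proof.
move=> y0 q0 pE; rewrite !tofracM pE.
have xy : (x / y)%:P%:F * y%:P%:F = x%:P%:F :> F by rewrite -tofracM -polyCM divfK.
have yF : y%:P%:F != 0 :> F by rewrite tofrac_eq0 polyC_eq0.
have qF : q%:F != 0 by rewrite tofrac_eq0.
have tF : t != 0 by rewrite tofrac_eq0 monic_neq0 ?monicX.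
exact: (cancel_fraction S xy yF qF tF).
Qed.

Lemma output_correct (vs : seq (place k)) d (os := map place_bits vs) :
  uniq vs -> ~~ odd (size vs) -> all (small_place d d) os ->
  (size h + sumn (map bit_count os) < d)%N ->
  let s := foldl (place_option_step d) ([::], [:: true]) os in
  exists a b : F, [/\ enc_output a b
      (coef_text (residues (bits h) d (final_P (bits h) s.1)) ++
        coef_text (residues (bits h) d (final_Q (bits h) d s.2)) ++ text_of_b),
    b != 0 & forall v, ramified a b v <-> v \in vs].
Proof.
move=> uvs evs sos dM s; have h1 := modulus_size_gt1 hI.
pose S := foldl bivariate_step (0, 1) os; pose K := foldl fraction_step (0, 1) vs.
have [sS1 sS2] : bits_poly s.1 = S.1.['X^d] /\ bits_poly s.2 = S.2.['X^d].
  apply: place_step_kronecker => //=; first by rewrite horner0.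
  by rewrite mul0r add0r polyC1 hornerC.
have [x1 x2] : xdeg_le (sumn (map bit_count os)) S.1 /\ xdeg_le (sumn (map bit_count os)) S.2.
  apply: (@xdeg_bivariate_step 0 (0, 1)); last by rewrite /= -(expr0 'X); apply: xdeg_leXn.
  by move=> j; rewrite coef0 size_poly0.
have SK : (mapF S.1, mapF S.2) = K.
  by rewrite /S /os map_bivariate_step /= rmorph0 rmorph1.
have [K0 KE] : K.2 != 0 /\ K.1%:F = K.2%:F * t * \sum_(v <- vs) place_term v.
  rewrite -[X in _ * X]add0r; apply: foldl_fraction_step => /=; first exact: oner_neq0.
  by rewrite tofrac0 mulr0.
have [SK1 SK2] : mapF S.1 = K.1 /\ mapF S.2 = K.2 by rewrite -SK.
pose p := (inF 'X^((size h).-2))%:P * K.1; pose q := 'X * ((inF h^`())%:P * K.2).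
have hd0 := in_field_deriv_neq0 hI.
have q0 : q != 0 by rewrite !mulf_neq0 ?polyC_eq0 // monic_neq0 ?monicX.
have pE : coef_text (residues (bits h) d (final_P (bits h) s.1)) = enc_poly (@enc_field h hI) p.
  rewrite (@emit_kronecker d _ (('X^((size h).-2))%:P * S.1) ((size h).-2 + sumn (map bit_count os))).
  - by rewrite rmorphM /= map_polyC SK1.
  - by apply: leq_ltn_trans dM; rewrite leq_add2r; lia.
  - by apply: xdeg_leM => //; apply: xdeg_leC; rewrite size_polyXn.
  by rewrite /final_P bits_poly_shift size_bits subn2 sS1 hornerM hornerC.
have qE : coef_text (residues (bits h) d (final_Q (bits h) d s.2)) = enc_poly (@enc_field h hI) q.
  rewrite (@emit_kronecker d _ ('X * ((h^`())%:P * S.2)) (0 + (size h + sumn (map bit_count os)))).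
  - by rewrite !rmorphM /= map_polyX map_polyC SK2.
  - by rewrite add0n.
  - apply: xdeg_leM; first exact: (xdeg_leXn 1).
    apply: xdeg_leM => //; apply: xdeg_leC; rewrite ltnW // ltnS (leq_trans (size_poly _ _)) //.
    exact: leq_pred.
  by rewrite /final_Q bits_poly_shift bits_poly_horner_mul bits_poly_deriv bitsK sS2 !hornerM hornerX hornerC.
exists (p%:F / q%:F), ('X%:F / 1%:F); rewrite pE qE text_of_bE tofrac1 divr1; split.
- exists p, q, 'X, 1; split=> //; first exact: oner_neq0.
  by rewrite tofrac1 divr1.
- by rewrite tofrac_eq0 monic_neq0 ?monicX.
move=> v; rewrite (fraction_identity _ hd0 K0 KE).
apply: (ramified_place_sum (field_pchar2 hI) (field_perfect (hI := hI))) => //.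
exact: trace_one_not_artin_schreier.
Qed.
End Output.

(** * The size of the input, and the theorem *)

Lemma size_enc_seq (A : Type) (e : A -> seq bool) (xs : seq A) :
  size (enc_seq e xs) = (sumn [seq (size (e x)).+1 | x <- xs]).+1.
Proof.
elim: xs => [|x xs IH] //.
by rewrite enc_seq_cons /= size_cat IH; lia.
Qed.

Lemma sumn_le (A : eqType) (u v : A -> nat) (s : seq A) :
  {in s, forall x, (u x <= v x)%N} -> (sumn (map u s) <= sumn (map v s))%N.
Proof.
elim: s => //= x s IH h; rewrite leq_add ?h ?mem_head //.
by apply: IH => y ys; apply: h; rewrite inE ys orbT.
Qed.

Lemma size_enc_place_bits (o : option (seq (seq bool))) :
  size (enc_place_bits o) = if o is Some cs then (2 * size cs + 2 * sumn (map size cs) + 2)%N else 1%N.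
Proof.
case: o => [cs|] //=; rewrite size_enc_seq -addn2; congr (_ + _)%N.
by elim: cs => [|c cs /= ->] //=; rewrite size_enc_bits; lia.
Qed.

Lemma leq_sumn (A : eqType) (u : A -> nat) (s : seq A) x :
  x \in s -> (u x <= sumn (map u s))%N.
Proof.
elim: s => //= y s IH; rewrite inE => /orP[/eqP->|/IH h]; first exact: leq_addr.
by rewrite (leq_trans h) // leq_addl.
Qed.

Lemma small_places os d : (size (enc_seq enc_place_bits os) <= d)%N -> all (small_place d d) os.
Proof.
move=> sd; apply/allP => -[cs|] // oos /=.
have h : ((size (enc_place_bits (Some cs))).+1 < size (enc_seq enc_place_bits os))%N.
  by rewrite size_enc_seq ltnS; apply: (leq_sumn (fun o => (size (enc_place_bits o)).+1)) oos.
rewrite size_enc_place_bits /= in h.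
set n := sumn _ in h *; have nd : (n <= d)%N by lia.
rewrite nd andbT; apply/andP; split; last by lia.
apply/allP => c cs_c; apply: leq_trans nd; exact: (leq_sumn size).
Qed.

(** The constant is a variable here because the numeral that is substituted for it
    is too large to be computed in unary. *)
Lemma exists_poly_nat (C e : nat) : exists B : {poly nat},
  forall n, B.[n] = (C * n.+1 ^ e)%N.
Proof.
exists (C%:P * ('X + 1%:P) ^+ e) => n.
rewrite hornerM hornerC horner_exp hornerD hornerX hornerC.
by rewrite -[n.+1]addn1; congr (_ * _)%N; elim: e => // e IH; rewrite exprS expnS IH.
Qed.

Lemma size_enc_field_bits (h : {poly 'F_2}) (hI : monic_irreducible_poly h)
    (c : {poly %/ h with hI}) : (size (bits c) < size h)%N.
Proof. by rewrite size_bits; have := @size_in_field _ hI c; rewrite in_fieldK. Qed.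

(** A coefficient takes at most 2 k + 2 bits, and there are deg f + 1 of them for a
    place f. *)
Lemma enc_input_size (h : {poly 'F_2}) (hI : monic_irreducible_poly h) n
    (vs : seq (place {poly %/ h with hI})) : size h = n.+1 ->
  (size (enc_input vs) <= 4 * ((input_size n vs).+1 * (input_size n vs).+1))%N.
Proof.
move=> hn; rewrite enc_inputE size_cat size_enc_bits size_bits hn size_enc_seq -map_comp.
rewrite /input_size; set D := (\sum_(v <- vs) place_degree v)%N.
have : (sumn [seq (size (enc_place_bits (place_bits v))).+1 | v <- vs]
    <= (D + size vs) * (2 * n + 2) + 3 * size vs)%N.
  rewrite /D; elim: vs {D} => [|v vs IH] /=; first by rewrite big_nil.
  rewrite big_cons; apply: leq_trans (leq_add (leqnn _) IH) _.
  suff : ((size (enc_place_bits (place_bits v))).+1 <= (place_degree v + 1) * (2 * n + 2) + 3)%N by lia.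
  case: v => [[f fP]|]; last by rewrite /=; lia.
  rewrite size_enc_place_bits /= size_map.
  have f0 : (0 < size f)%N by rewrite size_poly_gt0 monic_neq0 //; case/andP: (fP).
  have -> : ((size f).-1 + 1)%N = size f by rewrite addn1 prednK.
  set s := sumn _; suff : (s <= size f * n)%N by move: (size f) => m; lia.
  rewrite /s; elim: (f : seq _) => //= c cs IHc.
  by rewrite mulSn leq_add // -ltnS -hn size_enc_field_bits.
move: (sumn _) (size vs) => s l; nia.
Qed.

Lemma place_weights (h : {poly 'F_2}) (hI : monic_irreducible_poly h) n
    (vs : seq (place {poly %/ h with hI})) :
  (sumn (map coef_count (map (@place_bits h hI) vs)) <= input_size n vs)%N.
Proof.
rewrite /input_size -addnA; apply: leq_trans (leq_addl _ _).
elim: vs => [|[[f fP]|] vs IH] //=; rewrite big_cons /=; last by lia.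
rewrite size_map; apply: leq_trans (leq_add (leqSpred _) IH) _.
by rewrite !addSn ltnS addnCA.
Qed.

Lemma ninth_power (a b c m : nat) : let M := (c * (m * (m * m)))%N in
  (a * (b * (c * (c * c))) * m ^ 9 = a * (b * (M * (M * M))))%N.
Proof. by move=> M; rewrite /M; ring. Qed.

Theorem proposition3p21 :
  exists (P : program) (B : {poly nat}),
  forall (k : nat) (h : {poly 'F_2}) (hI : monic_irreducible_poly h),
  size h = k.+1 ->
  forall vs : seq (place {poly %/ h with hI}),
  uniq vs -> ~~ odd (size vs) ->
  expected_time_le P (enc_input vs) B.[input_size k vs] /\
  forall y, may_output P (enc_input vs) y ->
    exists a b : ratfun {poly %/ h with hI},
      [/\ enc_output a b y, b != 0 &
          forall v, ramified a b v <-> v \in vs].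
Proof.
(* The stacks are bounded by M = 5 (n + 1)^3, the time by a constant times M^3. *)
have [B BE] := exists_poly_nat (200 * (100 * (5 * (5 * 5)))) 9.
exists Main, B => k h hI hk vs uvs evs; rewrite BE.
have := enc_input_size vs hk; have := place_weights k vs.
move: (input_size k vs) => n; rewrite enc_inputE.
set os := map _ vs; set w := _ ++ _; move=> wt wn.
have wE : size w = (2 * size h + 1 + size (enc_seq enc_place_bits os))%N.
  by rewrite size_cat size_enc_bits size_bits.
have h1 := modulus_size_gt1 hI.
have sos : all (small_place (size w) (size w)) os by apply: small_places; lia.
have osw : (size os <= size w)%N.
  rewrite wE size_enc_seq; apply: leq_trans (leq_addl _ _); apply: leqW.
  by elim: os {w wt wn wE sos} => //= o os IH; lia.
have ow : (size h + sumn (map bit_count os) < size w)%N.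
  rewrite wE size_enc_seq.
  suff : (sumn (map bit_count os) <= sumn [seq (size (enc_place_bits x)).+1 | x <- os])%N by lia.
  by apply: sumn_le => -[cs|] _ //; rewrite size_enc_place_bits /bit_count; set m := sumn _; lia.
pose M := (5 * (n.+1 * (n.+1 * n.+1)))%N.
have MP : (1 + size w * sumn (map coef_count os) + size w <= M)%N.
  have wM : (size w * (sumn (map coef_count os)).+1 <= 4 * (n.+1 * n.+1) * n.+1)%N by apply: leq_mul.
  have n1 : (0 < n.+1 * (n.+1 * n.+1))%N by rewrite !muln_gt0.
  have e : (4 * (n.+1 * n.+1) * n.+1 = 4 * (n.+1 * (n.+1 * n.+1)))%N by rewrite -!mulnA.
  rewrite e in wM; rewrite /M; move: (n.+1 * (n.+1 * n.+1))%N n1 wM => N3.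
  by rewrite mulnS; lia.
have hb1 : (1 < size (bits h))%N by rewrite size_bits.
have [l mainE] := Main_spec hb1 sos MP osw.
split.
  by rewrite ninth_power -/M; exact: expected_time_exec mainE.
move=> y /(may_output_exec mainE) ->; exact: output_correct.
Qed.
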